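(* Let $p,q>1$ and let $\alpha,\beta$ be real. (1) If $\alpha<2$, $\beta<1$ and $x\in(0,\pi_{p,q}/2]$, then $$\int_0^x\frac{t\,\sin_{p,q}^{-\alpha}(t)\cos_{p,q}(t)}{(\sin_{p,q}^q(x)-\sin_{p,q}^q(t))^\beta}\,dt=\frac1q B\!\left(\tfrac{2-\alpha}{q},1-\beta\right)\sin_{p,q}^{2-\alpha-q\beta}(x)\;{}_3F_2\!\left(\tfrac1p,\tfrac{2-\alpha}{q},\tfrac1q;\;\tfrac{2-\alpha}{q}+1-\beta,\tfrac1q+1;\;\sin_{p,q}^q(x)\right).$$ (2) If $\alpha<1$, $\beta<1$ and $x\in[0,\pi_{p,q}/2)$, then $$\int_x^{\pi_{p,q}/2}\frac{t\,\sin_{p,q}^{q-1}(t)\cos_{p,q}^{2-p-\alpha}(t)}{(\cos_{p,q}^p(x)-\cos_{p,q}^p(t))^\beta}\,dt=\frac{\cos_{p,q}^{1-\alpha-p\beta}(x)}{q^2}B\!\left(\tfrac{p-1}{p},\tfrac1q\right)B\!\left(\tfrac{1-\alpha}{p},1-\beta\right)$$ $$\qquad-\frac{p\cos_{p,q}^{p(1-\beta)-\alpha}(x)}{q^2(p-1)}B\!\left(1-\tfrac\alpha p,1-\beta\right){}_3F_2\!\left(1-\tfrac1q,1-\tfrac\alpha p,\tfrac{p-1}{p};\;2-\tfrac\alpha p-\beta,\tfrac{2p-1}{p};\;\cos_{p,q}^p(x)\right).$$ (3) If $q\alpha>-1$, $q(\alpha-\beta)-\min(1,q/p)<-1$, and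 $x\in(0,\hat\pi_{p,q}/2)$ satisfies $\sinh_{p,q}(x)\le1$, then $$\int_0^{\hat\pi_{p,q}/2}\frac{t\cosh_{p,q}(t)\sinh_{p,q}^{\alpha q-1}(t)}{(\sinh_{p,q}^q(x)+\sinh_{p,q}^q(t))^\beta}\,dt$$ $$=\frac{\sinh_{p,q}^{q(\alpha-\beta)+1}(x)}{q}B\!\left(\alpha+\tfrac1q,\beta-\alpha-\tfrac1q\right){}_3F_2\!\left(\tfrac1p,\alpha+\tfrac1q,\tfrac1q;\;\alpha-\beta+\tfrac1q+1,\tfrac1q+1;\;\sinh_{p,q}^q(x)\right)$$ $$\quad+\frac{B\!\left(\alpha-\beta+\frac1q,\beta-\alpha+\frac1p-\frac1q\right)}{q^2(\beta-\alpha)}\,{}_3F_2\!\left(\beta,\beta-\alpha+\tfrac1p-\tfrac1q,\beta-\alpha;\;\beta-\alpha-\tfrac1q+1,\beta-\alpha+1;\;\sinh_{p,q}^q(x)\right).$$ (4) If $p<q$, $\beta<1$, $(\alpha+\beta)p>1$ and $x\in[0,\hat\pi_{p,q}/2)$, then $$\int_x^{\hat\pi_{p,q}/2}\frac{t\,\sinh_{p,q}^{q-1}(t)\cosh_{p,q}^{2-p(\alpha+1)}(t)}{(\cosh_{p,q}^p(t)-\cosh_{p,q}^p(x))^\beta}\,dt=\frac{\cosh_{p,q}^{1-p(\alpha+\beta)}(x)}{q^2}B\!\left(\tfrac1p-\tfrac1q,\tfrac1q\right)B\!\left(1-\beta,\beta+\alpha-\tfrac1p\right)$$ $$\qquad+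\frac{\cosh_{p,q}^{p/q-p(\alpha+\beta)}(x)}{q(1-q/p)}B\!\left(\beta+\alpha-\tfrac1q,1-\beta\right){}_3F_2\!\left(1-\tfrac1q,\beta+\alpha-\tfrac1q,\tfrac1p-\tfrac1q;\;\alpha+1-\tfrac1q,\tfrac1p-\tfrac1q+1;\;\cosh_{p,q}^{-p}(x)\right).$$
   Context: ${}_3F_2(a_1,a_2,a_3;b_1,b_2;z)=\sum_{k\ge0}\frac{(a_1)_k(a_2)_k(a_3)_k}{(b_1)_k(b_2)_k}\frac{z^k}{k!}$ is the generalized hypergeometric function, where $(a)_k=a(a+1)\cdots(a+k-1)$, $(a)_0=1$. $B(a,b)=\Gamma(a)\Gamma(b)/\Gamma(a+b)$ is Euler's beta function, given by this Gamma-function formula also when an argument is negative. For $p,q>1$: $\arcsin_{p,q}(x)=\int_0^x(1-t^q)^{-1/p}\,dt$ for $0\le x\le1$; $\pi_{p,q}/2=\arcsin_{p,q}(1)$; $\sin_{p,q}:[0,\pi_{p,q}/2]\to[0,1]$ is the inverse of $\arcsin_{p,q}$; $\cos_{p,q}(y)=\frac{d}{dy}\sin_{p,q}(y)=(1-\sin_{p,q}^q(y))^{1/p}$ on $[0,\pi_{p,q}/2]$. $\operatorname{arcsinh}_{p,q}(x)=\int_0^x(1+t^q)^{-1/p}\,dt$ for $x\ge0$; $\hat\pi_{p,q}/2=\int_0^\infty(1+t^q)^{-1/p}\,dt\in(0,\infty]$ (finite exactly when $p<q$); $\sinh_{p,q}:[0,\hat\pi_{p,q}/2)\to[0,\infty)$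 is the inverse of $\operatorname{arcsinh}_{p,q}$; $\cosh_{p,q}(y)=\frac{d}{dy}\sinh_{p,q}(y)=(1+\sinh_{p,q}^q(y))^{1/p}$. Powers such as $\sin_{p,q}^a(t)$ mean $(\sin_{p,q}(t))^a$.
   Formalization: In part (3) it is also assumed that β−α−1/q is not a nonnegative integer (else a Gamma factor on the right has a pole) and, when sinh_{p,q}(x)=1, that β+1/p<2 (else both 3F2 series diverge); otherwise the right-hand side is undefined. *)

(* Defs.v *)
From mathcomp Require Import all_boot all_order all_algebra.
From mathcomp Require Import all_classical all_reals all_analysis.

(* Pitfall of [powR]: 0 `^ a = 0 for every a != 0, even a < 0, and 0 `^ 0 = 1.
   Such values only occur below at endpoints of integration ranges, which are
   Lebesgue-negligible. *)

Set Implicit Arguments.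
Unset Strict Implicit.
Unset Printing Implicit Defensive.
Import Order.TTheory GRing.Theory Num.Theory.
Import numFieldNormedType.Exports.
Local Open Scope classical_set_scope.
Local Open Scope ring_scope.

Section special_functions.
Context {R : realType}.
Notation mu := (@lebesgue_measure R).

Definition rising (a : R) (k : nat) : R := \prod_(i < k) (a + i%:R).

Definition hyper3F2 (a1 a2 a3 b1 b2 z : R) : R :=
  limn (series (fun k : nat =>
    rising a1 k * rising a2 k * rising a3 k / (rising b1 k * rising b2 k)
    * (z ^+ k / k`!%:R))).

(* Euler's integral, for 0 < s. *)
Definition Gamma_pos (s : R) : R :=
  \int[mu]_(t in `]0, +oo[) (t `^ (s - 1) * expR (- t)).

(* For s <= 0, Gamma s = Gamma (s + n) / (s (s + 1) ... (s + n - 1)), where n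
   is the least natural number with 0 < s + n.  At the poles 0, -1, -2, ...
   the denominator vanishes and the value is 0, so that / Gamma s = 0 there,
   which is the usual convention for the entire function 1 / Gamma. *)
Definition Gamma (s : R) : R :=
  if 0 < s then Gamma_pos s
  else let n := (Num.truncn (- s)).+1 in Gamma_pos (s + n%:R) / rising s n.

Definition Beta (a b : R) : R := Gamma a * Gamma b / Gamma (a + b).

(* Derivative of f at y relative to the domain D: one-sided at an endpoint
   of an interval D. *)
Definition derive_within (D : set R) (f : R -> R) (y : R) : R :=
  lim ((f z - f y) / (z - y) @[z --> within D y^']).

Definition arcsinpq (p q x : R) : R :=
  \int[mu]_(t in `[0, x]) (1 - t `^ q) `^ (- p^-1).

(* pi_{p,q} / 2 *)
Definition hpi (p q : R) : R := arcsinpq p q 1.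

Definition sinpq (p q : R) : R -> R :=
  'pinv_(fun=> 0) `[0, 1] (arcsinpq p q).

Definition cospq (p q : R) : R -> R :=
  derive_within `[0, hpi p q] (sinpq p q).

Definition arcsinhpq (p q x : R) : R :=
  \int[mu]_(t in `[0, x]) (1 + t `^ q) `^ (- p^-1).

(* \hat\pi_{p,q} / 2, possibly +oo *)
Definition hpihat (p q : R) : \bar R :=
  (\int[mu]_(t in `[0%R, +oo[) ((1 + t `^ q) `^ (- p^-1))%:E)%E.

Definition sinhpq (p q : R) : R -> R :=
  'pinv_(fun=> 0) `[0, +oo[ (arcsinhpq p q).

Definition coshpq (p q : R) : R -> R :=
  derive_within [set y | 0 <= y /\ (y%:E < hpihat p q)%E] (sinhpq p q).

End special_functions.

(* Main.v *)
Require Import Defs.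
From HB Require Import structures.
From mathcomp Require Import all_boot all_order all_algebra.
From mathcomp Require Import all_classical all_reals all_analysis.
From mathcomp Require Import measurable_realfun ring lra.
Set Implicit Arguments.
Unset Strict Implicit.
Unset Printing Implicit Defensive.
Import Order.TTheory GRing.Theory Num.Theory.
Import numFieldNormedType.Exports.
Local Open Scope classical_set_scope.
Local Open Scope ring_scope.

(** In each of the four integrals a power of sin, cos, sinh or cosh is a variable
    v in which t itself is an incomplete Beta integral, and in which dt and the
    weight are products of powers. Expanding the incomplete Beta integral by the
    binomial series and integrating termwise gives Beta integrals, and the ratios
    of consecutive terms are those of a 3F2.

    For the first integral v = sin^q t and t = q^-1 * ibeta q^-1 (1 - p^-1) v, and
    the whole computation is has_int_ibeta_weighted. For the second, v = cos^p t,
    and for the fourth, v = cosh^(- p) t; by the reflection formula of the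
    incomplete Beta integral (ibeta_reflect, arcsinh_ibeta) t is the complete
    integral minus an incomplete one, which explains the two terms. In these three
    cases all terms of the expansion are nonnegative and v stays in ]0, 1[.

    For the third integral v = sinh^q t runs over ]0, +oo[ and, with y = sinh^q x,
    the integrand is sbeta v * v^(alpha - 1) * (y + v)^(- beta), where
    sbeta v = int_0^v w^(q^-1 - 1) (1 + w)^(- p^-1) dw. For y < 1 the range is cut at
    a T between y and 1. Below T the function sbeta is expanded in powers of v, above
    T the factor (y + v)^(- beta) in powers of y / v. The integrals of the terms are
    again incomplete Beta integrals, and their own expansions (cvg_sbeta,
    cvg_sbeta_infinity) consist of powers of T and of a constant, a value of the
    Beta function continued to negative arguments; since beta - alpha - 1/q is not an
    integer, no logarithm occurs. The powers of T form the same double series on both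
    sides with opposite signs, so they cancel (iterated_series_swap), and the two
    series of constants are the two 3F2 (has_int_integrand_lt1, res1E, res2E). At
    y = 1 the hypothesis beta + 1/p < 2 is the condition for both 3F2 to converge
    absolutely at 1 (hyper_summable), and the formula follows by letting y tend to 1
    (has_int_integrand_hyper1).

    The Beta function is used with the convention 1/Gamma = 0 at the poles of Gamma,
    for which the functional equation of 1/Gamma holds everywhere (invGammaS); the
    ratio of Beta values that the 3F2 requires follows (Beta_shift). Finally sin and
    sinh are inverses of integrals and cos and cosh are their derivatives relative to
    an interval; derive_within_inverse computes these by squeezing difference
    quotients. *)

(** * Integrals with a value *)

Section has_integral.
Context {R : realType}.
Notation mu := (@lebesgue_measure R).
Implicit Types (D : set R) (f g : R -> R) (u v x y z : R).

Lemma mem_oo x y z : `]x, z[%classic y <-> x < y < z.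
Proof. by rewrite /= in_itv/=. Qed.

Lemma mem_oy x y : `]x, +oo[%classic y <-> x < y.
Proof. by rewrite /= in_itv/= andbT. Qed.

(** The integral has a value for functions that are not measurable too; together
    with integrability, values can be added, compared and restricted. *)
Definition has_int D f v : Prop :=
  mu.-integrable D (EFin \o f) /\ (\int[mu]_(x in D) (f x)%:E)%E = v%:E.

Lemma has_int_uniq D f u v : has_int D f u -> has_int D f v -> u = v.
Proof. by move=> [_ e] [_ e2]; apply: EFin_inj; rewrite -e -e2. Qed.

Lemma has_int_meas D f v : has_int D f v -> measurable_fun D f.
Proof. by move=> [/integrableP [/measurable_EFinP]]. Qed.

Lemma has_int_ge0 D f v : measurable D -> measurable_fun D f ->
  (forall x, D x -> 0 <= f x) ->
  (\int[mu]_(x in D) (f x)%:E)%E = v%:E -> has_int D f v.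
Proof.
move=> mD mf f0 e; split => //; apply/integrableP; split.
  exact/measurable_EFinP.
rewrite (_ : (\int[mu]_(x in D) _)%E = v%:E) ?ltry// -e.
by apply: eq_integral => x; rewrite inE => /f0 fx; rewrite /= ger0_norm.
Qed.

Lemma has_int_eq D f g v : measurable D -> (forall x, D x -> f x = g x) ->
  has_int D f v -> has_int D g v.
Proof.
move=> mD fg [i e]; split.
  by apply: eq_integrable i => // x; rewrite inE => /fg /= ->.
by rewrite -e; apply: eq_integral => x; rewrite inE => /fg ->.
Qed.

Lemma has_int_scale D f k v : measurable D -> has_int D f v ->
  has_int D (fun x => k * f x) (k * v).
Proof.
move=> mD [i e]; split.
  by rewrite [X in integrable _ _ X](_ : _ = (fun x => k%:E * (EFin \o f) x)%E)//;
     exact: integrableZl.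
by under eq_integral do rewrite EFinM; rewrite integralZl// e.
Qed.

Lemma has_int_add D f g u v : measurable D -> has_int D f u -> has_int D g v ->
  has_int D (fun x => f x + g x) (u + v).
Proof.
move=> mD [i e] [j e']; split.
  by rewrite [X in integrable _ _ X](_ : _ = (EFin \o f) \+ (EFin \o g))%E//;
     exact: integrableD.
by under eq_integral do rewrite EFinD; rewrite integralD// e e'.
Qed.

Lemma has_int_sum D (f : nat -> R -> R) (v : nat -> R) n : measurable D ->
  (forall k, has_int D (f k) (v k)) ->
  has_int D (fun x => \sum_(0 <= k < n) f k x) (\sum_(0 <= k < n) v k).
Proof.
move=> mD fv; elim: n => [|n IH].
  rewrite big_nil; apply: (@has_int_eq _ (fun=> 0)) => //.
    by move=> x; rewrite big_nil.
  by split; [exact: integrable0 | rewrite integral0].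
rewrite big_nat_recr//=; apply: has_int_eq (has_int_add mD IH (fv n)) => //.
by move=> x _; rewrite big_nat_recr.
Qed.

Lemma has_int_le D f g u v : measurable D -> has_int D f u -> has_int D g v ->
  (forall x, D x -> f x <= g x) -> u <= v.
Proof.
move=> mD [i e] [j e'] fg; rewrite -lee_fin -e -e'.
by apply: le_integral => // x; rewrite inE => /fg; rewrite lee_fin.
Qed.

Lemma has_int_pos D f v : (forall x, D x -> 0 <= f x) -> has_int D f v -> 0 <= v.
Proof. by move=> f0 [_ e]; rewrite -lee_fin -e integral_ge0// => x /f0. Qed.

Lemma has_int_dom D f g v : measurable D -> measurable_fun D f -> has_int D g v ->
  (forall x, D x -> `|f x| <= g x) -> exists u, has_int D f u.
Proof.
move=> mD mf [i e] fg.
have jf : mu.-integrable D (EFin \o f).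
  apply: le_integrable i => //; first exact/measurable_EFinP.
  move=> x Dx /=; rewrite lee_fin (le_trans (fg _ Dx))// ler_norm//.
exists (\int[mu]_(x in D) f x); split => //.
by rewrite /Rintegral fineK//; exact: integrable_fin_num.
Qed.

Lemma has_int_sub D E f v : measurable D -> measurable E -> E `<=` D ->
  has_int D f v -> exists u, has_int E f u.
Proof.
move=> mD mE ED [i e].
have jf : mu.-integrable E (EFin \o f) by exact: integrableS i.
exists (\int[mu]_(x in E) f x); split => //.
by rewrite /Rintegral fineK//; exact: integrable_fin_num.
Qed.

Lemma has_int_union (D E F : set R) f u v : measurable D -> measurable E ->
  F = D `|` E -> D `&` E = set0 ->
  has_int D f u -> has_int E f v -> has_int F f (u + v).
Proof.
move=> mD mE -> DE [i e] [j e'].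
have [mi fi] := integrableP _ _ _ i; have [mj fj] := integrableP _ _ _ j.
have mf : measurable_fun (D `|` E) (EFin \o f) by exact/measurable_funU.
have dDE : [disjoint D & E] by apply/disj_set2P.
split; last by rewrite integral_setU// e e'.
apply/integrableP; split => //.
rewrite ge0_integral_setU//; first exact: lte_add_pinfty.
exact: measurableT_comp.
Qed.

Lemma has_int_oc y f V : has_int `]0, y[ f V -> has_int `]0, y] f V.
Proof.
move=> h; have mf := has_int_meas h; have [/integrableP[m i] e] := h.
have mf' : measurable_fun (`]0, y]%classic : set R) f.
  by apply/measurable_fun_itv_bndo_bndcP.
split; last by rewrite -integral_itv_bndo_bndc.
apply/integrableP; split; first exact/measurable_EFinP.
rewrite -(integral_itv_bndo_bndc (f := fun x => `|(EFin \o f) x|%E))//.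
exact: measurableT_comp.
Qed.

Lemma has_int_split T f U V : 0 < T -> has_int `]0, T[ f U -> has_int `]T, +oo[ f V ->
  has_int `]0, +oo[ f (U + V).
Proof.
move=> T0 /has_int_oc hU hV; apply: has_int_union hU hV => //.
  rewrite eqEsubset; split=> t.
    move=> /mem_oy t0; have [tT|Tt] := leP t T; last by right; apply/mem_oy.
    by left; rewrite /= in_itv/= t0.
  by move=> [/=|/mem_oy Tt]; [rewrite !in_itv/= andbT => /andP[]|
    apply/mem_oy; exact: lt_trans Tt].
rewrite -subset0 => t [/= + /mem_oy Tt]; rewrite in_itv/= => /andP[_].
by rewrite leNgt Tt.
Qed.

(** Dominated convergence for partial sums, by which every termwise integration
    below is justified. *)
Lemma has_int_series D (f : nat -> R -> R) (v : nat -> R) (F G : R -> R) (w : R) :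
  measurable D -> (forall k, has_int D (f k) (v k)) ->
  measurable_fun D F -> has_int D G w ->
  (forall x, D x -> series (f ^~ x) @ \oo --> F x) ->
  (forall x n, D x -> `|series (f ^~ x) n| <= G x) ->
  exists2 V, has_int D F V & series v @ \oo --> V.
Proof.
move=> mD fv mF [iG eG] fF fG.
have sv n := has_int_sum n mD fv.
have [iF _ cvg] : [/\ mu.-integrable D (EFin \o F),
  [sequence \int[mu]_(x in D) (`|(series (f ^~ x) n)%:E - (F x)%:E|)]_n @ \oo --> 0 &
  [sequence \int[mu]_(x in D) (series (f ^~ x) n)%:E]_n @ \oo
    --> \int[mu]_(x in D) (F x)%:E]%E.
  apply: (@dominated_convergence _ _ _ mu D mD
    (fun n x => (series (f ^~ x) n)%:E) (EFin \o F) (EFin \o G)) => //.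
  - by move=> n; have [i _] := sv n; case/integrableP: i.
  - exact/measurable_EFinP.
  - by apply: aeW => x Dx; apply: cvg_EFin (fF x Dx); near=> n.
  - by apply: aeW => x n Dx; rewrite /= lee_fin; exact: fG.
have fin : (\int[mu]_(x in D) (F x)%:E)%E \is a fin_num.
  exact: integrable_fin_num.
exists (fine (\int[mu]_(x in D) (F x)%:E)%E).
  by split => //; rewrite fineK.
move: cvg; rewrite -(fineK fin) => /fine_cvg.
apply: cvg_trans; apply: near_eq_cvg; near=> n => /=.
by have [_] := sv n; rewrite /series/= => ->.
Unshelve. all: by end_near. Qed.

End has_integral.

(** * Change of variables on intervals *)

Section substitution.
Context {R : realType}.
Notation mu := (@lebesgue_measure R).
Implicit Types (D E : set R) (F phi f g : R -> R) (u w y : R).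

(** The inverse of F is continuous, so that f is continuous on the image
    segment, as the substitution rule for segments requires. *)
Lemma subst_segment_incr F phi f g u w : u < w ->
  (forall v, v \in `[u, w] -> is_derive v 1 F (phi v)) ->
  (forall v, v \in `[u, w] -> {for v, continuous phi}) ->
  (forall v, v \in `[u, w] -> 0 < phi v) ->
  (forall v, v \in `[u, w] -> {for v, continuous g}) ->
  (forall v, v \in `[u, w] -> f (F v) = g v) ->
  [/\ F @` `[u, w] = `[F u, F w]%classic,
      {within `[F u, F w], continuous f} &
      (\int[mu]_(t in `[F u, F w]) (f t)%:E =
       \int[mu]_(v in `[u, w]) (g v * phi v)%:E)%E].
Proof.
move=> uw dF cphi phi0 cg fg.
have uwoc v : v \in `]u, w[ -> v \in `[u, w] by exact: subset_itv_oo_cc.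
have iu : u \in `[u, w] by rewrite in_itv/= lexx ltW.
have iw : w \in `[u, w] by rewrite in_itv/= lexx ltW.
have cF v : v \in `[u, w] -> {for v, continuous F}.
  by move=> /dF dv; apply/differentiable_continuous/derivable1_diffP; case: dv.
have cFw : {within `[u, w], continuous F}.
  by apply: continuous_in_subspaceT => x; rewrite inE => /cF.
have F'E v : v \in `[u, w] -> F^`()%classic v = phi v.
  by move=> /dF dv; rewrite derive1E; apply: derive_val.
have incr : {in `[u, w] &, {homo F : x y / x < y}}.
  apply: gtr0_derive1_lt_cc => // x /uwoc xuw.
    by case: (dF _ xuw).
  by rewrite F'E// phi0.
have mono : {in `[u, w] &, {mono F : x y / x <= y}} by exact: le_mono_in.
have inj : {in `[u, w] &, injective F} by exact: inc_inj_in.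
have img : F @` `[u, w] = `[F u, F w]%classic.
  rewrite eqEsubset; split.
    by move=> _ [x xuw <-]; rewrite /= in_itv/= !mono//; move: xuw; rewrite /= in_itv/=.
  have Fuw : F u <= F w by rewrite mono// ltW.
  exact: (segment_continuous_le_surjective (ltW uw) Fuw cFw).
pose psi := 'pinv_(fun=> u) `[u, w]%classic F.
have psiK : {in `[u, w], cancel F psi}.
  move=> x xi; apply: pinvKV; rewrite ?inE//.
  by move=> a b; rewrite !inE; exact: inj.
have cpsi : {within `[F u, F w], continuous psi}.
  exact: (segment_can_le_continuous (ltW uw) cFw psiK).
have cf : {within `[F u, F w], continuous f}.
  apply: (@subspace_eq_continuous _ _ _ (g \o psi)).
    move=> x; rewrite inE -img => -[v vi <-].
    by rewrite /from_subspace/= psiK// fg.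
  apply: within_continuous_comp => // x; rewrite inE -img => -[_ [v vi <-] <-].
  by rewrite psiK//; exact: cg.
split => //.
have nearu : \forall x \near u^'+, F^`()%classic x = phi x.
  near=> x; apply: F'E; rewrite in_itv/=; apply/andP; split => //.
  by near: x; exact: nbhs_right_le.
have nearw : \forall x \near w^'-, F^`()%classic x = phi x.
  near=> x; apply: F'E; rewrite in_itv/=; apply/andP; split => //.
  by near: x; exact: nbhs_left_ge.
rewrite (integration_by_substitution_increasing (ltW uw))//.
- apply: eq_integral => x; rewrite inE/= => xi.
  by rewrite !fctE /= fg// F'E.
- move=> x xi; rewrite /continuous_at F'E; last exact: uwoc.
  apply: cvg_trans (cphi _ (uwoc _ xi)); apply: near_eq_cvg.
  near=> y; rewrite F'E//; apply: uwoc.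
  by near: y; exact: near_in_itvoo.
- apply/cvg_ex; exists (phi u); apply: cvg_trans (cvg_at_right_filter (cphi _ iu)).
  by apply: near_eq_cvg; apply: filterS nearu => x ->.
- apply/cvg_ex; exists (phi w); apply: cvg_trans (cvg_at_left_filter (cphi _ iw)).
  by apply: near_eq_cvg; apply: filterS nearw => x ->.
- split.
  + by move=> x /uwoc /dF [].
  + exact: cvg_at_right_filter (cF _ iu).
  + exact: cvg_at_left_filter (cF _ iw).
Unshelve. all: by end_near. Qed.

Lemma subst_segment_decr F phi f g u w : u < w ->
  (forall v, v \in `[u, w] -> is_derive v 1 F (phi v)) ->
  (forall v, v \in `[u, w] -> {for v, continuous phi}) ->
  (forall v, v \in `[u, w] -> phi v < 0) ->
  (forall v, v \in `[u, w] -> {for v, continuous g}) ->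
  (forall v, v \in `[u, w] -> f (F v) = g v) ->
  [/\ F @` `[u, w] = `[F w, F u]%classic,
      {within `[F w, F u], continuous f} &
      (\int[mu]_(t in `[F w, F u]) (f t)%:E =
       \int[mu]_(v in `[u, w]) (g v * - phi v)%:E)%E].
Proof.
move=> uw dF cphi phi0 cg fg.
have [|||||img cf int] := @subst_segment_incr (fun x => - F x) (fun x => - phi x)
  (f \o -%R) g u w uw.
- by move=> v /dF ?; apply: is_deriveN.
- by move=> v /cphi; exact: continuousN.
- by move=> v /phi0; rewrite oppr_gt0.
- by [].
- by move=> v vi; rewrite /= opprK fg.
have cf' : {within `[F w, F u], continuous f}.
  rewrite (_ : f = (f \o -%R) \o -%R); last by apply/funext => x /=; rewrite opprK.
  exact: within_continuous_compN.
have le : F w <= F u.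
  rewrite -lerN2; have : `[- F u, - F w]%classic (- F u).
    by rewrite -img; exists u => //; rewrite /= in_itv/= lexx ltW.
  by rewrite /= in_itv/= => /andP[].
split => //.
  rewrite eqEsubset; split.
    move=> _ [x xi <-]; have : `[- F u, - F w]%classic (- F x) by rewrite -img; exists x.
    by rewrite /= !in_itv/= !lerN2 andbC.
  move=> x xi; have : `[- F u, - F w]%classic (- x).
    by move: xi; rewrite /= !in_itv/= !lerN2 andbC.
  by rewrite -img => -[z zi /oppr_inj <-]; exists z.
rewrite -[RHS]int (integration_by_substitution_oppr le cf).
by apply: eq_integral => x _; rewrite /= opprK.
Qed.

(** Integrals over an open interval are limits of integrals over the segments
    of such an exhaustion, on which the substitution rule for segments
    applies whatever happens at the endpoints of the interval. *)
Definition exhausted_by D (u w : nat -> R) : Prop :=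
  [/\ forall n, u n < w n, nondecreasing_seq (fun n => `[u n, w n]%classic) &
      D = \bigcup_n `[u n, w n]%classic].

Definition exhaustible D : Prop := exists u w : nat -> R, exhausted_by D u w.

(** Monotone convergence along the exhaustion; the sign of g makes it
    available before integrability is known on either side. *)
Lemma substitution D E F phi f g (u w : nat -> R) : exhausted_by D u w ->
  (forall v, D v -> is_derive v 1 F (phi v)) ->
  (forall v, D v -> {for v, continuous phi}) ->
  (forall v, D v -> 0 < phi v) \/ (forall v, D v -> phi v < 0) ->
  (forall v, D v -> {for v, continuous g}) ->
  (forall v, D v -> 0 <= g v) ->
  (forall v, D v -> E (F v) /\ f (F v) = g v) ->
  (forall t, E t -> exists2 v, D v & F v = t) ->
  [/\ measurable E, measurable_fun E f, (forall t, E t -> 0 <= f t) &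
  (\int[mu]_(t in E) (f t)%:E = \int[mu]_(v in D) (g v * `|phi v|)%:E)%E].
Proof.
move=> [uw nd DE] dF cphi phi0 cg g0 fg ED.
have inD n v : v \in `[u n, w n] -> D v by rewrite DE => vi; exists n.
have EE : E = \bigcup_n (F @` `[u n, w n]%classic).
  rewrite eqEsubset; split.
    move=> t /ED [v]; rewrite {1}DE => -[n _ vi] <-; exists n => //.
  by move=> _ [n _] [v /inD Dv <-]; exact: (fg _ Dv).1.
have f0 t : E t -> 0 <= f t.
  by move=> /ED [v Dv <-]; rewrite (fg _ Dv).2 g0.
have seg n : [/\ measurable (F @` `[u n, w n]%classic),
    measurable_fun (F @` `[u n, w n]%classic) f &
    (\int[mu]_(t in F @` `[u n, w n]%classic) (f t)%:E =
     \int[mu]_(v in `[u n, w n]%classic) (g v * `|phi v|)%:E)%E].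
  case: phi0 => phi0.
    have [|||||-> cf int] := @subst_segment_incr F phi f g _ _ (uw n).
    - by move=> v /inD/dF.
    - by move=> v /inD/cphi.
    - by move=> v /inD/phi0.
    - by move=> v /inD/cg.
    - by move=> v /inD/fg[].
    split => //; first exact: subspace_continuous_measurable_fun.
    rewrite int; apply: eq_integral => v; rewrite inE => /inD/phi0 p.
    by rewrite gtr0_norm.
  have [|||||-> cf int] := @subst_segment_decr F phi f g _ _ (uw n).
  - by move=> v /inD/dF.
  - by move=> v /inD/cphi.
  - by move=> v /inD/phi0.
  - by move=> v /inD/cg.
  - by move=> v /inD/fg[].
  split => //; first exact: subspace_continuous_measurable_fun.
  rewrite int; apply: eq_integral => v; rewrite inE => /inD/phi0 p.
  by rewrite ltr0_norm.
have mE : measurable E by rewrite EE; apply: bigcup_measurable => n _; case: (seg n).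
have mfE : measurable_fun E f.
  rewrite EE; apply/measurable_fun_bigcup => n; by case: (seg n).
split => //.
have ndE : nondecreasing_seq (fun n => F @` `[u n, w n]%classic).
  by move=> m n mn; rewrite subsetEset; apply: image_subset; rewrite -subsetEset; exact: nd.
have cE : (\int[mu]_(t in F @` `[u n, w n]%classic) (f t)%:E @[n --> \oo] -->
    \int[mu]_(t in E) (f t)%:E)%E.
  rewrite EE; apply: ge0_nondecreasing_set_cvg_integral => //.
  - by move=> n; case: (seg n).
  - by move=> n; case: (seg n) => ? ? _; exact/measurable_EFinP.
  - by move=> n _ [v /inD Dv <-]; rewrite lee_fin (fg _ Dv).2 g0.
have cD : (\int[mu]_(v in `[u n, w n]%classic) (g v * `|phi v|)%:E @[n --> \oo] -->
    \int[mu]_(v in D) (g v * `|phi v|)%:E)%E.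
  rewrite DE; apply: ge0_nondecreasing_set_cvg_integral => //.
  - move=> n; apply/measurable_EFinP.
    apply: subspace_continuous_measurable_fun => //.
    apply: continuous_in_subspaceT => v; rewrite inE => /inD Dv.
    apply: cvgM; first exact: cg.
    by apply: cvg_norm; exact: cphi.
  - by move=> n v /inD Dv; rewrite lee_fin mulr_ge0// g0.
have e n : (\int[mu]_(t in F @` `[u n, w n]%classic) (f t)%:E =
    \int[mu]_(v in `[u n, w n]%classic) (g v * `|phi v|)%:E)%E by case: (seg n).
move: cE; under eq_fun do rewrite e; move=> cE.
exact: cvg_unique cE cD.
Qed.

Lemma exh_oo (a b : R) : a < b -> exhaustible `]a, b[.
Proof.
(* from n = 0 on, 2 / (n + 3) < 1 leaves a segment of positive length *)
move=> ab; pose e n : R := (b - a) / (n + 3)%:R.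
have ba : 0 < b - a by rewrite subr_gt0.
have e0 n : 0 < e n by rewrite divr_gt0// ltr0n addn_gt0 orbT.
have le3 n : e n <= (b - a) / 3%:R.
  by rewrite ler_pM2l// lef_pV2 ?posrE ?ltr0n ?addn_gt0 ?orbT// ler_nat leq_addl.
have nde m n : (m <= n)%N -> e n <= e m.
  by move=> mn; rewrite ler_pM2l// lef_pV2 ?posrE ?ltr0n ?addn_gt0 ?orbT//
    ler_nat leq_add2r.
exists (fun n => a + e n), (fun n => b - e n); split.
- by move=> n; have := le3 n; lra.
- move=> m n mn; rewrite subsetEset => x /=; rewrite !in_itv/= => /andP[h1 h2].
  by have := nde _ _ mn; lra.
- rewrite eqEsubset; split; last first.
    move=> x [n _] /=; rewrite !in_itv/= => /andP[h1 h2].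
    by have := e0 n; lra.
  move=> x /=; rewrite in_itv/= => /andP[ax xb].
  have [n hn] : exists n : nat, (b - a) / Num.min (x - a) (b - x) <= (n + 3)%:R.
    exists (Num.truncn ((b - a) / Num.min (x - a) (b - x))).
    rewrite (le_trans (ltW (truncnS_gt _)))// ler_nat -addn1 leq_add2l//.
  have m0 : 0 < Num.min (x - a) (b - x) by rewrite lt_min !subr_gt0 ax xb.
  exists n => //=; rewrite in_itv/=.
  have : e n <= Num.min (x - a) (b - x).
    by rewrite ler_pdivrMr ?ltr0n ?addn_gt0 ?orbT// mulrC -ler_pdivrMr.
  by rewrite le_min => /andP[]; lra.
Qed.

Lemma exh_oy (a : R) : exhaustible `]a, +oo[.
Proof.
exists (fun n => a + n.+1%:R^-1), (fun n => a + n.+2%:R); split.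
- move=> n; rewrite ltrD2l (@le_lt_trans _ _ 1)// ?invf_le1 ?ler1n ?ltr1n//.
- move=> m n mn; rewrite subsetEset => x /=; rewrite !in_itv/= => /andP[h1 h2].
  apply/andP; split.
    by rewrite (le_trans _ h1)// lerD2l lef_pV2 ?posrE ?ltr0n// ler_nat.
  by rewrite (le_trans h2)// lerD2l ler_nat.
- rewrite eqEsubset; split; last first.
    move=> x [n _] /=; rewrite !in_itv/= andbT => /andP[h1 _].
    by rewrite (lt_le_trans _ h1)// ltrDl invr_gt0 ltr0n.
  move=> x /=; rewrite in_itv/= andbT => ax.
  have xa : 0 < x - a by rewrite subr_gt0.
  pose n := maxn (Num.truncn (x - a)) (Num.truncn (x - a)^-1).
  exists n => //=; rewrite in_itv/= -!lerBrDl; apply/andP; split.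
    rewrite invf_ple ?posrE ?ltr0n//.
    by rewrite (le_trans (ltW (truncnS_gt _)))// ler_nat ltnS leq_maxr.
  by rewrite -lerBlDl (le_trans (ltW (truncnS_gt _)))// ler_nat ltnS leqW// leq_maxl.
Qed.

End substitution.

(** * Real powers and their integrals *)

Section powers.
Context {R : realType}.
Notation mu := (@lebesgue_measure R).
Implicit Types (D E : set R) (F phi f g : R -> R) (a b c x y u v : R).

Lemma exhaustible_measurable D : exhaustible D -> measurable D.
Proof. by move=> [u [w [_ _ ->]]]; exact: bigcup_measurable. Qed.

Lemma exhaustible_continuous_measurable D f : exhaustible D ->
  (forall v, D v -> {for v, continuous f}) -> measurable_fun D f.
Proof.
move=> [u [w [_ _ DE]]] cf; rewrite DE; apply/measurable_fun_bigcup => // n.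
apply: subspace_continuous_measurable_fun => //.
apply: continuous_in_subspaceT => v; rewrite inE => vi; apply: cf.
by rewrite DE; exists n.
Qed.

Lemma has_int_subst D E F phi f g V : exhaustible D ->
  (forall v, D v -> is_derive v 1 F (phi v)) ->
  (forall v, D v -> {for v, continuous phi}) ->
  (forall v, D v -> 0 < phi v) \/ (forall v, D v -> phi v < 0) ->
  (forall v, D v -> {for v, continuous g}) ->
  (forall v, D v -> 0 <= g v) ->
  (forall v, D v -> E (F v) /\ f (F v) = g v) ->
  (forall t, E t -> exists2 v, D v & F v = t) ->
  has_int D (fun v => g v * `|phi v|) V <-> has_int E f V.
Proof.
move=> eD dF cphi phi0 cg g0 fg ED; have [u [w uwD]] := eD.
have [mE mf f0 e] := substitution uwD dF cphi phi0 cg g0 fg ED.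
split=> [[_ e']|[_ e']].
  by apply: has_int_ge0 => //; rewrite e.
apply: has_int_ge0; [exact: exhaustible_measurable| |
  by move=> v Dv; rewrite mulr_ge0// g0|by rewrite -e].
apply: exhaustible_continuous_measurable => // v Dv.
apply: cvgM; first exact: cg.
by apply: cvg_norm; exact: cphi.
Qed.

Lemma continuous_powR a x : 0 < x -> {for x, continuous (fun v => v `^ a)}.
Proof.
move=> x0; apply: differentiable_continuous; apply/derivable1_diffP.
by apply: derivable_powR; rewrite in_itv/= x0.
Qed.

Lemma cvg_powR {T} (F : set_system T) (FF : Filter F) (f : T -> R) (l a : R) : 0 < l ->
  f @ F --> l -> (fun t => f t `^ a) @ F --> l `^ a.
Proof.
by move=> l0 fl; apply: (@cvg_comp _ _ _ f (fun v => v `^ a)) fl _; exact: continuous_powR.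
Qed.

Lemma cvg_expR {T} (F : set_system T) (FF : Filter F) (f : T -> R) (l : R) :
  f @ F --> l -> (fun t => expR (f t)) @ F --> expR l.
Proof. by move=> fl; apply: (@cvg_comp _ _ _ f expR) fl _; exact: continuous_expR. Qed.

Lemma measurable_powRf {d} {T : measurableType d} (D : set T) (f : T -> R) a :
  measurable_fun D f -> measurable_fun D (fun t => f t `^ a).
Proof.
by move=> mf; apply: (@measurableT_comp _ _ _ _ _ _ (fun v : R => v `^ a)) mf;
  exact: measurable_powR.
Qed.

Lemma has_int_cst D k l : measurable D -> mu D = l%:E -> has_int D (fun=> k) (k * l).
Proof.
move=> mD muD; have h : has_int D (fun=> 1) l.
  apply: has_int_ge0 => //.
  rewrite (integral_cst mu mD 1%:E) mul1e; exact: muD.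
by apply: has_int_eq (has_int_scale k mD h) => // x _; rewrite mulr1.
Qed.

Lemma powR_powRV x a : 0 <= x -> a != 0 -> (x `^ a^-1) `^ a = x.
Proof. by move=> x0 a0; rewrite -powRrM mulVf// powRr1. Qed.

Lemma powR_powR x a : 0 <= x -> a != 0 -> (x `^ a) `^ a^-1 = x.
Proof. by move=> x0 a0; rewrite -powRrM mulfV// powRr1. Qed.

Lemma ltr_powR a x y : 0 < a -> 0 <= x -> x < y -> x `^ a < y `^ a.
Proof.
by move=> a0 x0 xy; apply: gt0_ltr_powR; rewrite // nnegrE// (le_trans x0)// ltW.
Qed.

Lemma ltr_powR_neg a x y : a < 0 -> 0 < x -> x < y -> y `^ a < x `^ a.
Proof.
move=> a0 x0 xy; rewrite -(opprK a) [X in X < _]powRN [X in _ < X]powRN.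
have y0 := lt_trans x0 xy.
by rewrite ltf_pV2 ?posrE ?powR_gt0// ltr_powR ?oppr_gt0 ?ltW.
Qed.

(** The substitution v = t^a leaves a constant integrand. *)
Lemma has_int_powR a y : 0 < a -> 0 < y ->
  has_int `]0, y[ (fun t => t `^ (a - 1)) (y `^ a / a).
Proof.
move=> a0 y0; have a0' := lt0r_neq0 a0.
have mE := @has_int_cst `]0, y `^ a[ 1 (y `^ a).
suff : has_int `]0, y[ (fun t => 1 * `|a * t `^ (a - 1)|) (y `^ a).
  move=> /(@has_int_scale _ _ _ a^-1) h; rewrite [X in has_int _ _ X]mulrC.
  apply: has_int_eq (h _) => // x xi; rewrite mul1r ger0_norm; last first.
    by rewrite mulr_ge0 ?powR_ge0// ltW.
  by rewrite mulKf.
apply/(@has_int_subst _ `]0, y `^ a[ (fun t => t `^ a) _ (cst 1) (cst 1)).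
- exact: exh_oo.
- by move=> v; rewrite /= in_itv/= => /andP[v0 _]; exact: is_derive1_powR.
- move=> v; rewrite /= in_itv/= => /andP[v0 _].
  by apply: cvgM; [exact: cvg_cst|exact: cvg_powR].
- by left=> v; rewrite /= in_itv/= => /andP[v0 _]; rewrite mulr_gt0// powR_gt0.
- by move=> v _; exact: cvg_cst.
- by [].
- move=> v; rewrite /= !in_itv/= => /andP[v0 vy]; split => //.
  by rewrite powR_gt0//= ltr_powR// ltW.
- move=> t; rewrite /= in_itv/= => /andP[t0 ty]; exists (t `^ a^-1).
    rewrite /= in_itv/= powR_gt0//= -[X in _ < X](@powR_powR _ a)// ?ltW//.
    by apply: ltr_powR => //; [rewrite invr_gt0|exact: ltW].
  by rewrite powR_powRV// ltW.
- rewrite -[X in has_int _ _ X]mul1r; apply: has_int_cst => //.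
  by rewrite lebesgue_measure_itv/= lte_fin powR_gt0// sube0.
Qed.

(** The substitution v = t^(- a) maps onto a bounded interval and leaves a
    constant integrand. *)
Lemma has_int_powR_y a y : 0 < a -> 0 < y ->
  has_int `]y, +oo[ (fun t => t `^ (- a - 1)) (y `^ (- a) / a).
Proof.
move=> a0 y0; have a0' := lt0r_neq0 a0.
have Na : - a < 0 by rewrite oppr_lt0.
have Na0 : - a != 0 by rewrite oppr_eq0.
suff : has_int `]y, +oo[ (fun t => 1 * `|- a * t `^ (- a - 1)|) (y `^ (- a)).
  move=> /(@has_int_scale _ _ _ a^-1) h; rewrite [X in has_int _ _ X]mulrC.
  apply: has_int_eq (h _) => // x xi; rewrite mul1r ler0_norm; last first.
    by rewrite mulNr oppr_le0 mulr_ge0 ?powR_ge0// ltW.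
  by rewrite mulNr opprK mulKf.
apply/(@has_int_subst _ `]0, y `^ (- a)[ (fun t => t `^ (- a)) _ (cst 1) (cst 1)).
- exact: exh_oy.
- move=> v; rewrite /= in_itv/= andbT => yv; apply: is_derive1_powR.
  exact: lt_trans yv.
- move=> v; rewrite /= in_itv/= andbT => yv.
  by apply: cvgM; [exact: cvg_cst|apply: cvg_powR => //; exact: lt_trans yv].
- right=> v; rewrite /= in_itv/= andbT => yv.
  by rewrite mulNr oppr_lt0 mulr_gt0// powR_gt0// (lt_trans y0).
- by move=> v _; exact: cvg_cst.
- by [].
- move=> v; rewrite /= !in_itv/= andbT => yv; split => //.
  by rewrite powR_gt0/= ?(lt_trans y0)// ltr_powR_neg.
- move=> t; rewrite /= in_itv/= => /andP[t0 ty]; exists (t `^ (- a)^-1).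
    rewrite /= in_itv/= andbT -[X in X < _](@powR_powR _ (- a))// ?ltW//.
    by apply: ltr_powR_neg => //; rewrite invr_lt0.
  by rewrite powR_powRV// ltW.
- rewrite -[X in has_int _ _ X]mul1r; apply: has_int_cst => //.
  by rewrite lebesgue_measure_itv/= lte_fin powR_gt0// sube0.
Qed.

End powers.

(** * The Gamma and Beta integrals *)

(** Powers, exponentials and special values are the indeterminates of the
    polynomial identities below. *)
Ltac abstract_atoms := repeat match goal with
  | |- context [powR ?x ?y] => let z := fresh "z" in generalize (powR x y); intro z
  | |- context [expR ?x] => let z := fresh "z" in generalize (expR x); intro z
  | |- context [Gamma_pos ?x] => let z := fresh "z" in generalize (Gamma_pos x); intro z
  | |- context [Gamma ?x] => let z := fresh "z" in generalize (Gamma x); intro z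
  | |- context [Beta ?x ?y] => let z := fresh "z" in generalize (Beta x y); intro z
  | |- context [rising ?x ?y] => let z := fresh "z" in generalize (rising x y); intro z
  end.
Ltac aring := abstract_atoms; ring.

Section gamma.
Context {R : realType}.
Notation mu := (@lebesgue_measure R).
Implicit Types (D E : set R) (F phi f g : R -> R) (a b c e x y u v s : R).

Lemma powR_D x (r s : R) : 0 < x -> x `^ (r + s) = x `^ r * x `^ s.
Proof. by move=> x0; apply: powRD; apply/implyP => _; rewrite gt_eqF. Qed.

(** Indicator functions of D and E reduce the statement to the plane. *)
Lemma tonelli_swap D E (h : R -> R -> R) : measurable D -> measurable E ->
  measurable_fun setT (fun z : R * R => h z.1 z.2) ->
  (forall x y, D x -> E y -> 0 <= h x y) ->
  (\int[mu]_(x in D) \int[mu]_(y in E) (h x y)%:E =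
   \int[mu]_(y in E) \int[mu]_(x in D) (h x y)%:E)%E.
Proof.
move=> mD mE mh h0.
pose k (z : R * R) : \bar R := (h z.1 z.2 * (\1_D z.1 * \1_E z.2))%:E.
have mk : measurable_fun setT k.
  apply/measurable_EFinP; apply: measurable_funM => //; apply: measurable_funM.
    exact: (measurableT_comp (measurable_indic mD) measurable_fst).
  exact: (measurableT_comp (measurable_indic mE) measurable_snd).
have k0 z : (0 <= k z)%E.
  rewrite lee_fin /k !indicE; have [/set_mem Dz|_] := boolP (z.1 \in D); last first.
    by rewrite mul0r mulr0.
  have [/set_mem Ez|_] := boolP (z.2 \in E); last by rewrite !mulr0.
  by rewrite !mulr1 h0.
have eD : (\int[mu]_(x in D) \int[mu]_(y in E) (h x y)%:E =
    \int[mu]_x \int[mu]_y k (x, y))%E.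
  rewrite integral_mkcond; apply: eq_integral => x _; rewrite patchE.
  case: ifPn => Dx.
    rewrite integral_mkcond; apply: eq_integral => y _; rewrite patchE /k/= !indicE Dx.
    by case: ifPn => _; rewrite ?mulr1 ?mulr0.
  by rewrite integral0_eq// => y _; rewrite /k/= !indicE (negbTE Dx) mul0r mulr0.
have eE : (\int[mu]_(y in E) \int[mu]_(x in D) (h x y)%:E =
    \int[mu]_y \int[mu]_x k (x, y))%E.
  rewrite integral_mkcond; apply: eq_integral => y _; rewrite patchE.
  case: ifPn => Ey.
    rewrite integral_mkcond; apply: eq_integral => x _; rewrite patchE /k/= !indicE Ey.
    by case: ifPn => _; rewrite ?mulr1 ?mul0r ?mulr0.
  by rewrite integral0_eq// => x _; rewrite /k/= !indicE (negbTE Ey) !mulr0.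
by rewrite eD eE; exact: fubini_tonelli.
Qed.

Lemma has_int_sub_le D E f u v : measurable D -> measurable E -> E `<=` D ->
  (forall x, D x -> 0 <= f x) -> has_int D f v -> has_int E f u -> u <= v.
Proof.
move=> mD mE ED f0 hv [_ eu]; have mf := has_int_meas hv; have [_ ev] := hv.
rewrite -lee_fin -eu -ev; apply: ge0_subset_integral => //.
exact/measurable_EFinP.
Qed.

(** This is ln x <= x - 1 at x = t / m. *)
Lemma powR_expRN_le (m t : R) : 0 < m -> 0 < t -> t `^ m * expR (- t) <= m `^ m.
Proof.
move=> m0 t0; rewrite /powR !gt_eqF// -expRD ler_expR.
have tm0 : 0 < t / m by rewrite divr_gt0.
have := @le_ln1Dx _ (t / m - 1); rewrite ltrBrDr addNr addrC subrK => /(_ tm0).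
rewrite ln_div ?posrE// => h.
have : m * (ln t - ln m) <= m * (t / m - 1) by rewrite ler_pM2l.
rewrite !mulrBr mulrCA mulfV ?gt_eqF// !mulr1; lra.
Qed.

Lemma measurable_gamma D c s :
  measurable_fun D (fun t : R => t `^ (s - 1) * expR (- (c * t))).
Proof.
apply: measurable_funTS; apply: measurable_funM; first exact: measurable_powR.
by apply: measurableT_comp => //; apply: measurableT_comp.
Qed.

(** The integrand is at most t^(s - 1) near 0, and at most a multiple of
    t^(- 2) near infinity. *)
Lemma has_int_Gamma_pos s : 0 < s ->
  has_int `]0, +oo[ (fun t => t `^ (s - 1) * expR (- t)) (Gamma_pos s).
Proof.
move=> s0; pose f t : R := t `^ (s - 1) * expR (- t).
have f0 t : 0 <= f t by rewrite mulr_ge0 ?powR_ge0 ?expR_ge0.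
have mf D : measurable_fun D f.
  rewrite (_ : f = fun t => t `^ (s - 1) * expR (- (1 * t))).
    exact: measurable_gamma.
  by apply/funext => t; rewrite mul1r.
have [u0 h0] : exists u, has_int `]0, 2[ f u.
  apply: (has_int_dom _ (mf _) (has_int_powR s0 (ltr0Sn _ 1))) => // t; rewrite /= in_itv/= => /andP[t0 _].
  rewrite ger0_norm// ler_piMr ?powR_ge0// -expR0 ler_expR oppr_le0 ltW//.
pose C := (s + 1) `^ (s + 1).
have [u1 h1] : exists u, has_int `]1, +oo[ f u.
  have := @has_int_powR_y R 1 1 ltr01 ltr01; move=> /(@has_int_scale _ _ _ C) h.
  apply: (has_int_dom _ (mf _) (h _)) => // t; rewrite /= in_itv/= andbT => t1.
  have t0 : 0 < t by exact: lt_trans t1.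
  rewrite ger0_norm// /f.
  rewrite (_ : s - 1 = (s + 1) + (- 1 - 1)); last by ring.
  rewrite powR_D//.
  rewrite mulrAC ler_wpM2r ?powR_ge0// powR_expRN_le// addr_gt0//.
have [u h] : exists u, has_int `]0, +oo[ f u.
  have [v1 k1] : exists v, has_int `]2, +oo[ f v.
    apply: has_int_sub h1 => // t /mem_oy t2; apply/mem_oy; apply: lt_trans t2.
    by rewrite ltr1n.
  by exists (u0 + v1); exact: has_int_split h0 k1.
rewrite /Gamma_pos; suff -> : \int[mu]_(t in `]0%R, +oo[) f t = u by [].
by case: h => _ e; rewrite /Rintegral e.
Qed.

Lemma Gamma_pos_gt0 s : 0 < s -> 0 < Gamma_pos s.
Proof.
move=> s0; have hs := has_int_Gamma_pos s0.
have h1 := has_int_powR s0 (@ltr01 R).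
have sub : (`]0, 1[%classic : set R) `<=` `]0, +oo[%classic.
  by move=> t /=; rewrite !in_itv/= andbT => /andP[].
have [u hu] := has_int_sub (measurable_itv _) (measurable_itv `]0, 1[) sub hs.
have : 0 < u.
  apply: (@lt_le_trans _ _ (expR (- 1) * (1 `^ s / s))).
    by rewrite powR1 mulr_gt0 ?expR_gt0// divr_gt0.
  apply: has_int_le (has_int_scale (expR (-1)) _ h1) hu _ => //.
  move=> t; rewrite /= in_itv/= => /andP[t0 t1].
  by rewrite mulrC ler_wpM2l ?powR_ge0// ler_expR lerN2 ltW.
move=> /lt_le_trans; apply; apply: has_int_sub_le hs hu => //.
by move=> t _; rewrite mulr_ge0 ?powR_ge0 ?expR_ge0.
Qed.

Lemma is_derive_scale c v : is_derive v 1 (fun t : R => c * t) c.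
Proof.
have := @is_deriveZ R R R id c v 1 1 (is_derive_id v 1).
by rewrite /GRing.scale/= mulr1.
Qed.

Lemma has_int_scale_y c f g V : 0 < c ->
  (forall v, 0 < v -> {for v, continuous g}) ->
  (forall v, 0 < v -> 0 <= g v) ->
  (forall v, 0 < v -> f (c * v) = g v) ->
  has_int `]0, +oo[ g V -> has_int `]0, +oo[ f (c * V).
Proof.
move=> c0 cg g0 fg hg.
apply/(@has_int_subst _ `]0, +oo[ _ (fun t => c * t) (fun=> c) f g).
- exact: exh_oy.
- by move=> v _; exact: is_derive_scale.
- by move=> v _; exact: cvg_cst.
- by left.
- by move=> v /mem_oy; exact: cg.
- by move=> v /mem_oy; exact: g0.
- by move=> v /mem_oy v0; split; [apply/mem_oy; rewrite mulr_gt0|rewrite fg].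
- move=> t /mem_oy t0; exists (t / c); last by rewrite mulrC divfK ?gt_eqF.
  by apply/mem_oy; rewrite divr_gt0.
by apply: has_int_eq (has_int_scale c _ hg) => // v _; rewrite gtr0_norm// mulrC.
Qed.

Lemma has_int_Gamma_scale c s : 0 < c -> 0 < s ->
  has_int `]0, +oo[ (fun t => t `^ (s - 1) * expR (- (c * t))) (c `^ (- s) * Gamma_pos s).
Proof.
move=> c0 s0; have hs := has_int_Gamma_pos s0.
have := @has_int_scale_y c^-1 (fun t => t `^ (s - 1) * expR (- (c * t)))
  (fun t => c `^ (1 - s) * (t `^ (s - 1) * expR (- t))) (c `^ (1 - s) * Gamma_pos s).
rewrite invr_gt0 (_ : c^-1 * _ = c `^ (- s) * Gamma_pos s); last first.
  rewrite mulrA -powR_inv1 ?ltW// -powR_D//.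
  by congr (_ `^ _ * _); ring.
apply => //.
- move=> v v0; apply: cvgM; first exact: cvg_cst.
  apply: cvgM; first exact: cvg_powR.
  by apply: cvg_expR; apply: cvgN; exact: cvg_id.
- by move=> v v0; rewrite !mulr_ge0 ?powR_ge0 ?expR_ge0.
- move=> v v0; rewrite powRM ?invr_ge0 ?ltW// -mulrA; congr (_ * (_ * expR (- _))).
    by rewrite -powR_inv1 ?ltW// -powRrM; congr (_ `^ _); ring.
  by rewrite mulrA mulfV ?gt_eqF// mul1r.
exact: has_int_scale.
Qed.

Local Opaque powR expR Gamma_pos.

(** Integrate v^(a - 1) s^(a + b - 1) exp (- (1 + v) s) in both orders: the
    integral over s is Gamma (a + b) times the integrand below, the integral
    over v leaves a product of two Gamma integrands. *)
Lemma has_int_Beta_y_raw a b : 0 < a -> 0 < b ->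
  has_int `]0, +oo[ (fun v => v `^ (a - 1) * (1 + v) `^ (- (a + b)))
    (Gamma_pos a * Gamma_pos b / Gamma_pos (a + b)).
Proof.
move=> a0 b0; have ab0 := addr_gt0 a0 b0.
have Gab := Gamma_pos_gt0 ab0.
pose h v s : R := v `^ (a - 1) * (s `^ (a + b - 1) * expR (- ((1 + v) * s))).
have mh : measurable_fun setT (fun z : R * R => h z.1 z.2).
  apply: measurable_funM; first exact: measurable_powRf.
  apply: measurable_funM; first exact: measurable_powRf.
  apply: measurableT_comp => //; apply: measurableT_comp => //.
  by apply: measurable_funM => //; exact: measurable_funD.
have mf : measurable_fun (`]0, +oo[%classic : set R) (fun v : R => v `^ (a - 1) * (1 + v) `^ (- (a + b))).
  apply: measurable_funTS; apply: measurable_funM; first exact: measurable_powRf.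
  by apply: measurable_powRf; exact: measurable_funD.
have := tonelli_swap (measurable_itv `]0, +oo[) (measurable_itv `]0, +oo[) mh.
have h0 x y : 0 <= h x y by rewrite !mulr_ge0 ?powR_ge0 ?expR_ge0.
move=> /(_ (fun x y _ _ => h0 x y)) sw.
have l1 : (\int[mu]_(v in `]0%R, +oo[) \int[mu]_(s in `]0%R, +oo[) (h v s)%:E =
   \int[mu]_(v in `]0%R, +oo[) ((Gamma_pos (a + b))%:E *
      (v `^ (a - 1) * (1 + v) `^ (- (a + b)))%:E))%E.
  apply: eq_integral => v; rewrite inE => /mem_oy v0.
  have v1 : 0 < 1 + v by rewrite addr_gt0.
  have [_ ->] := has_int_scale (v `^ (a - 1)) (measurable_itv _) (has_int_Gamma_scale v1 ab0).
  by rewrite -EFinM; congr EFin; rewrite [RHS]mulrC -mulrA.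
have key (t G e0 : R) : 0 < t ->
    t `^ (a + b - 1) * e0 * (t `^ (- a) * G) = G * (t `^ (b - 1) * e0).
  move=> t0; rewrite (_ : b - 1 = (a + b - 1) + (- a)); last by ring.
  by rewrite [in RHS](powR_D _ _ t0); aring.
have key2 (v s A B : R) : A * (B * expR (- ((1 + v) * s))) =
    B * expR (- s) * (A * expR (- (s * v))).
  rewrite (_ : - ((1 + v) * s) = - s + - (s * v)); last by ring.
  by rewrite expRD; aring.
have l2 : (\int[mu]_(s in `]0%R, +oo[) \int[mu]_(v in `]0%R, +oo[) (h v s)%:E =
   (Gamma_pos a * Gamma_pos b)%:E)%E.
  have [_ <-] := has_int_scale (Gamma_pos a) (measurable_itv _) (has_int_Gamma_pos b0).
  apply: eq_integral => s; rewrite inE => /mem_oy s0.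
  have [_] := has_int_scale (s `^ (a + b - 1) * expR (- s)) (measurable_itv _) (has_int_Gamma_scale s0 a0).
  rewrite (key _ _ _ s0).
  move=> <-; apply: eq_integral => v _; congr EFin; exact: key2.
rewrite l1 l2 in sw.
rewrite ge0_integralZl_EFin// in sw; last 3 first.
- by move=> x _; rewrite lee_fin mulr_ge0 ?powR_ge0.
- exact/measurable_EFinP.
- exact: ltW.
apply: has_int_ge0 => //; first by move=> x _; rewrite mulr_ge0 ?powR_ge0.
rewrite mulrC EFinM -sw muleA -EFinM mulVf ?gt_eqF// mul1e//.
Qed.

End gamma.

(** * Gamma and Beta at negative arguments *)

Section beta.
Local Opaque powR expR Gamma_pos.
Context {R : realType}.
Notation mu := (@lebesgue_measure R).
Implicit Types (D E : set R) (F phi f g : R -> R) (a b c e x y u v s : R).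

(** The rules of differentiation, for explicit function expressions, so that
    they compose by unification. *)
Lemma isd_eq f x a b : is_derive x 1 f a -> a = b -> is_derive x 1 f b.
Proof. by move=> fa <-. Qed.

Lemma isd_cst c x : is_derive x 1 (fun=> c) 0.
Proof. exact: is_derive_cst. Qed.

Lemma isd_id x : is_derive x 1 (fun t : R => t) 1.
Proof. exact: is_derive_id. Qed.

Lemma isd_add f g x a b : is_derive x 1 f a -> is_derive x 1 g b ->
  is_derive x 1 (fun t => f t + g t) (a + b).
Proof. by move=> fa gb; exact: (is_deriveD fa gb). Qed.

Lemma isd_opp f x a : is_derive x 1 f a -> is_derive x 1 (fun t => - f t) (- a).
Proof. by move=> fa; exact: (is_deriveN fa). Qed.

Lemma isd_mul f g x a b : is_derive x 1 f a -> is_derive x 1 g b ->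
  is_derive x 1 (fun t => f t * g t) (f x * b + g x * a).
Proof. by move=> fa gb; exact: (is_deriveM fa gb). Qed.

Lemma isd_powR f x a e : 0 < f x -> is_derive x 1 f a ->
  is_derive x 1 (fun t => f t `^ e) (e * f x `^ (e - 1) * a).
Proof.
move=> f0 fa.
exact: (@is_derive1_comp _ (fun t : R => t `^ e) f x _ _ (is_derive1_powR e f0) fa).
Qed.

Lemma rising0 a : rising a 0 = 1.
Proof. by rewrite /rising big_ord0. Qed.

Lemma risingS a k : rising a k.+1 = rising a k * (a + k%:R).
Proof. by rewrite /rising big_ord_recr. Qed.

Lemma risingSl a k : rising a k.+1 = a * rising (a + 1) k.
Proof.
rewrite /rising big_ord_recl addr0; congr (_ * _); apply: eq_bigr => i _.
by rewrite /bump/= natrD addrA.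
Qed.

Lemma rising_neq0 a k : (forall i : nat, a + i%:R != 0) -> rising a k != 0.
Proof. by move=> h; apply/prodf_neq0 => i _; exact: h. Qed.

Lemma rising_gt0 a k : 0 < a -> 0 < rising a k.
Proof. by move=> a0; apply: prodr_gt0 => i _; rewrite ltr_wpDr. Qed.

Lemma rising_ge0 a k : 0 <= a -> 0 <= rising a k.
Proof. by move=> a0; apply: prodr_ge0 => i _; rewrite addr_ge0. Qed.

(** The substitution w = exp (- t) leaves the constant 1 on ]0, 1[. *)
Lemma Gamma_pos1 : Gamma_pos 1 = 1 :> R.
Proof.
have h1 := has_int_Gamma_pos (@ltr01 R).
apply: has_int_uniq h1 _.
have : has_int `]0, 1[ (fun=> 1 : R) 1.
  rewrite -[X in has_int _ _ X]mulr1; apply: has_int_cst => //.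
  by rewrite lebesgue_measure_itv/= lte_fin ltr01 sube0.
move=> /(@has_int_subst _ `]0, +oo[ _ (fun t => expR (- t)) (fun t => - expR (- t)) _ (fun=> 1)).
have c v : {for v, continuous (fun t : R => expR (- t))}.
  by apply: cvg_expR; apply: cvgN; exact: cvg_id.
move=> /(_ (exh_oy 0)) h; apply: has_int_eq (h _ _ _ _ _ _ _) => //.
- move=> v /mem_oy v0; apply: (etrans (mul1r _)).
  by rewrite subrr powRr0 mul1r normrN ger0_norm ?expR_ge0.
- move=> v _; have := @is_derive1_comp _ expR -%R v _ _ (is_derive_expR _)
    (is_deriveNid v 1).
  by rewrite mulrN1.
- by move=> v _; apply: cvgN; exact: c.
- by right => v _; rewrite oppr_lt0 expR_gt0.
- by move=> v _; exact: cvg_cst.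
- move=> v /mem_oy v0; split=> //; rewrite /= in_itv/= expR_gt0/=.
  by rewrite -expR0 ltr_expR oppr_lt0.
- move=> t; rewrite /= in_itv/= => /andP[t0 t1]; exists (- ln t).
    by apply/mem_oy; rewrite oppr_gt0 ln_lt0// t0.
  by rewrite opprK lnK.
Qed.

(** The map v / (1 + v) carries the unbounded form of the Beta integral to
    the bounded one. *)
Lemma has_int_Beta01_pos a b : 0 < a -> 0 < b ->
  has_int `]0, 1[ (fun w => w `^ (a - 1) * (1 - w) `^ (b - 1))
    (Gamma_pos a * Gamma_pos b / Gamma_pos (a + b)).
Proof.
move=> a0 b0; have h := has_int_Beta_y_raw a0 b0.
have v1 v : 0 < v -> 0 < 1 + v by move=> v0; rewrite addr_gt0.
pose G v := (v * (1 + v) `^ (-1)) `^ (a - 1) * (1 + v) `^ (- 1) `^ (b - 1) : R.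
have FE v : 0 < v -> 1 - v * (1 + v) `^ (-1) = (1 + v) `^ (-1).
  move=> v0; rewrite powR_inv1 ?ltW ?v1//; field; by rewrite gt_eqF ?v1.
apply/(@has_int_subst _ `]0, +oo[ _ (fun v => v * (1 + v) `^ (-1))
  (fun v => (1 + v) `^ (- 2)) _ G).
- exact: exh_oy.
- move=> v /mem_oy v0.
  have d1 := isd_add (isd_cst 1 v) (isd_id v).
  apply: isd_eq (isd_mul (isd_id v) (isd_powR (-1) (v1 _ v0) d1)) _.
  rewrite (_ : (1 + v) `^ (-1) = (1 + v) * (1 + v) `^ (- 2)); last first.
    rewrite -{2}(powRr1 (ltW (v1 _ v0))) -(powR_D _ _ (v1 _ v0)).
    by congr (_ `^ _); ring.
  by rewrite (_ : -1 - 1 = - 2 :> R); [aring|ring].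
- move=> v /mem_oy v0; apply: cvg_powR; first exact: v1.
  by apply: cvgD; [exact: cvg_cst|exact: cvg_id].
- by left => v /mem_oy v0; rewrite powR_gt0 ?v1.
- move=> v /mem_oy v0.
  have c : (fun v : R => (1 + v) `^ (-1)) @ v --> (1 + v) `^ (- 1).
    apply: cvg_powR; first exact: v1.
    by apply: cvgD; [exact: cvg_cst|exact: cvg_id].
  apply: cvgM; apply: cvg_powR => //; rewrite ?mulr_gt0 ?powR_gt0 ?v1//.
  by apply: cvgM => //; exact: cvg_id.
- by move=> v _; rewrite mulr_ge0 ?powR_ge0.
- move=> v /mem_oy v0; split; last by rewrite /G FE.
  rewrite /= in_itv/= mulr_gt0 ?powR_gt0 ?v1//= -subr_gt0 FE// powR_gt0 ?v1//.
- move=> t; rewrite /= in_itv/= => /andP[t0 t1].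
  have t1' : 0 < 1 - t by rewrite subr_gt0.
  exists (t / (1 - t)); first by apply/mem_oy; rewrite divr_gt0.
  have e : 1 + t / (1 - t) = (1 - t)^-1 by field; rewrite gt_eqF.
  by rewrite e powR_inv1 ?invr_ge0 ?ltW// invrK divfK// gt_eqF.
apply: has_int_eq h => // v /mem_oy v0; rewrite ger0_norm ?powR_ge0// /G.
rewrite powRM ?powR_ge0 ?ltW// -!powRrM -mulrA -mulrA -!powR_D ?v1//.
by congr (_ * _ `^ _); ring.
Qed.

(** For b = 1 the Beta integral is the integral of a power. *)
Lemma Gamma_posS s : 0 < s -> Gamma_pos (s + 1) = s * Gamma_pos s.
Proof.
move=> s0; have := has_int_Beta01_pos s0 (@ltr01 R).
have := has_int_powR s0 (@ltr01 R).
move=> h1 h2.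
have : Gamma_pos s * Gamma_pos 1 / Gamma_pos (s + 1) = 1 `^ s / s.
  apply: has_int_uniq h2 _; apply: has_int_eq h1 => // w _.
  by rewrite subrr powRr0 mulr1.
rewrite Gamma_pos1 powR1 mulr1 => e.
have G1 : Gamma_pos (s + 1) != 0 by rewrite gt_eqF// Gamma_pos_gt0// addr_gt0.
have s0' : s != 0 by rewrite gt_eqF.
have -> : Gamma_pos s = 1 / s * Gamma_pos (s + 1) by rewrite -e mulfVK.
by rewrite mulrA mulrA mulr1 mulfV// mul1r.
Qed.

Lemma GammaE s : 0 < s -> Gamma s = Gamma_pos s.
Proof. by move=> s0; rewrite /Gamma s0. Qed.

(** With the convention that 1/Gamma vanishes at the poles of Gamma, the
    functional equation of 1/Gamma holds everywhere. *)
Lemma invGammaS s : (Gamma s)^-1 = s / Gamma (s + 1).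
Proof.
have [s0|sN0] := ltP 0 s.
  by rewrite !GammaE ?addr_gt0// Gamma_posS// invfM mulrA mulfV ?mul1r// gt_eqF.
have Ns0 : 0 <= - s by rewrite oppr_ge0.
have [s1|s1] := ltP 0 (s + 1).
  have tr : Num.truncn (- s) = 0%N.
    apply/eqP; rewrite truncn_eq// oppr_ge0 sN0/=; move: s1; rewrite /=; lra.
  rewrite {1}/Gamma ltNge sN0/= tr risingS rising0 mul1r addr0 GammaE//.
  by rewrite invfM invrK mulrC.
have tr : Num.truncn (- s) = (Num.truncn (- (s + 1))).+1.
  apply/eqP; rewrite truncn_eq//.
  have : 0 <= - (s + 1) by rewrite oppr_ge0.
  move=> /truncn_itv /andP[h1 h2].
  by rewrite -!natr1 in h2 *; lra.
rewrite /Gamma !ltNge sN0 s1/= tr risingSl.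
rewrite (_ : s + (Num.truncn (- (s + 1))).+2%:R = s + 1 + (Num.truncn (- (s + 1))).+1%:R); last first.
  by rewrite -[in LHS]natr1; ring.
by rewrite !invfM !invrK; aring.
Qed.

Lemma GammaS s : s != 0 -> Gamma (s + 1) = s * Gamma s.
Proof.
move=> s0; have := invGammaS s => /(congr1 GRing.inv).
by rewrite invrK invfM invrK => ->; rewrite mulrA mulfV// mul1r.
Qed.

Lemma Gamma_rising s k : (forall i : nat, s + i%:R != 0) ->
  Gamma (s + k%:R) = rising s k * Gamma s.
Proof.
move=> h; elim: k => [|k IH]; first by rewrite rising0 addr0 mul1r.
by rewrite -natr1 addrA GammaS// IH risingS; aring.
Qed.

Lemma Gamma_subn s k : (forall i : nat, 1 - s + i%:R != 0) ->
  Gamma (s - k%:R) = (-1) ^+ k * Gamma s / rising (1 - s) k.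
Proof.
move=> h; elim: k => [|k IH]; first by rewrite rising0 expr0 invr1 subr0 mul1r mulr1.
have sk : s - k.+1%:R != 0.
  apply: contra (h k) => /eqP e; apply/eqP.
  rewrite -[RHS]oppr0 -e -natr1; ring.
have := GammaS sk; rewrite (_ : s - k.+1%:R + 1 = s - k%:R); last first.
  by rewrite -natr1; ring.
rewrite IH => e; apply: (mulfI sk); rewrite -e risingS exprS invfM.
have r0 := rising_neq0 k h; have hk := h k.
rewrite (_ : s - k.+1%:R = - (1 - s + k%:R)); last by rewrite -natr1; ring.
by field; rewrite r0 hk.
Qed.

Lemma BetaE a b : Beta a b = Gamma a * Gamma b / Gamma (a + b).
Proof. by []. Qed.

Lemma Beta_pos a b : 0 < a -> 0 < b ->
  Beta a b = Gamma_pos a * Gamma_pos b / Gamma_pos (a + b).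
Proof. by move=> a0 b0; rewrite /Beta !GammaE// addr_gt0. Qed.

Lemma BetaC a b : Beta a b = Beta b a.
Proof. by rewrite /Beta [Gamma a * _]mulrC addrC. Qed.

Lemma Beta_gt0 a b : 0 < a -> 0 < b -> 0 < Beta a b.
Proof. by move=> a0 b0; rewrite Beta_pos// divr_gt0 ?mulr_gt0 ?Gamma_pos_gt0 ?addr_gt0. Qed.

Lemma has_int_Beta01 a b : 0 < a -> 0 < b ->
  has_int `]0, 1[ (fun w => w `^ (a - 1) * (1 - w) `^ (b - 1)) (Beta a b).
Proof. by move=> a0 b0; rewrite Beta_pos//; exact: has_int_Beta01_pos. Qed.

Lemma has_int_Beta_y a b : 0 < a -> 0 < b ->
  has_int `]0, +oo[ (fun v => v `^ (a - 1) * (1 + v) `^ (- (a + b))) (Beta a b).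
Proof. by move=> a0 b0; rewrite Beta_pos//; exact: has_int_Beta_y_raw. Qed.

Lemma addrn_neq0 a i : 0 < a -> a + i%:R != 0.
Proof. by move=> a0; rewrite gt_eqF// ltr_wpDr. Qed.

Lemma Beta_addn a b k : 0 < a -> 0 < b ->
  Beta (a + k%:R) b = Beta a b * rising a k / rising (a + b) k.
Proof.
move=> a0 b0; have ab := addr_gt0 a0 b0.
rewrite !BetaE (_ : a + k%:R + b = a + b + k%:R); last by ring.
rewrite !Gamma_rising; try by move=> i; exact: addrn_neq0.
by rewrite invfM; aring.
Qed.

(** Opposite shifts keep the sum of the arguments, hence the factor
    1/Gamma (a + b), whether or not a + b is a pole of Gamma. *)
Lemma Beta_shift a b k : 0 < a -> (forall i : nat, 1 - b + i%:R != 0) ->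
  Beta (a + k%:R) (b - k%:R) = Beta a b * rising a k * (-1) ^+ k / rising (1 - b) k.
Proof.
move=> a0 hb; rewrite !BetaE Gamma_rising; last by move=> i; exact: addrn_neq0.
rewrite Gamma_subn// (_ : a + k%:R + (b - k%:R) = a + b); last by ring.
by aring.
Qed.

End beta.

(** * The binomial series *)

Section binomial.
Context {R : realType}.
Local Opaque powR expR Gamma_pos.
Implicit Types (D E : set R) (F phi f g : R -> R) (a b c e x y v s w : R).

(** Coefficients of (1 - w)^(- a) in powers of w. *)
Definition bcoef a k : R := rising a k / k`!%:R.

Lemma fact_neq0 k : k`!%:R != 0 :> R.
Proof. by rewrite pnatr_eq0 -lt0n fact_gt0. Qed.

Lemma bcoef0 a : bcoef a 0 = 1.
Proof. by rewrite /bcoef rising0 fact0 divr1. Qed.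

(** The coefficients of (1 - w)^(- a) = (1 - w) (1 - w)^(- (a + 1)). *)
Lemma bcoef_pascal a k : bcoef a k.+1 = bcoef (a + 1) k.+1 - bcoef (a + 1) k.
Proof.
rewrite /bcoef risingSl risingS factS natrM; have := fact_neq0 k.
have : k.+1%:R != 0 :> R by rewrite pnatr_eq0.
rewrite -[k.+1%:R]natr1.
move: (k`!%:R : R) (k%:R : R) => x y.
by abstract_atoms; move=> h1 h2; field; rewrite h1 h2.
Qed.

Lemma bcoef_ge0 a k : 0 <= a -> 0 <= bcoef a k.
Proof. by move=> a0; rewrite divr_ge0 ?rising_ge0. Qed.

Lemma series_exp_le x n : 0 <= x -> series (exp_coeff x) n <= expR x.
Proof.
move=> x0; apply: nondecreasing_cvgn_le; last exact: is_cvg_series_exp_coeff.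
by apply/nondecreasing_seqP => m; rewrite /series/= big_nat_recr//= lerDl exp_coeff_ge0.
Qed.

(** For a > 0 the power (1 - w)^(- a) is, up to Gamma a, the integral of
    s^(a - 1) exp (- s) exp (s w); the exponential series is integrated
    termwise, dominated by its value at |w|. *)
Lemma cvg_binom_pos a w : 0 < a -> `|w| < 1 ->
  series (fun k => bcoef a k * w ^+ k) @ \oo --> (1 - w) `^ (- a).
Proof.
move=> a0 w1; have Ga := Gamma_pos_gt0 a0.
have w1' : 0 < 1 - w by rewrite subr_gt0 (le_lt_trans (ler_norm _)).
have w1'' : 0 < 1 - `|w| by rewrite subr_gt0.
pose f k s : R := s `^ (a - 1) * expR (- s) * exp_coeff (s * w) k.
have e1 s y : expR (- s) * expR (s * y) = expR (- ((1 - y) * s)).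
  by rewrite -expRD; congr expR; ring.
have fv k : has_int `]0, +oo[ (f k) (Gamma_pos a * (bcoef a k * w ^+ k)).
  have ak : 0 < a + k%:R by rewrite ltr_wpDr.
  have := has_int_scale (w ^+ k / k`!%:R) (measurable_itv _) (has_int_Gamma_pos ak).
  rewrite -GammaE// Gamma_rising; last by move=> i; exact: addrn_neq0.
  rewrite GammaE// (_ : w ^+ k / k`!%:R * (rising a k * Gamma_pos a) =
    Gamma_pos a * (bcoef a k * w ^+ k)); last by rewrite /bcoef; aring.
  apply: has_int_eq => // s /mem_oy s0; rewrite /f /exp_coeff/=.
  rewrite (_ : a + k%:R - 1 = a - 1 + k%:R); last by ring.
  by rewrite (powR_D _ _ s0) powR_mulrn ?ltW// exprMn; aring.
have mF : measurable_fun (`]0, +oo[%classic : set R)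
    (fun s => s `^ (a - 1) * expR (- ((1 - w) * s))) by exact: measurable_gamma.
have [||V hV cV] := has_int_series (measurable_itv _) fv mF (has_int_Gamma_scale w1'' a0).
- move=> s /mem_oy s0.
  have : (fun n => s `^ (a - 1) * expR (- s) * series (exp_coeff (s * w)) n) @ \oo
     --> s `^ (a - 1) * expR (- s) * expR (s * w).
    by apply: cvgM; [exact: cvg_cst|exact: is_cvg_series_exp_coeff].
  rewrite -mulrA e1; apply: cvg_trans; apply: near_eq_cvg; near=> n.
  by rewrite /series/= mulr_sumr.
- move=> s n /mem_oy s0; rewrite /series/= /f -mulr_sumr normrM.
  rewrite ger0_norm ?mulr_ge0 ?powR_ge0 ?expR_ge0//.
  rewrite -e1 [X in _ <= X]mulrA ler_wpM2l ?mulr_ge0 ?powR_ge0 ?expR_ge0//.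
  apply: le_trans (ler_norm_sum _ _ _) _.
  apply: le_trans (series_exp_le n _); last by rewrite mulr_ge0// ltW.
  rewrite /series/=; apply: ler_sum => k _.
  by rewrite /exp_coeff/= normrM normfV normrX normrM (gtr0_norm s0) (ger0_norm (ler0n _ _)).
have VE := has_int_uniq (has_int_Gamma_scale w1' a0) hV.
have : (fun n => (Gamma_pos a)^-1 * series (fun k => Gamma_pos a * (bcoef a k * w ^+ k)) n)
   @ \oo --> (Gamma_pos a)^-1 * V by apply: cvgM; [exact: cvg_cst|exact: cV].
rewrite -VE mulrCA mulVf ?gt_eqF// mulr1.
apply: cvg_trans; apply: near_eq_cvg; near=> n.
by rewrite /series/= -mulr_sumr mulKf// gt_eqF.
Unshelve. all: by end_near. Qed.

Lemma normr_rising a k : `|rising a k| <= rising (`|a| + 1) k.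
Proof.
rewrite /rising normr_prod; apply: ler_prod => i _.
rewrite normr_ge0/= (le_trans (ler_normD _ _))// normr_nat.
by rewrite lerD2r lerDl.
Qed.

(** The terms are at most those of the binomial series with exponent
    |a| + 1 > 0. *)
Lemma bcoef_summable a x : 0 <= x -> x < 1 ->
  cvgn (series (fun k => `|bcoef a k| * x ^+ k)).
Proof.
move=> x0 x1; have a0 : 0 < `|a| + 1 by rewrite ltr_wpDl.
have := cvg_binom_pos a0; rewrite -(ger0_norm x0) in x1 => /(_ _ x1) /cvgP.
apply: series_le_cvg => k.
- by apply: mulr_ge0 => //; exact: exprn_ge0.
- by apply: mulr_ge0; [apply: bcoef_ge0; exact: ltW|exact: exprn_ge0].
rewrite ler_wpM2r ?exprn_ge0// /bcoef normrM normfV (ger0_norm (ler0n _ _)).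
by rewrite ler_wpM2r ?invr_ge0// normr_rising.
Qed.

(** Multiplying the series for a + 1 by 1 - w gives the series for a, which
    carries the result from positive exponents to all of them. *)
Lemma cvg_binom a w : `|w| < 1 ->
  series (fun k => bcoef a k * w ^+ k) @ \oo --> (1 - w) `^ (- a).
Proof.
move=> w1; have w1' : 0 < 1 - w by rewrite subr_gt0 (le_lt_trans (ler_norm _)).
have [n] : exists n : nat, 0 < a + n%:R.
  exists (Num.truncn (- a)).+1.
  by rewrite -ltrBlDl sub0r truncnS_gt.
elim: n a => [|n IH] a; first by rewrite addr0 => a0; exact: cvg_binom_pos.
rewrite -natr1 addrCA addrC => a1; have {}IH := IH (a + 1) a1.
have c1 : series (fun k => bcoef (a + 1) k * w ^+ k) n0.+1 @[n0 --> \oo]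
    --> (1 - w) `^ (- (a + 1)) by rewrite cvg_shiftS.
rewrite -cvg_shiftS.
have -> : (1 - w) `^ (- a) = (1 - w) `^ (- (a + 1)) - w * (1 - w) `^ (- (a + 1)).
  rewrite -[X in _ = X - _]mul1r -mulrBl -[X in _ = X * _](powRr1 (ltW w1')) -(powR_D _ _ w1').
  by congr (_ `^ _); ring.
have : (fun n => series (fun k => bcoef (a + 1) k * w ^+ k) n.+1 -
    w * series (fun k => bcoef (a + 1) k * w ^+ k) n) @ \oo -->
    (1 - w) `^ (- (a + 1)) - w * (1 - w) `^ (- (a + 1)).
  by apply: cvgB => //; apply: cvgM => //; exact: cvg_cst.
apply: cvg_trans; apply: near_eq_cvg; near=> m.
rewrite /series/= !big_nat_recl//= !bcoef0 mulr_sumr -addrA -sumrB; congr (_ + _).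
by apply: eq_bigr => k _; rewrite (bcoef_pascal a) exprS; ring.
Unshelve. all: by end_near. Qed.

End binomial.

(** * The incomplete Beta integral *)

Section incomplete_beta.
Context {R : realType}.
Notation mu := (@lebesgue_measure R).
Local Opaque powR expR Gamma_pos Gamma Beta.
Implicit Types (D E : set R) (F phi f g : R -> R) (a b c e x y v s w : R).

Lemma has_int_scale_o c y f g V : 0 < c -> 0 < y ->
  (forall v, 0 < v < y -> {for v, continuous g}) ->
  (forall v, 0 < v < y -> 0 <= g v) ->
  (forall v, 0 < v < y -> f (c * v) = g v) ->
  has_int `]0, y[ g V -> has_int `]0, c * y[ f (c * V).
Proof.
move=> c0 y0 cg g0 fg hg.
apply/(@has_int_subst _ `]0, y[ _ (fun t => c * t) (fun=> c) f g).
- exact: exh_oo.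
- by move=> v _; exact: is_derive_scale.
- by move=> v _; exact: cvg_cst.
- by left.
- by move=> v /mem_oo; exact: cg.
- by move=> v /mem_oo; exact: g0.
- move=> v /mem_oo v0; split; [apply/mem_oo|by rewrite fg].
  by case/andP: v0 => v0 vy; rewrite mulr_gt0// ltr_pM2l.
- move=> t /mem_oo /andP[t0 t1]; exists (t / c); last by rewrite mulrC divfK ?gt_eqF.
  by apply/mem_oo; rewrite divr_gt0//= ltr_pdivrMr// mulrC.
by apply: has_int_eq (has_int_scale c _ hg) => // v _; rewrite gtr0_norm// mulrC.
Qed.

Lemma has_int_beta_scaled e b y : 0 < e -> b < 1 -> 0 < y ->
  has_int `]0, y[ (fun v => v `^ (e - 1) * (y - v) `^ (- b))
    (y `^ (e - b) * Beta e (1 - b)).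
Proof.
move=> e0 b1 y0; have b1' : 0 < 1 - b by rewrite subr_gt0.
have h := has_int_scale (y `^ (e - 1 - b)) (measurable_itv _) (has_int_Beta01 e0 b1').
have -> : y `^ (e - b) * Beta e (1 - b) = y * (y `^ (e - 1 - b) * Beta e (1 - b)).
  rewrite [RHS]mulrA -[X in _ = X * _ * _](powRr1 (ltW y0)) -(powR_D _ _ y0).
  by congr (_ `^ _ * _); ring.
rewrite -{1}(mulr1 y).
apply: has_int_scale_o h => //.
- move=> v /andP[v0 v1].
  apply: cvgM; first exact: cvg_cst.
  apply: cvgM; first by apply: cvg_powR => //; exact: cvg_id.
  apply: cvg_powR; first by rewrite subr_gt0.
  by apply: cvgB; [exact: cvg_cst|exact: cvg_id].
- by move=> v _; rewrite !mulr_ge0 ?powR_ge0.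
- move=> v /andP[v0 v1].
  have -> : y - y * v = y * (1 - v) by ring.
  have v1' : 0 <= 1 - v by rewrite subr_ge0 ltW.
  rewrite !(powRM _ (ltW y0))// ?(ltW v0)//.
  rewrite (_ : 1 - b - 1 = - b); last by ring.
  by rewrite [in RHS](powR_D _ _ y0); aring.
Qed.

Definition ibeta a b v : R :=
  \int[mu]_(w in `]0, v]) (w `^ (a - 1) * (1 - w) `^ (b - 1)).

Lemma has_int_ibeta a b v : 0 < a -> 0 < b -> v <= 1 ->
  has_int `]0, v[ (fun w => w `^ (a - 1) * (1 - w) `^ (b - 1)) (ibeta a b v).
Proof.
move=> a0 b0 v1.
have sub : (`]0, v[%classic : set R) `<=` `]0, 1[%classic.
  by move=> t /=; rewrite !in_itv/= => /andP[-> tv]/=; exact: lt_le_trans v1.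
have [u h] := has_int_sub (measurable_itv _) (measurable_itv _) sub (has_int_Beta01 a0 b0).
suff -> : ibeta a b v = u by [].
by have [_ e] := has_int_oc h; rewrite /ibeta /Rintegral e.
Qed.

Lemma ibeta1 a b : 0 < a -> 0 < b -> ibeta a b 1 = Beta a b.
Proof. by move=> a0 b0; exact: has_int_uniq (has_int_ibeta a0 b0 (lexx _)) (has_int_Beta01 a0 b0). Qed.

Lemma continuous_ibeta_fun a b v : 0 < v < 1 ->
  {for v, continuous (fun w : R => w `^ (a - 1) * (1 - w) `^ (b - 1))}.
Proof.
move=> /andP[v0 v1]; apply: cvgM; first by apply: cvg_powR => //; exact: cvg_id.
apply: cvg_powR; first by rewrite subr_gt0.
by apply: cvgB; [exact: cvg_cst|exact: cvg_id].
Qed.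

Lemma is_derive_primitive f u V x : 0 < x -> x < u -> has_int `]0, u[ f V ->
  {for x, continuous f} ->
  is_derive x 1 (fun y => \int[mu]_(w in `]0, y]) f w) (f x).
Proof.
move=> x0 xu h cf; have [i _] := has_int_oc h.
have x0' : (BRight 0 < BRight x)%O by rewrite bnd_simp.
have [d e] := @continuous_FTC1 _ f (BRight 0) x u xu i x0' cf.
by rewrite -e derive1E; exact: derivableP.
Qed.

Lemma is_derive_ibeta a b v : 0 < a -> 0 < b -> 0 < v < 1 ->
  is_derive v 1 (ibeta a b) (v `^ (a - 1) * (1 - v) `^ (b - 1)).
Proof.
move=> a0 b0 /andP[v0 v1].
apply: (is_derive_primitive v0 v1 (has_int_Beta01 a0 b0)).
by apply: continuous_ibeta_fun; rewrite v0.
Qed.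

Lemma isd_continuous f x a : is_derive x 1 f a -> {for x, continuous f}.
Proof. by move=> [d _]; apply/differentiable_continuous/derivable1_diffP. Qed.

Lemma series_le_lim (u : nat -> R) l n : (forall k, 0 <= u k) ->
  series u @ \oo --> l -> series u n <= l.
Proof.
move=> u0 ul; rewrite -(cvg_lim (@Rhausdorff R) ul).
apply: nondecreasing_cvgn_le; last exact: cvgP ul.
by apply/nondecreasing_seqP => m; rewrite /series/= big_nat_recr//= lerDl.
Qed.

(** For b <= 1 the coefficients are nonnegative, so that the integrand itself
    dominates the partial sums and v = 1 is allowed. *)
Lemma cvg_ibeta a b v : 0 < a -> 0 < b <= 1 -> 0 < v <= 1 ->
  series (fun k => bcoef (1 - b) k / (a + k%:R) * v `^ (a + k%:R)) @ \oo --> ibeta a b v.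
Proof.
move=> a0 /andP[b0 b1] /andP[v0 v1].
have b1' : 0 <= 1 - b by rewrite subr_ge0.
have ak k : 0 < a + k%:R by rewrite ltr_wpDr.
pose f k w := bcoef (1 - b) k * w `^ (a + k%:R - 1).
have f0 k w : 0 <= f k w by rewrite mulr_ge0 ?powR_ge0 ?bcoef_ge0.
have fv k : has_int `]0, v[ (f k) (bcoef (1 - b) k / (a + k%:R) * v `^ (a + k%:R)).
  rewrite (_ : _ / _ * _ = bcoef (1 - b) k * (v `^ (a + k%:R) / (a + k%:R))); last first.
    by rewrite mulrAC -mulrA.
  by apply: has_int_scale => //; exact: has_int_powR.
have hF := has_int_ibeta a0 b0 v1.
have cF x : 0 < x < v ->
    series (f ^~ x) @ \oo --> x `^ (a - 1) * (1 - x) `^ (b - 1).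
  move=> /andP[x0 xv].
  have x1 : `|x| < 1 by rewrite gtr0_norm// (lt_le_trans xv).
  have := @cvg_binom _ (1 - b) _ x1; rewrite opprB => h.
  have : (fun n => x `^ (a - 1) * series (fun k => bcoef (1 - b) k * x ^+ k) n) @ \oo
      --> x `^ (a - 1) * (1 - x) `^ (b - 1).
    by apply: cvgM => //; exact: cvg_cst.
  apply: cvg_trans; apply: near_eq_cvg; near=> n.
  rewrite /series/= mulr_sumr; apply: eq_bigr => k _; rewrite /f.
  rewrite (_ : a + k%:R - 1 = a - 1 + k%:R); last by ring.
  by rewrite (powR_D (a - 1) k%:R x0) powR_mulrn ?ltW//; move: (bcoef _ _) => B; aring.
have [||V hV cV] := has_int_series (measurable_itv _) fv (has_int_meas hF) hF.
- by move=> x /mem_oo; exact: cF.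
- move=> x n /mem_oo xi; rewrite ger0_norm; last by rewrite /series/=; exact: sumr_ge0.
  exact: (series_le_lim _ _ (cF _ xi)).
by rewrite (has_int_uniq hF hV).
Unshelve. all: by end_near. Qed.

Lemma rising_ratio a k : 0 < a -> rising a k / rising (a + 1) k = a / (a + k%:R).
Proof.
move=> a0; have := risingSl a k; rewrite risingS => e.
apply/eqP; rewrite eqr_div; first by rewrite e mulrC.
  by rewrite gt_eqF// rising_gt0// addr_gt0.
exact: addrn_neq0.
Qed.

(** Expand ibeta in powers of v: each term is a Beta integral on ]0, y[, and
    the quotients of rising factorials of these terms are those of the
    hypergeometric series. *)
Lemma has_int_ibeta_weighted a b c beta y : 0 < a -> 0 < b <= 1 -> 0 < a + c ->
  beta < 1 -> 0 < y <= 1 ->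
  has_int `]0, y[ (fun v => ibeta a b v * (v `^ (c - 1) * (y - v) `^ (- beta)))
    (y `^ (a + c - beta) / a * Beta (a + c) (1 - beta) *
     hyper3F2 (1 - b) (a + c) a (a + c + 1 - beta) (a + 1) y).
Proof.
move=> a0 b01 ac0 beta1 /andP[y0 y1]; have /andP[b0 b1] := b01.
have b1' : 0 <= 1 - b by rewrite subr_ge0.
have beta1' : 0 < 1 - beta by rewrite subr_gt0.
have ak k : 0 < a + k%:R by rewrite ltr_wpDr.
pose d k := bcoef (1 - b) k / (a + k%:R).
have d0 k : 0 <= d k by rewrite /d divr_ge0 ?bcoef_ge0// ltW.
pose m v := v `^ (c - 1) * (y - v) `^ (- beta).
have m0 v : 0 <= m v by rewrite mulr_ge0 ?powR_ge0.
pose f k v := d k * v `^ (a + k%:R) * m v.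
have fE k v : 0 < v -> f k v = d k * (v `^ (a + c + k%:R - 1) * (y - v) `^ (- beta)).
  move=> v0; rewrite /f /m (_ : a + c + k%:R - 1 = a + k%:R + (c - 1)); last by ring.
  by rewrite (powR_D (a + k%:R) (c - 1) v0); move: (d k) => dk; aring.
pose C := y `^ (a + c - beta) / a * Beta (a + c) (1 - beta).
(* the hypergeometric term, with the constant factor C taken out *)
pose t k := rising (1 - b) k * rising (a + c) k * rising a k /
   (rising (a + c + 1 - beta) k * rising (a + 1) k) * (y ^+ k / k`!%:R).
have fv k : has_int `]0, y[ (f k) (C * t k).
  have ack : 0 < a + c + k%:R by rewrite ltr_wpDr.
  have := has_int_scale (d k) (measurable_itv _) (has_int_beta_scaled ack beta1 y0).
  rewrite (Beta_addn _ ac0 beta1').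
  rewrite (_ : _ * (_ * _) = C * t k).
    by apply: has_int_eq => // v /mem_oo /andP[v0 _]; rewrite fE.
  rewrite /C /t /d /bcoef (_ : a + c + 1 - beta = a + c + (1 - beta)); last by ring.
  rewrite (_ : a + c + k%:R - beta = a + c - beta + k%:R); last by ring.
  rewrite (powR_D (a + c - beta) k%:R y0) powR_mulrn ?ltW//.
  have e : (a + k%:R)^-1 = a^-1 * (rising a k / rising (a + 1) k).
    by rewrite rising_ratio// mulrA mulVf ?gt_eqF// mul1r.
  rewrite e invfM.
  move: (y ^+ k) (rising (a + c + (1 - beta)) k)^-1 (rising (a + 1) k)^-1.
  by move: (k`!%:R^-1) (a^-1) => A1 A2 A3 A4 A5; aring.
have hm := has_int_beta_scaled ac0 beta1 y0.
(* v^(- a) times a partial sum for ibeta a b v increases with v: its value at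
   v = 1 is at most B *)
pose B := ibeta a b 1.
have hG := has_int_scale B (measurable_itv _) hm.
have cF v : 0 < v < y -> series (f ^~ v) @ \oo --> ibeta a b v * m v.
  move=> /andP[v0 vy]; have v01 : 0 < v <= 1 by rewrite v0/= (le_trans (ltW vy)).
  have : (fun n => series (fun k => d k * v `^ (a + k%:R)) n * m v) @ \oo
      --> ibeta a b v * m v by apply: cvgM; [exact: cvg_ibeta|exact: cvg_cst].
  by apply: cvg_trans; apply: near_eq_cvg; near=> n; rewrite /series/= mulr_suml.
have mF : measurable_fun (`]0, y[%classic : set R) (fun v => ibeta a b v * m v).
  apply: exhaustible_continuous_measurable; first exact: exh_oo.
  move=> v /mem_oo /andP[v0 vy]; apply: cvgM.
    by apply: (isd_continuous (is_derive_ibeta a0 b0 _)); rewrite v0 (lt_le_trans vy).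
  apply: cvgM; first by apply: cvg_powR => //; exact: cvg_id.
  apply: cvg_powR; first by rewrite subr_gt0.
  by apply: cvgB; [exact: cvg_cst|exact: cvg_id].
have [||V hV cV] := has_int_series (measurable_itv _) fv mF hG.
- by move=> v /mem_oo; exact: cF.
- move=> v n /mem_oo /andP[v0 vy]; rewrite ger0_norm; last first.
    by rewrite /series/=; apply: sumr_ge0 => k _;
    apply: mulr_ge0 => //; apply: mulr_ge0 => //; exact: powR_ge0.
  have -> : B * (v `^ (a + c - 1) * (y - v) `^ (- beta)) = B * v `^ a * m v.
    rewrite /m (_ : a + c - 1 = a + (c - 1)); last by ring.
    by rewrite (powR_D a (c - 1) v0); clearbody B; aring.
  rewrite /series/= -mulr_suml ler_wpM2r// [B * _]mulrC.
  have cB : series (fun k => d k) @ \oo --> B.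
    have := @cvg_ibeta a b 1 a0 b01; rewrite ltr01 lexx => /(_ isT).
    apply: cvg_trans; apply: near_eq_cvg; near=> N.
    by rewrite /series/=; apply: eq_bigr => k _; rewrite powR1/= mulr1.
  apply: (@le_trans _ _ (v `^ a * series d n)); last first.
    by rewrite ler_wpM2l ?powR_ge0//; exact: series_le_lim cB.
  rewrite /series/= mulr_sumr; apply: ler_sum => k _.
  rewrite (powR_D a k%:R v0) (powR_mulrn _ (ltW v0)) mulrCA ler_wpM2l ?powR_ge0//.
  by apply: ler_piMr => //; apply: exprn_ile1; [exact: ltW|exact: le_trans (ltW vy) y1].
have C0 : C != 0.
  apply: lt0r_neq0; apply: mulr_gt0; last exact: Beta_gt0.
  by apply: divr_gt0 => //; exact: powR_gt0.
suff ct : series t @ \oo --> V / C.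
  rewrite (_ : hyper3F2 _ _ _ _ _ _ = V / C); last exact: (cvg_lim (@Rhausdorff R) ct).
  by rewrite -/C mulrCA mulfV// mulr1.
have : (fun n => series (fun k => C * t k) n / C) @ \oo --> V / C.
  by apply: cvgM => //; exact: cvg_cst.
apply: cvg_trans; apply: near_eq_cvg; near=> n.
by rewrite /series/= -mulr_sumr [C * _]mulrC mulfK.
Unshelve. all: by end_near. Qed.

End incomplete_beta.

(** * Derivative of an inverse function *)

Section inverse_functions.
Context {R : realType}.
Notation mu := (@lebesgue_measure R).
Local Opaque powR expR Gamma_pos Gamma Beta.
Implicit Types (D E : set R) (F phi f g A S h : R -> R) (a b c e x y v s w u z : R).

Lemma ivl_split u w : 0 <= u -> u < w ->
  (`]0, w[%classic : set R) = `]0, u]%classic `|` `]u, w[%classic /\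
  (`]0, u]%classic : set R) `&` `]u, w[%classic = set0.
Proof.
move=> u0 uw; split.
  rewrite eqEsubset; split=> t /=; rewrite !in_itv/=.
    by move=> /andP[t0 tw]; have [tu|ut] := leP t u; [left; rewrite t0|right].
  by move=> [/andP[t0 tu]|/andP[ut tw]];
    [rewrite t0 (le_lt_trans tu)|rewrite tw (le_lt_trans u0)].
rewrite -subset0 => t [/=]; rewrite !in_itv/= => /andP[_ tu] /andP[ut _].
by have := le_lt_trans tu ut; rewrite ltxx.
Qed.

Lemma has_int_increment f u w U W : 0 <= u -> u < w ->
  has_int `]0, u[ f U -> has_int `]0, w[ f W -> has_int `]u, w[ f (W - U).
Proof.
move=> u0 uw hU hW; have [e d] := ivl_split u0 uw.
have sub : (`]u, w[%classic : set R) `<=` `]0, w[%classic by rewrite e; right.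
have [X hX] := has_int_sub (measurable_itv _) (measurable_itv _) sub hW.
have -> : W - U = X; last by [].
have := has_int_union (measurable_itv _) (measurable_itv _) e d (has_int_oc hU) hX.
by move=> /(has_int_uniq hW) ->; rewrite addrC addKr.
Qed.

Lemma has_int_cst_oo u w k : u < w -> has_int `]u, w[ (fun=> k) (k * (w - u)).
Proof.
by move=> uw; apply: has_int_cst => //; rewrite lebesgue_measure_itv/= lte_fin uw.
Qed.

Lemma increment_ge f u w U W m : 0 <= u -> u < w ->
  has_int `]0, u[ f U -> has_int `]0, w[ f W ->
  (forall t, u < t < w -> m <= f t) -> m * (w - u) <= W - U.
Proof.
move=> u0 uw hU hW fm.
apply: (has_int_le _ (has_int_cst_oo m uw) (has_int_increment u0 uw hU hW)) => //.
Qed.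

Lemma increment_le f u w U W m : 0 <= u -> u < w ->
  has_int `]0, u[ f U -> has_int `]0, w[ f W ->
  (forall t, u < t < w -> f t <= m) -> W - U <= m * (w - u).
Proof.
move=> u0 uw hU hW fm.
apply: (has_int_le _ (has_int_increment u0 uw hU hW) (has_int_cst_oo m uw)) => //.
Qed.

Lemma within_dnbhs_proper D y e : 0 < e -> (forall z, y < z < y + e -> D z) ->
  ProperFilter (within D y^').
Proof.
move=> e0 De; split; last exact: within_filter.
rewrite /within/= => -[r /= r0 br].
pose m := Num.min r e / 2.
have m0 : 0 < m by rewrite divr_gt0// lt_min r0.
have [mr me] : m < r /\ m < e.
  have : m < Num.min r e by rewrite /m ltr_pdivrMr// ltr_pMr ?ltr1n// lt_min r0.
  by rewrite lt_min => /andP[].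
apply: (br (y + m)) => /=.
- by rewrite opprD addNKr normrN gtr0_norm.
- by rewrite -subr_eq0 addrAC subrr add0r gt_eqF.
- by apply: De; rewrite ltrDl m0 ltrD2l.
Qed.

(** The difference quotients of an inverse S of A are the inverses of those of
    A; a bound on the latter makes S locally Lipschitz, and the quotients are
    then squeezed between two values of the continuous function h. *)
Lemma derive_within_inverse D E A S h u K r e0 : E u ->
  (forall v w, E v -> E w -> v < w ->
     [/\ 0 < A w - A v, Num.min (h v) (h w) * (A w - A v) <= w - v &
         w - v <= Num.max (h v) (h w) * (A w - A v)]) ->
  (forall z, D z -> exists2 v, E v & A v = z) ->
  (forall v, E v -> S (A v) = v) ->
  (forall e, 0 < e -> exists2 d, 0 < d &
     forall v, E v -> `|v - u| < d -> `|h v - h u| < e) ->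
  0 < r -> 0 < K -> (forall v, E v -> `|A v - A u| < r -> h v <= K) -> h u <= K ->
  0 < e0 -> (forall z, A u < z < A u + e0 -> D z) ->
  derive_within D S (A u) = h u.
Proof.
move=> Eu AE DE SA hc r0 K0 hK huK e00 De.
have PF := within_dnbhs_proper e00 De.
rewrite /derive_within; apply: cvg_lim => //.
apply/cvgrPdist_lt => e e1.
have [d d0 hd] := hc _ e1.
have Kd : 0 < d / K by rewrite divr_gt0.
suff : forall z, D z -> z != A u -> `|z - A u| < r -> `|z - A u| < d / K ->
    `|h u - (S z - S (A u)) / (z - A u)| < e.
  move=> H; rewrite /within/=; exists (Num.min r (d / K)) => /=.
    by rewrite lt_min r0.
  move=> z /=; rewrite lt_min distrC => /andP[zr zd] zA Dz.
  by apply: H.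
move=> z Dz; have [v Ev <-] := DE _ Dz => vu vr vd.
rewrite !SA//.
have key v1 v2 : E v1 -> E v2 -> v1 < v2 -> h v1 <= K -> h v2 <= K ->
    `|A v2 - A v1| < d / K ->
    [/\ 0 < A v2 - A v1, v2 - v1 < d,
     Num.min (h v1) (h v2) <= (v2 - v1) / (A v2 - A v1) &
     (v2 - v1) / (A v2 - A v1) <= Num.max (h v1) (h v2)].
  move=> E1 E2 lt12 k1 k2 ad; have [p1 p2 p3] := AE _ _ E1 E2 lt12.
  split => //; last 2 first.
  - by rewrite ler_pdivlMr.
  - by rewrite ler_pdivrMr.
  apply: (le_lt_trans p3); apply: (@le_lt_trans _ _ (K * (A v2 - A v1))).
    by rewrite ler_wpM2r ?(ltW p1)// ge_max k1.
  by rewrite mulrC -ltr_pdivlMr// -(gtr0_norm p1).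
have hv := hK _ Ev vr.
have cl (q : R) : `|v - u| < d -> Num.min (h v) (h u) <= q -> q <= Num.max (h v) (h u) ->
    `|h u - q| < e.
  move=> /(hd _ Ev) huv q1 q2; rewrite distrC.
  apply: le_lt_trans huv; move: q1 q2.
  rewrite ge_min le_max ler_norml => /orP q1 /orP q2.
  have n0 := normr_ge0 (h v - h u).
  have := ler_norm (h v - h u); have := ler_norm (- (h v - h u)); rewrite normrN.
  by case: q1; case: q2; lra.
have [lt|lt|e2] := ltgtP v u.
- have vd' : `|A u - A v| < d / K by rewrite distrC.
  have [p1 p2 p3 p4] := key _ _ Ev Eu lt hv huK vd'.
  rewrite (_ : (v - u) / (A v - A u) = (u - v) / (A u - A v)); last first.
    by rewrite -(opprB u v) -(opprB (A u)) invrN mulrNN.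
  by apply: cl => //; rewrite distrC gtr0_norm// subr_gt0.
- have [p1 p2 p3 p4] := key _ _ Eu Ev lt huK hv vd.
  by apply: cl; rewrite 1?minC 1?maxC// gtr0_norm// subr_gt0.
- by move: vu; rewrite e2 eqxx.
Qed.

Lemma powR_continuous_ge0 q u : 1 < q -> 0 <= u -> forall e, 0 < e ->
  exists2 d, 0 < d & forall v, 0 <= v -> `|v - u| < d -> `|v `^ q - u `^ q| < e.
Proof.
move=> q1; have q0 : 0 < q := lt_trans ltr01 q1.
rewrite le_eqVlt => /predU1P[<-|u0] e e0.
  exists (Num.min 1 e); first by rewrite lt_min ltr01.
  move=> v v0; rewrite (powR0 (lt0r_neq0 q0)) !subr0 !ger0_norm ?powR_ge0//.
  rewrite lt_min => /andP[v1 ve].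
  move: v0; rewrite le_eqVlt => /predU1P[<-|v0]; first by rewrite (powR0 (lt0r_neq0 q0)).
  apply: le_lt_trans ve; apply: ge1r_powR; last exact: ltW.
  by rewrite v0/= ltW.
have := @continuous_powR R q u u0; rewrite /prop_for /continuous_at.
move=> /cvgrPdist_lt /(_ _ e0) [d /= d0 H]; exists d => // v v0 vd.
by rewrite distrC; apply: H; rewrite /= distrC.
Qed.

Lemma powR_continuous_eps b x e : 0 < x -> 0 < e ->
  exists2 d, 0 < d & forall y, `|y - x| < d -> `|y `^ b - x `^ b| < e.
Proof.
move=> x0 e0; have := @continuous_powR R b x x0; rewrite /prop_for /continuous_at.
move=> /cvgrPdist_lt /(_ _ e0) [d /= d0 H]; exists d => // y yd.
by rewrite distrC; apply: H; rewrite /= distrC.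
Qed.

Lemma ibeta0 a b : ibeta a b 0 = 0 :> R.
Proof.
by rewrite /ibeta /Rintegral set_itv_ge ?bnd_simp ?ltxx// integral_set0.
Qed.

(** The substitution 1 - w exchanges the two exponents. *)
Lemma ibeta_reflect a b v : 0 < a -> 0 < b -> 0 <= v <= 1 ->
  ibeta a b (1 - v) = Beta a b - ibeta b a v.
Proof.
move=> a0 b0 /andP[v0 v1].
move: v0; rewrite le_eqVlt => /predU1P[<-|v0].
  by rewrite subr0 ibeta1// ibeta0 subr0.
have h1 := has_int_ibeta b0 a0 v1.
have h2 : has_int `]1 - v, 1[ (fun w => w `^ (a - 1) * (1 - w) `^ (b - 1)) (ibeta b a v).
  apply/(@has_int_subst _ `]0, v[ _ (fun w => 1 - w) (fun=> -1) _
     (fun w => w `^ (b - 1) * (1 - w) `^ (a - 1))).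
  - exact: exh_oo.
  - move=> w _; apply: isd_eq (isd_add (isd_cst 1 w) (isd_opp (isd_id w))) _.
    by rewrite add0r.
  - by move=> w _; exact: cvg_cst.
  - by right => w _; rewrite oppr_lt0.
  - by move=> w /mem_oo /andP[w0 wv]; apply: continuous_ibeta_fun; rewrite w0 (lt_le_trans wv).
  - by move=> w _; rewrite mulr_ge0 ?powR_ge0.
  - move=> w /mem_oo /andP[w0 wv]; split.
      by apply/mem_oo; rewrite ltrD2l ltrN2 wv/= gtrBl.
    by rewrite subKr mulrC.
  - move=> t /mem_oo /andP[t0 t1]; exists (1 - t); last by rewrite subKr.
    by apply/mem_oo; rewrite subr_gt0 t1/= ltrBlDr -ltrBlDl.
  by apply: has_int_eq h1 => // w _; rewrite normrN1 mulr1.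
have v1' : 0 <= 1 - v by rewrite subr_ge0.
have v1'' : 1 - v < 1 by rewrite gtrBl.
have h3 := has_int_ibeta a0 b0 (ltW v1'').
have := has_int_increment v1' v1'' h3 (has_int_Beta01 a0 b0).
by move=> /(has_int_uniq h2) ->; rewrite subKr.
Qed.

End inverse_functions.

(** * The functions arcsin, sin and cos *)

Section arcsin.
Context {R : realType}.
Notation mu := (@lebesgue_measure R).
Local Opaque powR expR Gamma_pos Gamma Beta ibeta.
Implicit Types (D E : set R) (F phi f g A S h : R -> R) (a b c e x y v s w u z : R).

Lemma ct_cst c x : {for x, continuous (fun=> c : R)}.
Proof. exact: cvg_cst. Qed.

Lemma ct_id x : {for x, continuous (fun t : R => t)}.
Proof. exact: cvg_id. Qed.

Lemma ct_add f g x : {for x, continuous f} -> {for x, continuous g} ->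
  {for x, continuous (fun t => f t + g t)}.
Proof. by move=> cf cg; exact: (cvgD cf cg). Qed.

Lemma ct_sub f g x : {for x, continuous f} -> {for x, continuous g} ->
  {for x, continuous (fun t => f t - g t)}.
Proof. by move=> cf cg; exact: (cvgB cf cg). Qed.

Lemma ct_mul f g x : {for x, continuous f} -> {for x, continuous g} ->
  {for x, continuous (fun t => f t * g t)}.
Proof. by move=> cf cg; exact: (cvgM cf cg). Qed.

Lemma ct_powR f x e : 0 < f x -> {for x, continuous f} ->
  {for x, continuous (fun t => f t `^ e)}.
Proof. by move=> f0 cf; apply: cvg_powR. Qed.

Lemma has_int_closed y f V : has_int `]0, y[ f V -> \int[mu]_(t in `[0, y]) f t = V.
Proof.
move=> h; have mf := has_int_meas h; have [_ e] := h.
rewrite /Rintegral integral_itv_bndoo ?e//; exact/measurable_EFinP.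
Qed.

Lemma powR1r e : 1 `^ e = 1 :> R.
Proof. by rewrite powR1. Qed.

Section pq.
Context (p q : R) (hp : 1 < p) (hq : 1 < q).

Let p0 : 0 < p := lt_trans ltr01 hp.
Let q0 : 0 < q := lt_trans ltr01 hq.
Let ip0 : 0 < p^-1. Proof. by rewrite invr_gt0. Qed.
Let iq0 : 0 < q^-1. Proof. by rewrite invr_gt0. Qed.
Let ip1 : 0 < 1 - p^-1. Proof. by rewrite subr_gt0 invf_lt1. Qed.
Let qn0 : q != 0 := lt0r_neq0 q0.

Lemma powR_root_lt1 v : 0 <= v -> v < 1 -> v `^ q^-1 < 1.
Proof. by move=> v0 v1; have := ltr_powR iq0 v0 v1; rewrite powR1. Qed.

Lemma powRq_lt1 v : 0 <= v -> v < 1 -> v `^ q < 1.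
Proof. by move=> v0 v1; have := ltr_powR q0 v0 v1; rewrite powR1. Qed.

Lemma powRq_le1 v : 0 <= v <= 1 -> 0 <= v `^ q <= 1.
Proof.
move=> /andP[v0]; rewrite powR_ge0 le_eqVlt => /predU1P[->|v1]; first by rewrite powR1 lexx.
by rewrite ltW// powRq_lt1.
Qed.

Lemma has_int_root_subst v f V : 0 < v ->
  (forall w, 0 < w < v -> {for w, continuous (fun w => f (w `^ q^-1))}) ->
  (forall w, 0 < w < v -> 0 <= f (w `^ q^-1)) ->
  has_int `]0, v[ (fun w => q^-1 * (w `^ (q^-1 - 1) * f (w `^ q^-1))) V ->
  has_int `]0, v `^ q^-1[ f V.
Proof.
move=> v0 cf f0 hV.
apply/(@has_int_subst _ `]0, v[ _ (fun w => w `^ q^-1) (fun w => q^-1 * w `^ (q^-1 - 1)) _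
     (fun w => f (w `^ q^-1))).
- exact: exh_oo.
- move=> w /mem_oo /andP[w0 _]; apply: isd_eq (isd_powR q^-1 w0 (isd_id w)) _.
  by rewrite mulr1.
- move=> w /mem_oo /andP[w0 _]; apply: ct_mul; first exact: ct_cst.
  by apply: ct_powR => //; exact: ct_id.
- by left => w /mem_oo /andP[w0 _]; rewrite mulr_gt0// powR_gt0.
- by move=> w /mem_oo; exact: cf.
- by move=> w /mem_oo; exact: f0.
- move=> w /mem_oo /andP[w0 wv]; split => //; apply/mem_oo.
  by rewrite powR_gt0//= ltr_powR// ltW.
- move=> t /mem_oo /andP[t0 t1]; exists (t `^ q); last by apply: powR_powR => //; exact: ltW.
  apply/mem_oo; rewrite powR_gt0//= -[X in _ < X](powR_powRV (ltW v0) qn0).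
  by apply: ltr_powR => //; exact: ltW.
apply: has_int_eq hV => // w _.
rewrite ger0_norm; first by rewrite [RHS]mulrC mulrA.
by apply: mulr_ge0; [exact: ltW|exact: powR_ge0].
Qed.

Lemma has_int_arcsin_root v : 0 < v <= 1 ->
  has_int `]0, v `^ q^-1[ (fun t => (1 - t `^ q) `^ (- p^-1))
    (q^-1 * ibeta q^-1 (1 - p^-1) v).
Proof.
move=> /andP[v0 v1].
apply: has_int_root_subst => //.
- move=> w /andP[w0 wv].
  have e : (w `^ q^-1) `^ q = w := powR_powRV (ltW w0) qn0.
  apply: (ct_powR (f := fun w => 1 - (w `^ q^-1) `^ q)).
    by rewrite e subr_gt0 (lt_le_trans wv).
  apply: ct_sub; first exact: ct_cst.
  apply: (ct_powR (f := fun w => w `^ q^-1)); first exact: powR_gt0.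
  by apply: ct_powR => //; exact: ct_id.
- by move=> w _; exact: powR_ge0.
apply: has_int_eq (has_int_scale q^-1 (measurable_itv _) (has_int_ibeta iq0 ip1 v1)) => // w /mem_oo /andP[w0 _].
rewrite (powR_powRV (ltW w0) qn0); congr (_ * (_ * _ `^ _)); ring.
Qed.

Lemma arcsin0 : arcsinpq p q 0 = 0.
Proof. by rewrite /arcsinpq set_itv1 Rintegral_set1. Qed.

Lemma arcsin_root v : 0 <= v <= 1 ->
  arcsinpq p q (v `^ q^-1) = q^-1 * ibeta q^-1 (1 - p^-1) v.
Proof.
move=> /andP[]; rewrite le_eqVlt => /predU1P[<- _|v0 v1].
  by rewrite (powR0 (lt0r_neq0 iq0)) arcsin0 ibeta0 mulr0.
by apply: has_int_closed; apply: has_int_arcsin_root; rewrite v0.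
Qed.

Lemma has_int_arcsin u : 0 <= u <= 1 ->
  has_int `]0, u[ (fun t => (1 - t `^ q) `^ (- p^-1)) (arcsinpq p q u).
Proof.
move=> /andP[]; rewrite le_eqVlt => /predU1P[<- _|u0 u1].
  rewrite arcsin0 set_itv_ge ?bnd_simp ?ltxx//.
  by split; [exact: integrable_set0|rewrite integral_set0].
have uq : 0 < u `^ q by rewrite powR_gt0.
have uq1 : 0 < u `^ q <= 1 
  by rewrite uq; have /powRq_le1 /andP[] : 0 <= u <= 1 by rewrite ltW.
have := has_int_arcsin_root uq1; rewrite -arcsin_root ?(ltW uq)//; last by case/andP: uq1.
by rewrite (powR_powR (ltW u0) qn0).
Qed.

(** The integrand increases, so its end values bound its mean on [v, w]; these
    are the bounds on difference quotients that derive_within_inverse takes. *)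
Lemma arcsin_increment v w : 0 <= v -> v < w -> w <= 1 ->
  [/\ 0 < arcsinpq p q w - arcsinpq p q v,
    (1 - w `^ q) `^ p^-1 * (arcsinpq p q w - arcsinpq p q v) <= w - v &
    w - v <= (1 - v `^ q) `^ p^-1 * (arcsinpq p q w - arcsinpq p q v)].
Proof.
move=> v0 vw w1.
have v1 : v < 1 := lt_le_trans vw w1.
have w0 : 0 <= w := le_trans v0 (ltW vw).
have hv := @has_int_arcsin v; rewrite v0 (ltW v1) in hv; have {}hv := hv isT.
have hw := @has_int_arcsin w; rewrite w0 w1 in hw; have {}hw := hw isT.
have v1q : 0 < 1 - v `^ q by rewrite subr_gt0 powRq_lt1.
have lo : (1 - v `^ q) `^ (- p^-1) * (w - v) <= arcsinpq p q w - arcsinpq p q v.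
  apply: (increment_ge v0 vw hv hw) => t /andP[vt tw].
  have t1 : t < 1 := lt_le_trans tw w1.
  have t0 : 0 <= t := le_trans v0 (ltW vt).
  have : 0 < 1 - t `^ q by rewrite subr_gt0 powRq_lt1.
  have : 1 - t `^ q < 1 - v `^ q by rewrite ltrD2l ltrN2 ltr_powR.
  by move=> h1 h2; apply: ltW; apply: ltr_powR_neg => //; rewrite oppr_lt0.
have vpos : 0 < (1 - v `^ q) `^ p^-1 by rewrite powR_gt0.
have wv : 0 < w - v by rewrite subr_gt0.
split.
- by apply: lt_le_trans lo; rewrite mulr_gt0 ?powR_gt0.
- move: w1; rewrite le_eqVlt => /predU1P[e|w1].
    by rewrite e powR1 subrr (powR0 (lt0r_neq0 ip0)) mul0r -e ltW.
  have w1q : 0 < 1 - w `^ q by rewrite subr_gt0 powRq_lt1.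
  have wpos : 0 < (1 - w `^ q) `^ p^-1 by rewrite powR_gt0.
  have : arcsinpq p q w - arcsinpq p q v <= (1 - w `^ q) `^ (- p^-1) * (w - v).
    apply: (increment_le v0 vw hv hw) => t /andP[vt tw].
    have t0 : 0 <= t := le_trans v0 (ltW vt).
    have : 1 - w `^ q < 1 - t `^ q by rewrite ltrD2l ltrN2 ltr_powR.
    by move=> h1; apply: ltW; apply: ltr_powR_neg => //; rewrite oppr_lt0.
  by rewrite powRN mulrC ler_pdivlMr// mulrC.
- by move: lo; rewrite powRN mulrC ler_pdivrMr// mulrC.
Qed.

Lemma arcsin_inj v w : 0 <= v <= 1 -> 0 <= w <= 1 ->
  arcsinpq p q v = arcsinpq p q w -> v = w.
Proof.
move=> /andP[v0 v1] /andP[w0 w1] e; apply/eqP; case: ltgtP => // lt.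
  by have [] := arcsin_increment v0 lt w1; rewrite e subrr ltxx.
by have [] := arcsin_increment w0 lt v1; rewrite e subrr ltxx.
Qed.

Lemma sin_arcsin u : 0 <= u <= 1 -> sinpq p q (arcsinpq p q u) = u.
Proof.
move=> u01; rewrite /sinpq; apply: pinvKV; last by rewrite inE/= in_itv.
by move=> v w; rewrite !inE/= !in_itv/=; exact: arcsin_inj.
Qed.

Lemma arcsin_le v w : 0 <= v -> v <= w -> w <= 1 -> arcsinpq p q v <= arcsinpq p q w.
Proof.
move=> v0; rewrite le_eqVlt => /predU1P[->//|vw] w1.
by have [] := arcsin_increment v0 vw w1; rewrite subr_gt0 => /ltW.
Qed.

Lemma arcsin_lt v w : 0 <= v -> v < w -> w <= 1 -> arcsinpq p q v < arcsinpq p q w.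
Proof. by move=> v0 vw w1; have [] := arcsin_increment v0 vw w1; rewrite subr_gt0. Qed.

Lemma arcsin_surj x : 0 <= x <= hpi p q ->
  exists2 u, 0 <= u <= 1 & arcsinpq p q u = x.
Proof.
move=> /andP[x0 xh].
have h01 : 0 <= (1 : R) <= 1 by rewrite ler01 lexx.
have i' : mu.-integrable `[0, 1] (EFin \o (fun t => (1 - t `^ q) `^ (- p^-1))).
  have [i2 _] := has_int_oc (has_int_arcsin h01).
  move: i2 => /integrableP[m f]; apply/integrableP.
  have m' : measurable_fun (`[0, 1]%classic : set R) (fun t => (1 - t `^ q) `^ (- p^-1)).
    by apply: measurable_funTS; apply: measurable_powRf; apply: measurable_funB.
  split; first exact/measurable_EFinP.
  rewrite -(integral_itv_obnd_cbnd (f := fun x => `|(EFin \o _) x|%E))//.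
  exact: measurableT_comp.
have c := parameterized_integral_continuous ler01 i'.
have [] := @IVT _ (arcsinpq p q) 0 1 x ler01 c.
  by rewrite arcsin0 ge_min x0/= le_max [X in _ || X]xh orbT.
by move=> u; rewrite in_itv/= => u01 e; exists u.
Qed.

Lemma cos_arcsin u : 0 <= u < 1 ->
  cospq p q (arcsinpq p q u) = (1 - u `^ q) `^ p^-1.
Proof.
move=> /andP[u0 u1]; rewrite /cospq.
have uq : 0 < 1 - u `^ q by rewrite subr_gt0 powRq_lt1.
have lt : arcsinpq p q u < hpi p q by exact: arcsin_lt.
have h1 v : 0 <= v <= 1 -> (1 - v `^ q) `^ p^-1 <= 1.
  move=> /powRq_le1 /andP[v0 v1]; rewrite -[X in _ <= X](powR1r p^-1).
  apply: ge0_ler_powR; rewrite ?nnegrE ?(ltW ip0)// ?subr_ge0//.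
  by rewrite gerBl.
apply: (@derive_within_inverse _ _ `[0, 1] (arcsinpq p q) _
  (fun v => (1 - v `^ q) `^ p^-1) u 1 1 (hpi p q - arcsinpq p q u)) => //.
- by rewrite /= in_itv/= u0 ltW.
- move=> v w; rewrite /= !in_itv/= => /andP[v0 v1] /andP[w0 w1] vw.
  have [i1 i2 i3] := arcsin_increment v0 vw w1; split => //.
    apply: le_trans i2; apply: ler_wpM2r; first exact: ltW.
    by rewrite ge_min [X in _ || X]lexx orbT.
  apply: (le_trans i3); apply: ler_wpM2r; first exact: ltW.
    by rewrite le_max [X in X || _]lexx.
- move=> z; rewrite /= in_itv/= => /arcsin_surj [v v01 e]; exists v => //.
- by move=> v; rewrite /= in_itv/=; exact: sin_arcsin.
- move=> e e0; have [d d0 hd] := powR_continuous_eps p^-1 uq e0.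
  have [d' d'0 hd'] := powR_continuous_ge0 hq u0 d0.
  exists d' => // v; rewrite /= in_itv/= => /andP[v0 v1] vd; apply: hd.
  rewrite (_ : 1 - v `^ q - (1 - u `^ q) = - (v `^ q - u `^ q)); last by aring.
  by rewrite normrN; exact: hd'.
- by move=> v; rewrite /= in_itv/= => v01 _; exact: h1.
- by apply: h1; rewrite u0 ltW.
- by rewrite subr_gt0.
- move=> z; rewrite addrC subrK => /andP[z1 z2]; rewrite /= in_itv/= (ltW z2) andbT.
  by apply: le_trans (ltW z1); rewrite -arcsin0; apply: arcsin_le => //; exact: ltW.
Qed.

Lemma hpiE : hpi p q = q^-1 * Beta q^-1 (1 - p^-1).
Proof.
have := arcsin_root (v := 1); rewrite powR1 ler01 lexx => /(_ isT).
by rewrite -/(hpi p q) ibeta1.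
Qed.

End pq.
End arcsin.

(** * Integrals of the sine *)

Section sine_integrals.
Context {R : realType}.
Notation mu := (@lebesgue_measure R).
Local Opaque powR expR Gamma_pos Gamma Beta ibeta hyper3F2.
Context (p q : R) (hp : 1 < p) (hq : 1 < q).
Implicit Types (alpha beta x u v w y t : R).

Let p0 : 0 < p := lt_trans ltr01 hp.
Let q0 : 0 < q := lt_trans ltr01 hq.
Let ip0 : 0 < p^-1. Proof. by rewrite invr_gt0. Qed.
Let iq0 : 0 < q^-1. Proof. by rewrite invr_gt0. Qed.
Let ip1 : 0 < 1 - p^-1. Proof. by rewrite subr_gt0 invf_lt1. Qed.
Let ip1' : 0 < 1 - p^-1 <= 1. Proof. by rewrite ip1/= gerBl ltW. Qed.
Let iq1' : 0 < q^-1 <= 1. Proof. by rewrite iq0/= ltW// invf_lt1. Qed.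
Let qn0 : q != 0 := lt0r_neq0 q0.
Let pn0 : p != 0 := lt0r_neq0 p0.

(** In the variable v = sin^q t one has t = q^-1 * ibeta q^-1 (1 - p^-1) v, and
    dt and the weight are powers of v, 1 - v and y - v in which those of 1 - v
    cancel. *)
Lemma sine_integral_left alpha beta x : alpha < 2 -> beta < 1 ->
  0 < x -> x <= hpi p q ->
  (\int[mu]_(t in `]0%R, x[)
      (t * sinpq p q t `^ (- alpha) * cospq p q t
       / (sinpq p q x `^ q - sinpq p q t `^ q) `^ beta)%:E)%E
   = (q^-1 * Beta ((2 - alpha) / q) (1 - beta)
      * sinpq p q x `^ (2 - alpha - q * beta)
      * hyper3F2 p^-1 ((2 - alpha) / q) q^-1
          ((2 - alpha) / q + 1 - beta) (q^-1 + 1)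
          (sinpq p q x `^ q))%:E.
Proof.
move=> alpha2 beta1 x0 xh.
have [|u u01 ux] := @arcsin_surj _ _ _ hp hq x; first by rewrite ltW.
have -> : sinpq p q x = u by rewrite -ux; apply: sin_arcsin.
have u0 : 0 < u.
  rewrite lt_neqAle eq_sym (andP u01).1 andbT; apply: contraTneq x0 => u0.
  by rewrite -ux u0 arcsin0 ltxx.
pose y := u `^ q.
have y0 : 0 < y by rewrite powR_gt0.
have y1 : y <= 1 by have /andP[] := powRq_le1 hq u01.
have yu : y `^ q^-1 = u by apply: powR_powR => //; exact: ltW.
pose a := q^-1; pose b := 1 - p^-1; pose c := (1 - alpha) / q.
have ac : a + c = (2 - alpha) / q by rewrite /a /c; field.
have ac0 : 0 < a + c by rewrite ac divr_gt0// subr_gt0.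
have K := has_int_ibeta_weighted iq0 ip1' ac0 beta1 (y := y).
have {}K := K ltac:(by rewrite y0).
pose F v := q^-1 * ibeta a b v.
have FE v : 0 < v < y -> arcsinpq p q (v `^ q^-1) = F v.
  move=> /andP[v0 vy]; apply: arcsin_root => //.
  by rewrite (ltW v0)/= (le_trans (ltW vy)).
pose g v := F v * (v `^ q^-1) `^ (- alpha) * (1 - v) `^ p^-1 * (y - v) `^ (- beta).
have lt1 v : 0 < v < y -> 0 < v < 1 by move=> /andP[-> vy]; exact: lt_le_trans y1.
have dF v : 0 < v < y -> is_derive v 1 F (q^-1 * (v `^ (a - 1) * (1 - v) `^ (b - 1))).
  move=> /lt1 v01; apply: isd_eq (isd_mul (isd_cst q^-1 v) (is_derive_ibeta iq0 ip1 v01)) _.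
  by rewrite mulr0 addr0.
have FD v : 0 < v < y -> 0 < F v < x.
  move=> v01; rewrite -FE// -ux -(arcsin0 p q).
  have /andP[v0 vy] := v01; have /andP[u0' u1] := u01.
  have vu : v `^ q^-1 < u by rewrite -yu ltr_powR// ltW.
  apply/andP; split; first by apply: arcsin_lt => //; [exact: powR_gt0|exact: le_trans (ltW vu) u1].
  by apply: arcsin_lt => //; exact: powR_ge0.
set W := (q^-1 * _ * _ * _).
suff : has_int `]0, x[ (fun t => t * sinpq p q t `^ (- alpha) * cospq p q t
       / (y - sinpq p q t `^ q) `^ beta) W by move=> [].
apply/(@has_int_subst _ `]0, y[ _ F (fun v => q^-1 * (v `^ (a - 1) * (1 - v) `^ (b - 1))) _ g).
- exact: exh_oo.
- move=> v /mem_oo /lt1 v01; apply: ct_mul; first exact: ct_cst.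
  exact: continuous_ibeta_fun.
- left => v /mem_oo /lt1 /andP[v0 v1].
  by rewrite mulr_gt0// mulr_gt0 ?powR_gt0// subr_gt0.
- move=> v /mem_oo vy; have /andP[v0 v1] := lt1 _ vy.
  apply: ct_mul; last first.
    apply: (ct_powR (f := fun v => y - v)); first by rewrite subr_gt0; case/andP: vy.
    by apply: ct_sub; [exact: ct_cst|exact: ct_id].
  apply: ct_mul; last first.
    apply: (ct_powR (f := fun v => 1 - v)); first by rewrite subr_gt0.
    by apply: ct_sub; [exact: ct_cst|exact: ct_id].
  apply: ct_mul; first exact: isd_continuous (dF _ vy).
  apply: (ct_powR (f := fun v => v `^ q^-1)); first exact: powR_gt0.
  by apply: ct_powR => //; exact: ct_id.
- move=> v /mem_oo /FD /andP[F0 _].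
  by rewrite mulr_ge0 ?powR_ge0// mulr_ge0 ?powR_ge0// mulr_ge0 ?powR_ge0// ltW.
- move=> v /mem_oo vy; split; first by apply/mem_oo; exact: FD.
  have /andP[v0 v1] := lt1 _ vy.
  have r01 : 0 <= v `^ q^-1 < 1 by rewrite powR_ge0 powR_root_lt1// ltW.
  have r01' : 0 <= v `^ q^-1 <= 1 by case/andP: r01 => -> /ltW.
  rewrite -FE// (sin_arcsin hp hq r01') (cos_arcsin hp hq r01).
  by rewrite (powR_powRV (ltW v0) qn0) /g FE// (powRN (y - v)).
- move=> t /mem_oo /andP[t0 tx].
  have [|w w01 wt] := @arcsin_surj _ _ _ hp hq t.
    by rewrite (ltW t0)/= (le_trans (ltW tx)).
  have /andP[w0 w1] := w01.
  have w0' : 0 < w.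
    rewrite lt_neqAle eq_sym w0 andbT; apply: contraTneq t0 => w0'.
    by rewrite -wt w0' arcsin0 ltxx.
  have wu : w < u.
    rewrite ltNge; apply/negP => uw; move: tx; rewrite -wt -ux ltNge.
    by rewrite (arcsin_le hp hq (ltW u0) uw w1).
  have wy : 0 < w `^ q < y by rewrite powR_gt0//= ltr_powR.
  exists (w `^ q); first exact/mem_oo.
  by rewrite -FE// (powR_powR w0 qn0).
have -> : W = q^-1 * q^-1 * (y `^ (a + c - beta) / a * Beta (a + c) (1 - beta) *
     hyper3F2 (1 - b) (a + c) a (a + c + 1 - beta) (a + 1) y).
  rewrite /W /b subKr -ac -/a.
  have -> : u `^ (2 - alpha - q * beta) = y `^ (a + c - beta).
    rewrite /y -powRrM ac; congr (_ `^ _); field; exact: qn0.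
  rewrite /a invrK.
  move: (y `^ _) (Beta _ _) (hyper3F2 _ _ _ _ _ _) => A1 A2 A3.
  by field; exact: qn0.
apply: has_int_eq (has_int_scale (q^-1 * q^-1) (measurable_itv _) K) => //.
move=> v /mem_oo vy; have /andP[v0 v1] := lt1 _ vy.
rewrite /g /F ger0_norm; last first.
  by rewrite mulr_ge0 ?(ltW iq0)// mulr_ge0 ?powR_ge0.
rewrite (_ : c - 1 = q^-1 * (- alpha) + (a - 1)); last by rewrite /a /c; field.
rewrite (powR_D (q^-1 * - alpha) (a - 1) v0) powRrM.
have e : (1 - v) `^ p^-1 * (1 - v) `^ (b - 1) = 1.
  have v1' : 0 < 1 - v by rewrite subr_gt0.
  rewrite -(powR_D _ _ v1') (_ : p^-1 + (b - 1) = 0) ?powRr0//.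
  rewrite /b; ring.
move: ((v `^ q^-1) `^ - alpha) (v `^ (a - 1)) ((y - v) `^ - beta) (ibeta a b v) => A1 A2 A3 A4.
move: e; move: ((1 - v) `^ p^-1) ((1 - v) `^ (b - 1)) (q^-1) => B1 B2 B3 e.
by rewrite -[LHS]mulr1 -e; ring.
Qed.

(** In the variable v = cos^p t, reflection writes t as the quarter period
    minus q^-1 * ibeta (1 - p^-1) q^-1 v: the first term of the result is the
    Beta integral multiplying the quarter period. *)
Lemma sine_integral_right alpha beta x : alpha < 1 -> beta < 1 ->
  0 <= x -> x < hpi p q ->
   (\int[mu]_(t in `]x, hpi p q[)
      (t * sinpq p q t `^ (q - 1) * cospq p q t `^ (2 - p - alpha)
       / (cospq p q x `^ p - cospq p q t `^ p) `^ beta)%:E)%E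
   = (cospq p q x `^ (1 - alpha - p * beta) / q ^+ 2
      * Beta ((p - 1) / p) q^-1 * Beta ((1 - alpha) / p) (1 - beta)
      - p * cospq p q x `^ (p * (1 - beta) - alpha) / (q ^+ 2 * (p - 1))
        * Beta (1 - alpha / p) (1 - beta)
        * hyper3F2 (1 - q^-1) (1 - alpha / p) ((p - 1) / p)
            (2 - alpha / p - beta) ((2 * p - 1) / p)
            (cospq p q x `^ p))%:E.
Proof.
move=> alpha1 beta1 x0 xh.
have [|u u01 ux] := @arcsin_surj _ _ _ hp hq x; first by rewrite x0 ltW.
have /andP[u0 u1'] := u01.
have u1 : u < 1.
  rewrite lt_neqAle u1' andbT; apply: contraTneq xh => u1.
  by rewrite -ux u1 -/(hpi p q) ltxx.
have y1 : 0 < 1 - u `^ q by rewrite subr_gt0 powRq_lt1.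
pose y := 1 - u `^ q.
have cosx : cospq p q x = y `^ p^-1 by rewrite -ux; apply: cos_arcsin => //; rewrite u0.
have yp : (y `^ p^-1) `^ p = y by apply: powR_powRV => //; exact: ltW.
rewrite cosx yp.
have y01 : 0 < y <= 1 by rewrite y1/= gerBl powR_ge0.
have /andP[y0 y1le] := y01.
pose a := 1 - p^-1; pose b := q^-1; pose c := (1 - alpha) / p.
have c0 : 0 < c by rewrite divr_gt0// subr_gt0.
have ac0 : 0 < a + c by rewrite addr_gt0.
have K := has_int_ibeta_weighted ip1 iq1' ac0 beta1 y01.
have K0 := has_int_beta_scaled c0 beta1 y0.
pose F v := hpi p q - q^-1 * ibeta a b v.
have hpi_ibeta v : 0 <= v <= 1 -> arcsinpq p q ((1 - v) `^ q^-1) = F v.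
  move=> /andP[v0 v1]; rewrite arcsin_root//; last by rewrite subr_ge0 v1 gerBl.
  by rewrite ibeta_reflect ?v0//  /F hpiE// /a /b; ring.
have lt1 v : 0 < v < y -> 0 < v < 1 by move=> /andP[-> vy]; exact: lt_le_trans y1le.
have FE v : 0 < v < y -> arcsinpq p q ((1 - v) `^ q^-1) = F v.
  by move=> /lt1 /andP[v0 v1]; apply: hpi_ibeta; rewrite !ltW.
pose phi v := - (q^-1 * (v `^ (a - 1) * (1 - v) `^ (b - 1))).
have dF v : 0 < v < y -> is_derive v 1 F (phi v).
  move=> /lt1 v01.
  apply: isd_eq (isd_add (isd_cst (hpi p q) v)
    (isd_opp (isd_mul (isd_cst q^-1 v) (is_derive_ibeta ip1 iq0 v01)))) _.
  by rewrite mulr0 addr0 add0r.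
pose g v := F v * ((1 - v) `^ q^-1) `^ (q - 1) * (v `^ p^-1) `^ (2 - p - alpha)
   * (y - v) `^ (- beta).
have root v : 0 < v < y -> [/\ 0 <= (1 - v) `^ q^-1 < 1 , u < (1 - v) `^ q^-1 &
    0 < 1 - v].
  move=> vy; have /andP[v0 v1] := lt1 _ vy; have /andP[_ vy'] := vy.
  have v1' : 0 < 1 - v by rewrite subr_gt0.
  split => //; first by rewrite powR_ge0 powR_root_lt1// ?gtrBl// ltW.
  rewrite -[X in X < _](powR_powR u0 qn0) ltr_powR ?powR_ge0//.
  by rewrite ltrBrDl -ltrBrDr.
have FD v : 0 < v < y -> x < F v < hpi p q.
  move=> v01; have [/andP[r0 r1] r2 _] := root _ v01; rewrite -FE// -ux.
  by apply/andP; split; apply: arcsin_lt => //; exact: ltW.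
set W := (X in _ = X%:E).
suff : has_int `]x, hpi p q[ (fun t => t * sinpq p q t `^ (q - 1)
    * cospq p q t `^ (2 - p - alpha) / (y - cospq p q t `^ p) `^ beta) W by move=> [].
apply/(@has_int_subst _ `]0, y[ _ F phi _ g).
- exact: exh_oo.
- move=> v /mem_oo /lt1 v01.
  apply: (@continuousN _ _ _ (fun v => q^-1 * (v `^ (a - 1) * (1 - v) `^ (b - 1)))).
  apply: ct_mul; first exact: ct_cst.
  exact: continuous_ibeta_fun.
- right => v /mem_oo /lt1 /andP[v0 v1]; rewrite oppr_lt0.
  by rewrite mulr_gt0// mulr_gt0 ?powR_gt0// subr_gt0.
- move=> v /mem_oo vy; have /andP[v0 v1] := lt1 _ vy; have [_ _ v1'] := root _ vy.
  apply: ct_mul; last first.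
    apply: (ct_powR (f := fun v => y - v)); first by rewrite subr_gt0; case/andP: vy.
    by apply: ct_sub; [exact: ct_cst|exact: ct_id].
  apply: ct_mul; last first.
    apply: (ct_powR (f := fun v => v `^ p^-1)); first exact: powR_gt0.
    by apply: ct_powR => //; exact: ct_id.
  apply: ct_mul; first exact: isd_continuous (dF _ vy).
  apply: (ct_powR (f := fun v => (1 - v) `^ q^-1)); first exact: powR_gt0.
  apply: (ct_powR (f := fun v => 1 - v)) => //.
  by apply: ct_sub; [exact: ct_cst|exact: ct_id].
- move=> v /mem_oo /FD /andP[F0 _].
  rewrite mulr_ge0 ?powR_ge0// mulr_ge0 ?powR_ge0// mulr_ge0 ?powR_ge0//.
  by rewrite ltW// (le_lt_trans x0).
- move=> v /mem_oo vy; split; first by apply/mem_oo; exact: FD.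
  have [r01 _ v1'] := root _ vy; have /andP[v0 _] := vy.
  have r01' : 0 <= (1 - v) `^ q^-1 <= 1 by case/andP: r01 => -> /ltW.
  rewrite -FE// (sin_arcsin hp hq r01') (cos_arcsin hp hq r01).
  rewrite (powR_powRV (ltW v1') qn0) subKr /g FE// (powRN (y - v)).
  by rewrite (powR_powRV (ltW v0) pn0).
- move=> t /mem_oo /andP[xt th].
  have [|w w01 wt] := @arcsin_surj _ _ _ hp hq t.
    by rewrite (ltW th) andbT (le_trans x0)// ltW.
  have /andP[w0 w1] := w01.
  have w1' : w < 1.
    rewrite lt_neqAle w1 andbT; apply: contraTneq th => w1'.
    by rewrite -wt w1' -/(hpi p q) ltxx.
  have uw : u < w.
    rewrite ltNge; apply/negP => uw; move: xt; rewrite -wt -ux ltNge.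
    by rewrite (arcsin_le hp hq w0 uw u1').
  have wy : 0 < 1 - w `^ q < y.
    by rewrite subr_gt0 powRq_lt1//= ltrD2l ltrN2 ltr_powR.
  exists (1 - w `^ q); first exact/mem_oo.
  by rewrite -FE// subKr (powR_powR w0 qn0).
set HG := hyper3F2 (1 - b) (a + c) a (a + c + 1 - beta) (a + 1) y in K.
have pm1 : p - 1 != 0 by rewrite gt_eqF// subr_gt0.
have -> : W = q^-1 * hpi p q * (y `^ (c - beta) * Beta c (1 - beta)) +
   - (q^-1 * q^-1) * (y `^ (a + c - beta) / a * Beta (a + c) (1 - beta) * HG).
  have e1 : a + c = 1 - alpha / p by rewrite /a /c; field; exact: pn0.
  have -> : W = y `^ (c - beta) / q ^+ 2 * Beta ((p - 1) / p) q^-1 * Beta c (1 - beta)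
      - p * y `^ (a + c - beta) / (q ^+ 2 * (p - 1)) * Beta (a + c) (1 - beta) * HG.
    rewrite /W /HG e1 -2!powRrM.
    have -> : (1 - alpha - p * beta) = p * (c - beta) by rewrite /c; field; exact: pn0.
    have -> : p * (1 - beta) - alpha = p * (1 - alpha / p - beta) by field; exact: pn0.
    rewrite !mulrA mulVf// !mul1r.
    have -> : (p - 1) / p = a by rewrite /a; field; exact: pn0.
    have -> : (2 * p - 1) / p = a + 1 by rewrite /a; field; exact: pn0.
    have -> : 2 - alpha / p - beta = 1 - alpha / p + 1 - beta by ring.
    by [].
  have -> : (p - 1) / p = a by rewrite /a; field; exact: pn0.
  rewrite hpiE// -/a BetaC -/b.
  have e2 : a^-1 = p / (p - 1) by rewrite /a; field; rewrite pn0 pm1.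
  rewrite e2.
  clearbody HG.
  move: (Beta a b) (Beta c _) (Beta (a + c) _) (y `^ (c - beta)) (y `^ (a + c - beta)).
  move=> A1 A2 A3 A4 A5; rewrite /b; field; by rewrite qn0 pm1.
have h1 := has_int_scale (q^-1 * hpi p q) (measurable_itv _) K0.
have h2 := has_int_scale (- (q^-1 * q^-1)) (measurable_itv _) K.
apply: has_int_eq (has_int_add (measurable_itv _) h1 h2) => //.
move=> v /mem_oo vy; have /andP[v0 v1] := lt1 _ vy; have [_ _ v1'] := root _ vy.
rewrite /g /F /phi normrN ger0_norm; last first.
  by rewrite mulr_ge0 ?(ltW iq0)// mulr_ge0 ?powR_ge0.
have -> : v `^ (c - 1) = (v `^ p^-1) `^ (2 - p - alpha) * v `^ (a - 1).
  rewrite -powRrM -(powR_D _ _ v0); congr (_ `^ _).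
  rewrite /a /c; field; exact: pn0.
have e : ((1 - v) `^ q^-1) `^ (q - 1) * (1 - v) `^ (b - 1) = 1.
  rewrite -powRrM -(powR_D _ _ v1') (_ : _ + (b - 1) = 0) ?powRr0//.
  rewrite /b; field; exact: qn0.
move: (v `^ (a - 1)) ((y - v) `^ - beta) (ibeta a b v) (hpi p q)
  ((v `^ p^-1) `^ (2 - p - alpha)) => A1 A2 A3 A4 A5.
move: e; move: (q^-1) ((1 - v) `^ (b - 1)) (_ `^ (q - 1)) => B3 B1 B2 e.
by rewrite -[LHS]mulr1 -e; ring.
Qed.

End sine_integrals.

(** * The functions arcsinh, sinh and cosh *)

Section second_kind.
Context {R : realType}.
Notation mu := (@lebesgue_measure R).
Local Opaque powR expR Gamma_pos Gamma Beta.
Implicit Types (D E : set R) (F phi f g A S h : R -> R) (a b c e x y v s w u z : R).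

(** The incomplete Beta integral for 1 + w in place of 1 - w: in the variable
    v = sinh^q t one has t = q^-1 * sbeta q^-1 p^-1 v. *)
Definition sbeta a c v : R :=
  \int[mu]_(w in `]0, v]) (w `^ (a - 1) * (1 + w) `^ (- c)).

Lemma measurable_sbeta D a c :
  measurable_fun D (fun w : R => w `^ (a - 1) * (1 + w) `^ (- c)).
Proof.
apply: measurable_funTS; apply: measurable_funM; first exact: measurable_powRf.
by apply: measurable_powRf; exact: measurable_funD.
Qed.

Lemma continuous_sbeta_fun a c v : 0 < v ->
  {for v, continuous (fun w : R => w `^ (a - 1) * (1 + w) `^ (- c))}.
Proof.
move=> v0; apply: ct_mul; first by apply: ct_powR => //; exact: ct_id.
apply: (ct_powR (f := fun w => 1 + w)); first exact: addr_gt0.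
by apply: ct_add; [exact: ct_cst|exact: ct_id].
Qed.

Lemma has_int_sbeta a c v : 0 < a -> 0 < v ->
  has_int `]0, v[ (fun w => w `^ (a - 1) * (1 + w) `^ (- c)) (sbeta a c v).
Proof.
move=> a0 v0.
have h := has_int_scale ((1 + v) `^ `|c|) (measurable_itv _) (has_int_powR a0 v0).
have [|u hu] := has_int_dom (measurable_itv _) (@measurable_sbeta _ a c) h.
  move=> w /mem_oo /andP[w0 wv].
  rewrite ger0_norm; last by apply: mulr_ge0; exact: powR_ge0.
  rewrite mulrC; apply: ler_wpM2r; first exact: powR_ge0.
  have w1 : 1 <= 1 + w by rewrite lerDl ltW.
  apply: (@le_trans _ _ ((1 + w) `^ `|c|)).
    by apply: ler_powR => //; rewrite -normrN ler_norm.
  apply: ge0_ler_powR; rewrite ?nnegrE ?normr_ge0//; last by rewrite lerD2l ltW.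
  - exact: le_trans ler01 w1.
  - by apply: addr_ge0 => //; exact: ltW.
suff -> : sbeta a c v = u by [].
by have [_ e] := has_int_oc hu; rewrite /sbeta /Rintegral e.
Qed.

Lemma is_derive_sbeta a c v : 0 < a -> 0 < v ->
  is_derive v 1 (sbeta a c) (v `^ (a - 1) * (1 + v) `^ (- c)).
Proof.
move=> a0 v0; have v1 : 0 < v + 1 by rewrite addr_gt0.
apply: (is_derive_primitive (u := v + 1) v0 _ (has_int_sbeta c a0 v1)); first by rewrite ltrDl.
exact: continuous_sbeta_fun.
Qed.

Lemma sbeta_ge0 a c v : 0 <= sbeta a c v.
Proof.
rewrite /sbeta /Rintegral fine_ge0// integral_ge0// => x _.
by rewrite lee_fin mulr_ge0 ?powR_ge0.
Qed.

Lemma sbeta0 a c : sbeta a c 0 = 0 :> R.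
Proof.
by rewrite /sbeta /Rintegral set_itv_ge ?bnd_simp ?ltxx// integral_set0.
Qed.

(** The substitution w / (1 - w) carries a bounded range to an unbounded one. *)
Lemma sbeta_ibeta a c w : 0 < a -> a < c -> 0 <= w < 1 ->
  sbeta a c (w / (1 - w)) = ibeta a (c - a) w.
Proof.
move=> a0 ac /andP[]; rewrite le_eqVlt => /predU1P[<- _|w0 w1].
  by rewrite mul0r sbeta0 ibeta0.
have ca : 0 < c - a by rewrite subr_gt0.
have h := has_int_ibeta a0 ca (ltW w1).
have pos t : 0 < t < w -> 0 < 1 - t.
  by move=> /andP[_ tw]; rewrite subr_gt0 (lt_trans tw).
have w1' : 0 < 1 - w by rewrite subr_gt0.
have W0 : 0 < w / (1 - w) by rewrite divr_gt0.
have hs := has_int_sbeta c a0 W0.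
apply: has_int_uniq hs _.
pose F t : R := t * (1 - t) `^ (-1).
have FE t : 0 < t < w -> F t = t / (1 - t).
  by move=> /pos t1; rewrite /F powR_inv1// ltW.
have F1 t : 0 < t < w -> 1 + F t = (1 - t) `^ (-1).
  move=> tw; have t1 := pos _ tw; rewrite FE// powR_inv1 ?(ltW t1)//.
  by field; rewrite gt_eqF.
have dF t : 0 < t < w -> is_derive t 1 F ((1 - t) `^ (- 2)).
  move=> tw; have t1 := pos _ tw.
  have d1 := isd_add (isd_cst 1 t) (isd_opp (isd_id t)).
  apply: isd_eq (isd_mul (isd_id t) (isd_powR (f := fun t => 1 - t) (-1) t1 d1)) _.
  cbv beta.
  rewrite (_ : (1 - t) `^ (-1) = (1 - t) * (1 - t) `^ (- 2)); last first.
    rewrite -{2}(powRr1 (ltW t1)) -(powR_D _ _ t1); congr (_ `^ _); ring.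
  have -> : (1 - t) `^ (-1 - 1) = (1 - t) `^ (- 2) by congr (_ `^ _); ring.
  aring.
apply/(@has_int_subst _ `]0, w[ _ F (fun t => (1 - t) `^ (- 2)) _
   (fun t => (F t) `^ (a - 1) * ((1 - t) `^ (-1)) `^ (- c))).
- exact: exh_oo.
- move=> t /mem_oo /pos t1; apply: (ct_powR (f := fun t => 1 - t)) => //.
  by apply: ct_sub; [exact: ct_cst|exact: ct_id].
- by left => t /mem_oo /pos t1; rewrite powR_gt0.
- move=> t /mem_oo tw; have t1 := pos _ tw; have /andP[t0 _] := tw.
  apply: ct_mul.
    apply: (ct_powR (f := F)); last exact: isd_continuous (dF _ tw).
    by rewrite /F mulr_gt0// powR_gt0.
  apply: (ct_powR (f := fun t => (1 - t) `^ (-1))); first exact: powR_gt0.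
  apply: (ct_powR (f := fun t => 1 - t)) => //.
  by apply: ct_sub; [exact: ct_cst|exact: ct_id].
- by move=> t _; apply: mulr_ge0; exact: powR_ge0.
- move=> t /mem_oo tw; have t1 := pos _ tw; have /andP[t0 tw'] := tw.
  split; last by rewrite F1.
  apply/mem_oo; rewrite FE// divr_gt0//= ltr_pdivrMr// mulrAC ltr_pdivlMr//.
  by rewrite !mulrBr !mulr1 [w * t]mulrC ltrD2r.
- move=> z /mem_oo /andP[z0 zw].
  have z1 : 0 < 1 + z by rewrite addr_gt0.
  have zw' : z / (1 + z) < w.
    by move: zw; rewrite ltr_pdivlMr// mulrBr mulr1 ltrBlDr ltr_pdivrMr// mulrDr mulr1 [w * z]mulrC addrC.
  have zz : 0 < z / (1 + z) < w by rewrite divr_gt0.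
  exists (z / (1 + z)); first exact/mem_oo.
  rewrite FE//; field; rewrite (gt_eqF z1)/=.
  by rewrite addrK oner_eq0.
apply: has_int_eq h => // t /mem_oo tw; have t1 := pos _ tw; have /andP[t0 _] := tw.
rewrite [`|_|]ger0_norm; last exact: powR_ge0.
rewrite /F (powRM _ (ltW t0) (powR_ge0 _ _)) -2!powRrM -2!mulrA; congr (_ * _).
by rewrite -2!(powR_D _ _ t1); congr (_ `^ _); ring.
Qed.

Section pq.
Context (p q : R) (hp : 1 < p) (hq : 1 < q).

Let p0 : 0 < p := lt_trans ltr01 hp.
Let q0 : 0 < q := lt_trans ltr01 hq.
Let ip0 : 0 < p^-1. Proof. by rewrite invr_gt0. Qed.
Let iq0 : 0 < q^-1. Proof. by rewrite invr_gt0. Qed.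
Let qn0 : q != 0 := lt0r_neq0 q0.

Notation gsh := (fun t : R => (1 + t `^ q) `^ (- p^-1)).

Lemma has_int_arcsinh_root v : 0 < v ->
  has_int `]0, v `^ q^-1[ gsh (q^-1 * sbeta q^-1 p^-1 v).
Proof.
move=> v0; apply: has_int_root_subst => //.
- move=> w /andP[w0 wv].
  apply: (ct_powR (f := fun w => 1 + (w `^ q^-1) `^ q)).
    by rewrite ltr_wpDr// powR_ge0.
  apply: ct_add; first exact: ct_cst.
  apply: (ct_powR (f := fun w => w `^ q^-1)); first exact: powR_gt0.
  by apply: ct_powR => //; exact: ct_id.
- by move=> w _; exact: powR_ge0.
apply: has_int_eq (has_int_scale q^-1 (measurable_itv _) (has_int_sbeta p^-1 iq0 v0)) => // w /mem_oo /andP[w0 _].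
by rewrite (powR_powRV (ltW w0) qn0).
Qed.

Lemma arcsinh0 : arcsinhpq p q 0 = 0.
Proof. by rewrite /arcsinhpq set_itv1 Rintegral_set1. Qed.

Lemma arcsinh_root v : 0 <= v ->
  arcsinhpq p q (v `^ q^-1) = q^-1 * sbeta q^-1 p^-1 v.
Proof.
rewrite le_eqVlt => /predU1P[<-|v0].
  by rewrite (powR0 (lt0r_neq0 iq0)) arcsinh0 sbeta0 mulr0.
by apply: has_int_closed; apply: has_int_arcsinh_root.
Qed.

Lemma has_int_arcsinh u : 0 <= u -> has_int `]0, u[ gsh (arcsinhpq p q u).
Proof.
rewrite le_eqVlt => /predU1P[<-|u0].
  rewrite arcsinh0 set_itv_ge ?bnd_simp ?ltxx//.
  by split; [exact: integrable_set0|rewrite integral_set0].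
have uq : 0 < u `^ q by rewrite powR_gt0.
have := has_int_arcsinh_root uq; rewrite -arcsinh_root ?(ltW uq)//.
by rewrite (powR_powR (ltW u0) qn0).
Qed.

Lemma gsh_pos t : 0 < 1 + t `^ q.
Proof. by rewrite ltr_wpDr// powR_ge0. Qed.

Lemma gsh_lt v w : 0 <= v -> v < w -> 1 + v `^ q < 1 + w `^ q.
Proof. by move=> v0 vw; rewrite ltrD2l ltr_powR. Qed.

(** As for arcsin, except that the integrand decreases. *)
Lemma arcsinh_increment v w : 0 <= v -> v < w ->
  [/\ 0 < arcsinhpq p q w - arcsinhpq p q v,
    (1 + v `^ q) `^ p^-1 * (arcsinhpq p q w - arcsinhpq p q v) <= w - v &
    w - v <= (1 + w `^ q) `^ p^-1 * (arcsinhpq p q w - arcsinhpq p q v)].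
Proof.
move=> v0 vw; have w0 : 0 <= w := le_trans v0 (ltW vw).
have hv := has_int_arcsinh v0; have hw := has_int_arcsinh w0.
have wv : 0 < w - v by rewrite subr_gt0.
have vpos : 0 < (1 + v `^ q) `^ p^-1 by apply: powR_gt0; exact: gsh_pos.
have wpos : 0 < (1 + w `^ q) `^ p^-1 by apply: powR_gt0; exact: gsh_pos.
have lo : (1 + w `^ q) `^ (- p^-1) * (w - v) <= arcsinhpq p q w - arcsinhpq p q v.
  apply: (increment_ge v0 vw hv hw) => t /andP[vt tw].
  have t0 : 0 <= t := le_trans v0 (ltW vt).
  apply: ltW; apply: ltr_powR_neg; [by rewrite oppr_lt0|exact: gsh_pos|exact: gsh_lt].
have hi : arcsinhpq p q w - arcsinhpq p q v <= (1 + v `^ q) `^ (- p^-1) * (w - v).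
  apply: (increment_le v0 vw hv hw) => t /andP[vt tw].
  apply: ltW; apply: ltr_powR_neg; [by rewrite oppr_lt0|exact: gsh_pos|exact: gsh_lt].
split.
- apply: lt_le_trans lo; apply: mulr_gt0; last exact: wv.
  by apply: powR_gt0; exact: gsh_pos.
- move: hi; rewrite [X in X * (w - v)]powRN [X in _ <= X]mulrC (ler_pdivlMr _ _ vpos).
  by rewrite [X in X <= _]mulrC; apply.
- move: lo; rewrite [X in X * (w - v)]powRN [X in X <= _]mulrC (ler_pdivrMr _ _ wpos).
  by rewrite [X in _ <= X]mulrC; apply.
Qed.

Lemma arcsinh_lt v w : 0 <= v -> v < w -> arcsinhpq p q v < arcsinhpq p q w.
Proof. by move=> v0 vw; have [] := arcsinh_increment v0 vw; rewrite subr_gt0. Qed.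

Lemma arcsinh_le v w : 0 <= v -> v <= w -> arcsinhpq p q v <= arcsinhpq p q w.
Proof. by move=> v0; rewrite le_eqVlt => /predU1P[->//|/(arcsinh_lt v0)/ltW]. Qed.

Lemma arcsinh_inj v w : 0 <= v -> 0 <= w ->
  arcsinhpq p q v = arcsinhpq p q w -> v = w.
Proof.
move=> v0 w0 e; apply/eqP; case: ltgtP => // lt.
  by have := arcsinh_lt v0 lt; rewrite e ltxx.
by have := arcsinh_lt w0 lt; rewrite e ltxx.
Qed.

Lemma sinh_arcsinh u : 0 <= u -> sinhpq p q (arcsinhpq p q u) = u.
Proof.
move=> u0; rewrite /sinhpq; apply: pinvKV; last by rewrite inE/= in_itv/= u0.
by move=> v w; rewrite !inE/= !in_itv/= !andbT; exact: arcsinh_inj.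
Qed.

Lemma measurable_gsh D : measurable_fun D gsh.
Proof.
by apply: measurable_funTS; apply: measurable_powRf; apply: measurable_funD.
Qed.

Lemma arcsinh_le_hpihat u : 0 <= u -> ((arcsinhpq p q u)%:E <= hpihat p q)%E.
Proof.
move=> u0; have [_ <-] := has_int_arcsinh u0.
apply: ge0_subset_integral => //.
- by apply/measurable_EFinP; exact: measurable_gsh.
- by move=> x _; rewrite lee_fin powR_ge0.
- by move=> x /=; rewrite !in_itv/= andbT => /andP[/ltW].
Qed.

Lemma arcsinh_lt_hpihat u : 0 <= u -> ((arcsinhpq p q u)%:E < hpihat p q)%E.
Proof.
move=> u0; have u1 : 0 <= u + 1 by rewrite addr_ge0.
apply: lt_le_trans (arcsinh_le_hpihat u1).
by rewrite lte_fin; apply: arcsinh_lt => //; rewrite ltrDl.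
Qed.

Lemma integral_arcsinh n :
  (\int[mu]_(x in `[0%R, n%:R]) (gsh x)%:E = (arcsinhpq p q n%:R)%:E)%E.
Proof.
have [_ <-] := has_int_arcsinh (ler0n R n).
apply: integral_itv_bndoo; by apply/measurable_EFinP; exact: measurable_gsh.
Qed.

Lemma arcsinh_surj x : 0 <= x -> (x%:E < hpihat p q)%E ->
  exists2 u, 0 <= u & arcsinhpq p q u = x.
Proof.
move=> x0 xh.
have c0 : (\int[mu]_(x in `[0%R, n%:R]) (gsh x)%:E @[n --> \oo] --> hpihat p q)%E.
  apply: ge0_cvgn_integral; first by move=> y; exact: powR_ge0.
  exact: measurable_gsh.
have [n xn] : exists n : nat, x < arcsinhpq p q n%:R.
  apply: contrapT => /forallNP H.
  have : (hpihat p q <= x%:E)%E.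
    rewrite -(cvg_lim _ c0)//; apply: lime_le; first exact: cvgP c0.
    near=> n.
    by rewrite integral_arcsinh lee_fin leNgt; apply/negP; exact: H.
  by rewrite leNgt xh.
have n0 : (0 : R) <= n%:R by [].
have i : mu.-integrable `[0, n%:R] (EFin \o gsh).
  apply/integrableP; split; first by apply/measurable_EFinP; exact: measurable_gsh.
  rewrite (_ : (\int[mu]_(x in _) _)%E = (arcsinhpq p q n%:R)%:E) ?ltry//.
  rewrite -integral_arcsinh; apply: eq_integral => y _.
  by rewrite /= ger0_norm// powR_ge0.
have c := parameterized_integral_continuous n0 i.
have [] := @IVT _ (arcsinhpq p q) 0 n%:R x n0 c.
  by rewrite arcsinh0 ge_min x0/= le_max (ltW xn) orbT.
by move=> u; rewrite in_itv/= => /andP[u0 _] e; exists u.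
Unshelve. all: by end_near. Qed.

Lemma cosh_arcsinh u : 0 <= u ->
  coshpq p q (arcsinhpq p q u) = (1 + u `^ q) `^ p^-1.
Proof.
move=> u0; rewrite /coshpq.
have u1 : 0 <= u + 1 by rewrite addr_ge0.
have uu1 : u < u + 1 by rewrite ltrDl.
have mono v w : 0 <= v -> v <= w -> (1 + v `^ q) `^ p^-1 <= (1 + w `^ q) `^ p^-1.
  move=> v0; rewrite le_eqVlt => /predU1P[->|vw]; first exact: lexx.
  by apply: ltW; apply: ltr_powR => //; [apply: ltW; exact: gsh_pos|exact: gsh_lt].
have lt := arcsinh_lt u0 uu1.
(* values of arcsinh this close to arcsinh u come from v < u + 1, where cosh is
   at most its value at u + 1 *)
apply: (@derive_within_inverse _ _ `[0, +oo[ (arcsinhpq p q) _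
  (fun v => (1 + v `^ q) `^ p^-1) u ((1 + (u + 1) `^ q) `^ p^-1)
  (arcsinhpq p q (u + 1) - arcsinhpq p q u) (arcsinhpq p q (u + 1) - arcsinhpq p q u)).
- by rewrite /= in_itv/= u0.
- move=> v w; rewrite /= !in_itv/= !andbT => v0 w0 vw.
  have [i1 i2 i3] := arcsinh_increment v0 vw; split => //.
    apply: le_trans i2; apply: ler_wpM2r; first exact: ltW.
    by rewrite ge_min [X in X || _]lexx.
  apply: (le_trans i3); apply: ler_wpM2r; first exact: ltW.
  by rewrite le_max [X in _ || X]lexx orbT.
- move=> z [z0 zh]; have [v v0 e] := arcsinh_surj z0 zh; exists v => //.
  by rewrite /= in_itv/= v0.
- by move=> v; rewrite /= in_itv/= andbT; exact: sinh_arcsinh.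
- move=> e e0; have [d d0 hd] := powR_continuous_eps p^-1 (gsh_pos u) e0.
  have [d' d'0 hd'] := powR_continuous_ge0 hq u0 d0.
  exists d' => // v; rewrite /= in_itv/= andbT => v0 vd; apply: hd.
  rewrite (_ : 1 + v `^ q - (1 + u `^ q) = (v `^ q - u `^ q)); last by aring.
  exact: hd'.
- by rewrite subr_gt0.
- by apply: powR_gt0; exact: gsh_pos.
- move=> v; rewrite /= in_itv/= andbT => v0 H; apply: mono => //.
  rewrite leNgt; apply/negP => uv.
  have h1 : arcsinhpq p q (u + 1) < arcsinhpq p q v by exact: arcsinh_lt.
  move: H; rewrite gtr0_norm; last by rewrite subr_gt0 (lt_trans lt).
  by rewrite ltrD2r ltNge (ltW h1).
- by apply: mono => //; exact: ltW.
- by rewrite subr_gt0.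
- move=> z; rewrite addrC subrK => /andP[z1 z2]; split.
    by apply: le_trans (ltW z1); rewrite -arcsinh0; apply: arcsinh_le.
  apply: le_lt_trans (arcsinh_lt_hpihat u1).
  by rewrite lee_fin ltW.
Qed.

Lemma hpihatE : p < q ->
  hpihat p q = (q^-1 * Beta q^-1 (p^-1 - q^-1))%:E.
Proof.
move=> pq; have pq0 : 0 < p^-1 - q^-1 by rewrite subr_gt0 ltf_pV2 ?posrE.
have h := has_int_Beta_y iq0 pq0.
have e : q^-1 + (p^-1 - q^-1) = p^-1 by ring.
rewrite e in h.
suff : has_int `]0, +oo[ gsh (q^-1 * Beta q^-1 (p^-1 - q^-1)).
  move=> [_ <-]; rewrite /hpihat -integral_itv_obnd_cbnd//.
  by apply/measurable_EFinP; exact: measurable_gsh.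
apply/(@has_int_subst _ `]0, +oo[ _ (fun w => w `^ q^-1) (fun w => q^-1 * w `^ (q^-1 - 1)) _
     (fun w => (1 + w) `^ (- p^-1))).
- exact: exh_oy.
- move=> w /mem_oy w0; apply: isd_eq (isd_powR q^-1 w0 (isd_id w)) _.
  by rewrite mulr1.
- move=> w /mem_oy w0; apply: ct_mul; first exact: ct_cst.
  by apply: ct_powR => //; exact: ct_id.
- by left => w /mem_oy w0; rewrite mulr_gt0// powR_gt0.
- move=> w /mem_oy w0; apply: (ct_powR (f := fun w => 1 + w)); first exact: addr_gt0.
  by apply: ct_add; [exact: ct_cst|exact: ct_id].
- by move=> w _; exact: powR_ge0.
- move=> w /mem_oy w0; split; first by apply/mem_oy; rewrite powR_gt0.
  by rewrite (powR_powRV (ltW w0) qn0).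
- move=> t /mem_oy t0; exists (t `^ q); first by apply/mem_oy; exact: powR_gt0.
  by apply: powR_powR => //; exact: ltW.
apply: has_int_eq (has_int_scale q^-1 (measurable_itv _) h) => // w _.
rewrite ger0_norm; first by rewrite [RHS]mulrC mulrA.
by apply: mulr_ge0; [exact: ltW|exact: powR_ge0].
Qed.

(** The variable r is cosh^(- p): the unbounded range of sinh becomes ]0, 1]. *)
Lemma arcsinh_ibeta r : p < q -> 0 < r <= 1 ->
  arcsinhpq p q ((r `^ (-1) - 1) `^ q^-1) =
  q^-1 * Beta q^-1 (p^-1 - q^-1) - q^-1 * ibeta (p^-1 - q^-1) q^-1 r.
Proof.
move=> pq /andP[r0 r1]; have pq0 : 0 < p^-1 - q^-1 by rewrite subr_gt0 ltf_pV2 ?posrE.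
have r1' : 0 <= 1 - r by rewrite subr_ge0.
have r2 : 1 - r < 1 by rewrite gtrBl.
rewrite powR_inv1 ?(ltW r0)//.
have -> : r^-1 - 1 = (1 - r) / (1 - (1 - r)) by rewrite subKr; field; rewrite gt_eqF.
rewrite arcsinh_root; last by rewrite divr_ge0// subKr ltW.
rewrite sbeta_ibeta ?r1'//; last by rewrite -subr_gt0.
by rewrite ibeta_reflect ?mulrBr// (ltW r0).
Qed.

End pq.
End second_kind.

(** * The hyperbolic sine near infinity *)

Section hyperbolic_sine_tail.
Context {R : realType}.
Notation mu := (@lebesgue_measure R).
Local Opaque powR expR Gamma_pos Gamma Beta ibeta hyper3F2.
Context (p q : R) (hp : 1 < p) (hq : 1 < q).
Implicit Types (alpha beta x u v w y t r : R).

Let p0 : 0 < p := lt_trans ltr01 hp.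
Let q0 : 0 < q := lt_trans ltr01 hq.
Let iq0 : 0 < q^-1. Proof. by rewrite invr_gt0. Qed.
Let iq1' : 0 < q^-1 <= 1. Proof. by rewrite iq0/= ltW// invf_lt1. Qed.
Let qn0 : q != 0 := lt0r_neq0 q0.
Let pn0 : p != 0 := lt0r_neq0 p0.

(** The variable r = cosh^(- p) t brings back the situation of
    sine_integral_right, with hpihat in place of the quarter period. *)
Lemma sinh_integral_tail alpha beta x : p < q -> beta < 1 -> 1 < (alpha + beta) * p ->
  0 <= x -> (x%:E < hpihat p q)%E ->
   (\int[mu]_(t in [set t : R | (x < t)%R /\ t%:E < hpihat p q])
      (t * sinhpq p q t `^ (q - 1) * coshpq p q t `^ (2 - p * (alpha + 1))
       / (coshpq p q t `^ p - coshpq p q x `^ p) `^ beta)%:E)%E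
   = (coshpq p q x `^ (1 - p * (alpha + beta)) / q ^+ 2
      * Beta (p^-1 - q^-1) q^-1 * Beta (1 - beta) (beta + alpha - p^-1)
      + coshpq p q x `^ (p / q - p * (alpha + beta)) / (q * (1 - q / p))
        * Beta (beta + alpha - q^-1) (1 - beta)
        * hyper3F2 (1 - q^-1) (beta + alpha - q^-1) (p^-1 - q^-1)
            (alpha + 1 - q^-1) (p^-1 - q^-1 + 1)
            (coshpq p q x `^ (- p)))%:E.
Proof.
move=> pq beta1 ab1 x0 xh.
have [u u0 ux] := arcsinh_surj hq x0 xh.
pose a := p^-1 - q^-1; pose b := q^-1; pose c := beta + alpha - p^-1.
have a0 : 0 < a by rewrite subr_gt0 ltf_pV2 ?posrE.
have c0 : 0 < c by rewrite subr_gt0 -[X in X < _]mul1r ltr_pdivrMr// addrC.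
have ac0 : 0 < a + c by rewrite addr_gt0.
pose C := 1 + u `^ q.
have C0 : 0 < C by rewrite ltr_wpDr// powR_ge0.
have C1 : 1 <= C by rewrite lerDl powR_ge0.
have cosx : coshpq p q x = C `^ p^-1 by rewrite -ux; apply: cosh_arcsinh.
have Cp : (C `^ p^-1) `^ p = C by apply: powR_powRV => //; exact: ltW.
pose Y := C `^ (-1).
have Y0 : 0 < Y by apply: powR_gt0.
have CY : C * Y = 1 by rewrite /Y powR_inv1 ?(ltW C0)// mulfV// gt_eqF.
have YC : Y `^ (-1) = C by rewrite /Y -powRrM mulrNN mulr1 powRr1// ltW.
have CNp : (C `^ p^-1) `^ (- p) = Y by rewrite -powRrM mulrN mulVf.
have Y1 : Y <= 1.
  by rewrite /Y powR_inv1 ?(ltW C0)// invf_le1.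
rewrite cosx Cp CNp.
have Y01 : 0 < Y <= 1 by rewrite Y0.
have K := has_int_ibeta_weighted a0 iq1' ac0 beta1 Y01.
have K0 := has_int_beta_scaled c0 beta1 Y0.
pose H := q^-1 * Beta b a.
have hE : hpihat p q = H%:E := hpihatE hp hq pq.
pose F r := H - q^-1 * ibeta a b r.
have FE r : 0 < r <= 1 -> arcsinhpq p q ((r `^ (-1) - 1) `^ q^-1) = F r.
  exact: arcsinh_ibeta.
have lt1 r : 0 < r < Y -> 0 < r < 1 by move=> /andP[-> vy]; exact: lt_le_trans Y1.
have le1 r : 0 < r < Y -> 0 < r <= 1 by move=> /lt1 /andP[-> /ltW].
pose phi r := - (q^-1 * (r `^ (a - 1) * (1 - r) `^ (b - 1))).
have dF r : 0 < r < Y -> is_derive r 1 F (phi r).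
  move=> /lt1 r01.
  apply: isd_eq (isd_add (isd_cst H r)
    (isd_opp (isd_mul (isd_cst q^-1 r) (is_derive_ibeta a0 iq0 r01)))) _.
  by rewrite mulr0 addr0 add0r.
pose g r := F r * ((r `^ (-1) - 1) `^ q^-1) `^ (q - 1)
   * ((r `^ (-1)) `^ p^-1) `^ (2 - p * (alpha + 1)) * (r `^ (-1) - C) `^ (- beta).
have rinv r : 0 < r < Y -> [/\ C < r `^ (-1), 0 < r `^ (-1) - 1 & r * r `^ (-1) = 1].
  move=> /andP[r0 rY].
  have h : C < r `^ (-1) by rewrite -YC; apply: ltr_powR_neg => //; rewrite oppr_lt0.
  split => //; first by rewrite subr_gt0 (le_lt_trans C1).
  by rewrite powR_inv1 ?(ltW r0)// mulfV// gt_eqF.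
have root r : 0 < r < Y -> u < (r `^ (-1) - 1) `^ q^-1.
  move=> rY; have [h1 h2 _] := rinv _ rY.
  rewrite -[X in X < _](powR_powR u0 qn0); apply: ltr_powR => //; first exact: powR_ge0.
  by rewrite ltrBrDl.
have FD r : 0 < r < Y -> x < F r < H.
  move=> rY; have := root _ rY => r2; rewrite -FE ?le1// -ux.
  have := arcsinh_lt hp hq u0 r2 => ->/=.
  have := arcsinh_lt_hpihat hp hq (u := (r `^ (-1) - 1) `^ q^-1).
  by rewrite hE lte_fin; apply; exact: powR_ge0.
set W := (X in _ = X%:E).
have EE : [set t : R | (x < t)%R /\ (t%:E < hpihat p q)%E] = `]x, H[%classic.
  by rewrite hE eqEsubset; split => t /=; rewrite in_itv/= lte_fin;
    [move=> [-> ->]|move=> /andP].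
rewrite EE.
suff : has_int `]x, H[ (fun t => t * sinhpq p q t `^ (q - 1)
    * coshpq p q t `^ (2 - p * (alpha + 1)) / (coshpq p q t `^ p - C) `^ beta) W by move=> [].
have cr r : 0 < r -> {for r, continuous (fun r : R => r `^ (-1))}.
  by move=> r0; apply: ct_powR => //; exact: ct_id.
apply/(@has_int_subst _ `]0, Y[ _ F phi _ g).
- exact: exh_oo.
- move=> r /mem_oo /lt1 r01.
  apply: (@continuousN _ _ _ (fun r => q^-1 * (r `^ (a - 1) * (1 - r) `^ (b - 1)))).
  apply: ct_mul; first exact: ct_cst.
  exact: continuous_ibeta_fun.
- right => r /mem_oo /lt1 /andP[r0 r1]; rewrite oppr_lt0.
  apply: mulr_gt0 => //; apply: mulr_gt0; apply: powR_gt0 => //.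
  by rewrite subr_gt0.
- move=> r /mem_oo rY; have /andP[r0 r1] := lt1 _ rY; have [h1 h2 _] := rinv _ rY.
  apply: ct_mul; last first.
    apply: (ct_powR (f := fun r => r `^ (-1) - C)); first by rewrite subr_gt0.
    by apply: ct_sub; [exact: cr|exact: ct_cst].
  apply: ct_mul; last first.
    apply: (ct_powR (f := fun r => (r `^ (-1)) `^ p^-1)).
      by apply: powR_gt0; exact: powR_gt0.
    by apply: (ct_powR (f := fun r => r `^ (-1))); [exact: powR_gt0|exact: cr].
  apply: ct_mul; first exact: isd_continuous (dF _ rY).
  apply: (ct_powR (f := fun r => (r `^ (-1) - 1) `^ q^-1)); first exact: powR_gt0.
  apply: (ct_powR (f := fun r => r `^ (-1) - 1)); first exact: h2.
  by apply: ct_sub; [exact: cr|exact: ct_cst].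
- move=> r /mem_oo /FD /andP[F0 _].
  apply: mulr_ge0; last exact: powR_ge0.
  apply: mulr_ge0; last exact: powR_ge0.
  apply: mulr_ge0; last exact: powR_ge0.
  by rewrite ltW// (le_lt_trans x0).
- move=> r /mem_oo rY; split; first by apply/mem_oo; exact: FD.
  have [h1 h2 _] := rinv _ rY; have h3 := powR_ge0 (r `^ (-1) - 1) q^-1.
  rewrite -FE ?le1// (sinh_arcsinh hp hq h3) (cosh_arcsinh hp hq h3).
  rewrite (powR_powRV (ltW h2) qn0) subrKC /g FE ?le1//.
  by rewrite (powR_powRV (powR_ge0 _ _) pn0) (powRN (_ - C)).
- move=> t /mem_oo /andP[xt th].
  have t0 := le_trans x0 (ltW xt).
  have th' : (t%:E < hpihat p q)%E by rewrite hE lte_fin.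
  have [w w0 wt] := arcsinh_surj hq t0 th'.
  have uw : u < w.
    rewrite ltNge; apply/negP => uw; move: xt; rewrite -wt -ux ltNge.
    by rewrite (arcsinh_le hp hq w0 uw).
  have w1 : 0 < 1 + w `^ q by rewrite ltr_wpDr// powR_ge0.
  have wY : 0 < (1 + w `^ q) `^ (-1) < Y.
    rewrite powR_gt0//=; apply: ltr_powR_neg => //.
    by rewrite ltrD2l; apply: ltr_powR.
  exists ((1 + w `^ q) `^ (-1)); first exact/mem_oo.
  rewrite -FE ?le1// -powRrM mulrNN mulr1 (powRr1 (ltW w1)) addrC addKr.
  by rewrite (powR_powR w0 qn0).
set HG := hyper3F2 (1 - b) (a + c) a (a + c + 1 - beta) (a + 1) Y in K.
have pqn : 1 - q / p != 0.
  by rewrite subr_eq0 eq_sym gt_eqF// ltr_pdivlMr// mul1r.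
have qp0 : q - p != 0 by rewrite subr_eq0 gt_eqF.
have pq0 : p - q != 0 by rewrite subr_eq0 lt_eqF.
have powC (e f : R) : C `^ (- e) * Y `^ (f - e) = C `^ (- f).
  rewrite /Y -powRrM -(powR_D _ _ C0); congr (_ `^ _); ring.
have -> : W = q^-1 * C `^ (- beta) * H * (Y `^ (c - beta) * Beta c (1 - beta)) +
   - (q^-1 * C `^ (- beta) * q^-1) * (Y `^ (a + c - beta) / a * Beta (a + c) (1 - beta) * HG).
  have e1 : a + c = beta + alpha - q^-1 by rewrite /a /c; ring.
  have -> : W = C `^ (- c) / q ^+ 2 * Beta a b * Beta (1 - beta) c
      + C `^ (- (a + c)) / (q * (1 - q / p)) * Beta (a + c) (1 - beta) * HG.
    rewrite /W /HG e1 -2!powRrM.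
    have -> : p^-1 * (1 - p * (alpha + beta)) = - c by rewrite /c; field; exact: pn0.
    have -> : p^-1 * (p / q - p * (alpha + beta)) = - (beta + alpha - q^-1).
      by field; rewrite pn0 qn0.
    have -> : beta + alpha - q^-1 + 1 - beta = alpha + 1 - q^-1 by ring.
    by [].
  rewrite -(powC beta c) -(powC beta (a + c)) /H [Beta b a]BetaC [Beta (1 - beta) c]BetaC.
  have e2 : a^-1 = p * q / (q - p) by rewrite /a; field; rewrite qp0 pn0 qn0.
  rewrite e2.
  clearbody HG.
  move: (Beta a b) (Beta c _) (Beta (a + c) _) (C `^ (- beta)) (Y `^ (c - beta))
    (Y `^ (a + c - beta)).
  move=> A1 A2 A3 A4 A5 A6; field; by rewrite qn0 pn0 qp0 pq0.
have h1 := has_int_scale (q^-1 * C `^ (- beta) * H) (measurable_itv _) K0.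
have h2 := has_int_scale (- (q^-1 * C `^ (- beta) * q^-1)) (measurable_itv _) K.
apply: has_int_eq (has_int_add (measurable_itv _) h1 h2) => //.
move=> r /mem_oo rY; have /andP[r0 r1] := lt1 _ rY; have [s1 s2 s3] := rinv _ rY.
rewrite /g /F /phi normrN ger0_norm; last first.
  apply: mulr_ge0; first exact: ltW.
  by apply: mulr_ge0; exact: powR_ge0.
have r1' : 0 < 1 - r by rewrite subr_gt0.
have Yr : 0 < Y - r by rewrite subr_gt0; case/andP: rY.
have -> : r `^ (-1) - C = C * ((Y - r) * r `^ (-1)).
  rewrite (_ : C * _ = (C * Y) * r `^ (-1) - C * (r * r `^ (-1))); last by aring.
  by rewrite CY s3 mul1r mulr1.
have -> : r `^ (-1) - 1 = (1 - r) * r `^ (-1) by rewrite mulrBl mul1r s3.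
rewrite (powRM _ (ltW C0)); last by apply: mulr_ge0; [exact: ltW|exact: powR_ge0].
rewrite (powRM _ (ltW Yr) (powR_ge0 _ _)) (powRM _ (ltW r1') (powR_ge0 _ _)).
rewrite (powRM (q - 1) (powR_ge0 _ _) (powR_ge0 _ _)).
have -> : r `^ (c - 1) = ((r `^ (-1)) `^ q^-1) `^ (q - 1) *
   ((r `^ (-1)) `^ p^-1) `^ (2 - p * (alpha + 1)) * (r `^ (-1)) `^ (- beta) * r `^ (a - 1).
  rewrite -!powRrM -!(powR_D _ _ r0); congr (_ `^ _).
  by rewrite /a /c; field; rewrite pn0 qn0.
have e : ((1 - r) `^ q^-1) `^ (q - 1) * (1 - r) `^ (b - 1) = 1.
  rewrite -powRrM -(powR_D _ _ r1') (_ : _ + (b - 1) = 0) ?powRr0//.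
  rewrite /b; field; exact: qn0.
have -> : ibeta a q^-1 r = ibeta a b r by [].
move: (ibeta a b r) e => A3 e; move: e.
move: (q^-1) ((1 - r) `^ (b - 1)) (((1 - r) `^ _) `^ (q - 1))
 => B3 B1 B2 e.
move: (r `^ (a - 1)) ((Y - r) `^ - beta) (C `^ (- beta))
  (((r `^ (-1)) `^ p^-1) `^ (2 - p * (alpha + 1)))
  (((r `^ (-1)) `^ B3) `^ (q - 1)) ((r `^ (-1)) `^ (- beta)) => A1 A2 A5 A6 A7 A8.
clearbody H; by rewrite -[LHS]mulr1 -e; ring.
Qed.

End hyperbolic_sine_tail.

(** * Expansions of the unbounded incomplete Beta integral *)

(** Unlike abstract_atoms, this identifies powers that agree only up to
    conversion of the underlying ring structures. *)
Ltac abstract_upto := repeat match goal with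
  | |- context [powR ?x ?y] => let z := fresh "z" in set z := (powR x y); clearbody z
  end.

Section expansions.
Context {R : realType}.
Notation mu := (@lebesgue_measure R).
Local Opaque powR expR Gamma_pos Gamma Beta.
Implicit Types (D E : set R) (F phi f g A S h : R -> R) (a b c e x y v s t w z T : R).

(** Coefficients of (1 + w)^(- c) in powers of w. *)
Definition scoef c k : R := (-1) ^+ k * bcoef c k.

Lemma normr_scoef c k : `|scoef c k| = `|bcoef c k|.
Proof. by rewrite /scoef normrM normrX normrN1 expr1n mul1r. Qed.

Lemma cvg_sbinom c w : `|w| < 1 ->
  series (fun k => scoef c k * w ^+ k) @ \oo --> (1 + w) `^ (- c).
Proof.
move=> w1; have w1' : `|- w| < 1 by rewrite normrN.
have := @cvg_binom _ c _ w1'; rewrite opprK.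
apply: cvg_trans; apply: near_eq_cvg; near=> n.
rewrite /series/=; apply: eq_bigr => k _.
by rewrite /scoef -[- w]mulN1r exprMn; ring.
Unshelve. all: by end_near. Qed.

(** Absolute convergence at a bound tau of |h| makes a multiple of g dominate
    all partial sums. *)
Lemma has_int_power_series D (cf m : nat -> R) (tau w : R) (h g F S : R -> R) :
  measurable D -> 0 <= tau -> cvgn (series (fun k => `|cf k| * tau ^+ k)) ->
  (forall x, D x -> `|h x| <= tau) -> has_int D g w ->
  (forall x, D x -> 0 <= g x) ->
  (forall k, has_int D (fun x => h x ^+ k * g x) (m k)) ->
  measurable_fun D F ->
  (forall x, D x -> F x = S x * g x) ->
  (forall x, D x -> series (fun k => cf k * h x ^+ k) @ \oo --> S x) ->
  exists2 V, has_int D F V & series (fun k => cf k * m k) @ \oo --> V.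
Proof.
move=> mD tau0 cvg hb hg g0 hm mF FS cS.
pose f k x := cf k * (h x ^+ k * g x).
have fv k : has_int D (f k) (cf k * m k) by apply: has_int_scale.
have fser x n : series (f ^~ x) n = series (fun k => cf k * h x ^+ k) n * g x.
  by rewrite /series/= mulr_suml; apply: eq_bigr => k _; rewrite /f mulrA.
apply: (has_int_series mD fv mF (has_int_scale (limn (series (fun k => `|cf k| * tau ^+ k))) mD hg)).
- move=> x Dx; rewrite FS//.
  have : (fun n => series (fun k => cf k * h x ^+ k) n * g x) @ \oo --> S x * g x.
    by apply: cvgM; [exact: cS|exact: cvg_cst].
  by apply: cvg_trans; apply: near_eq_cvg; near=> n; rewrite fser.
- move=> x n Dx; rewrite fser normrM (ger0_norm (g0 _ Dx)).
  apply: ler_wpM2r; first exact: g0.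
  apply: le_trans (ler_norm_sum _ _ _) _.
  apply: (@le_trans _ _ (series (fun k => `|cf k| * tau ^+ k) n)).
    rewrite /series/=; apply: ler_sum => k _.
    rewrite normrM normrX ler_wpM2l// lerXn2r// ?nnegrE//.
    exact: hb.
  apply: nondecreasing_cvgn_le; last exact: cvg.
  apply/nondecreasing_seqP => i; rewrite /series/= big_nat_recr//= lerDl.
  by rewrite mulr_ge0// exprn_ge0.
Unshelve. all: by end_near. Qed.

Lemma cvg_sbeta a c v : 0 < a -> 0 < v < 1 ->
  series (fun k => scoef c k * (v `^ (a + k%:R) / (a + k%:R))) @ \oo --> sbeta a c v.
Proof.
move=> a0 /andP[v0 v1].
have hm k : has_int `]0, v[ (fun w => w ^+ k * w `^ (a - 1)) (v `^ (a + k%:R) / (a + k%:R)).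
  have ak : 0 < a + k%:R by rewrite ltr_wpDr.
  apply: has_int_eq (has_int_powR ak v0) => // w /mem_oo /andP[w0 _].
  rewrite -(powR_mulrn _ (ltW w0)) -(powR_D _ _ w0); congr (_ `^ _); ring.
have cf : cvgn (series (fun k => `|scoef c k| * v ^+ k)).
  under eq_fun do rewrite normr_scoef.
  by apply: bcoef_summable => //; exact: ltW.
have [||||V hV cV] := has_int_power_series (S := fun w => (1 + w) `^ (- c))
    (measurable_itv _) (ltW v0) cf _ (has_int_powR a0 v0) _ hm (@measurable_sbeta _ _ a c).
- by move=> x /mem_oo /andP[x0 xv]; rewrite gtr0_norm// ltW.
- by move=> x _; exact: powR_ge0.
- by move=> x _; rewrite mulrC.
- move=> x /mem_oo /andP[x0 xv]; apply: cvg_sbinom.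
  by rewrite gtr0_norm// (lt_trans xv).
by rewrite (has_int_uniq (has_int_sbeta c a0 v0) hV).
Qed.

(** The substitution w = v^(- 1). *)
Lemma has_int_tail e b T : 0 < b - e -> 0 < T ->
  has_int `]T, +oo[ (fun v => v `^ (e - 1) * (1 + v) `^ (- b))
    (sbeta (b - e) b (T `^ (-1))).
Proof.
move=> be T0; have iT : 0 < T `^ (-1) by apply: powR_gt0.
have TT : (T `^ (-1)) `^ (-1) = T by rewrite -powRrM mulrNN mulr1 powRr1// ltW.
have h := has_int_sbeta b be iT.
pose g w := (w `^ (-1)) `^ (e - 1) * (1 + w `^ (-1)) `^ (- b).
have N10 : (-1 : R) < 0 by rewrite ltrN10.
apply/(@has_int_subst _ `]0, T `^ (-1)[ _ (fun w => w `^ (-1))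
   (fun w => -1 * w `^ (-1 - 1)) _ g).
- exact: exh_oo.
- move=> w /mem_oo /andP[w0 _]; apply: isd_eq (isd_powR (-1) w0 (isd_id w)) _.
  by rewrite mulr1.
- move=> w /mem_oo /andP[w0 _]; apply: ct_mul; first exact: ct_cst.
  by apply: ct_powR => //; exact: ct_id.
- by right => w /mem_oo /andP[w0 _]; rewrite mulN1r oppr_lt0 powR_gt0.
- move=> w /mem_oo /andP[w0 _].
  have c1 : {for w, continuous (fun w : R => w `^ (-1))}.
    by apply: ct_powR => //; exact: ct_id.
  have w1 : 0 < w `^ (-1) by exact: powR_gt0.
  apply: ct_mul; first exact: (ct_powR (f := fun w => w `^ (-1))).
  apply: (ct_powR (f := fun w => 1 + w `^ (-1))); first exact: addr_gt0.
  by apply: ct_add; [exact: ct_cst|exact: c1].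
- by move=> w _; apply: mulr_ge0; exact: powR_ge0.
- move=> w /mem_oo /andP[w0 wT]; split => //.
  by apply/mem_oy; rewrite -[X in X < _]TT; exact: ltr_powR_neg.
- move=> v /mem_oy Tv; have v0 := lt_trans T0 Tv.
  exists (v `^ (-1)); last by rewrite -powRrM mulrNN mulr1 powRr1// ltW.
  by apply/mem_oo; rewrite powR_gt0//=; exact: ltr_powR_neg.
apply: has_int_eq h => // w /mem_oo /andP[w0 _].
have w1 : 0 < 1 + w by rewrite addr_gt0.
rewrite mulN1r normrN [`|_|]ger0_norm ?powR_ge0// /g.
have -> : 1 + w `^ (-1) = (1 + w) * w `^ (-1).
  by rewrite mulrDl mul1r powR_inv1 ?(ltW w0)// mulfV ?gt_eqF// addrC.
rewrite (powRM _ (ltW w1) (powR_ge0 _ _)) -2!powRrM.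
have -> : w `^ (b - e - 1) = w `^ (-1 * (e - 1)) * w `^ (-1 * - b) * w `^ (-1 - 1).
  by rewrite -!(powR_D _ _ w0); congr (_ `^ _); ring.
by rewrite mulrAC; congr (_ * _); rewrite -mulrA; congr (_ * _); exact: mulrC.
Qed.

Lemma sbeta_le a c v : 0 < a -> 0 < v <= 1 -> sbeta a c v <= 2 `^ `|c| * (v `^ a / a).
Proof.
move=> a0 /andP[v0 v1].
apply: (has_int_le (measurable_itv _) (has_int_sbeta c a0 v0)
  (has_int_scale (2 `^ `|c|) (measurable_itv _) (has_int_powR a0 v0))) => w /mem_oo /andP[w0 wv].
rewrite mulrC; apply: ler_wpM2r; first exact: powR_ge0.
have w1 : 1 <= 1 + w by rewrite lerDl ltW.
apply: (@le_trans _ _ ((1 + w) `^ `|c|)).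
  by apply: ler_powR => //; rewrite -normrN ler_norm.
apply: ge0_ler_powR; rewrite ?nnegrE ?normr_ge0//.
  exact: le_trans ler01 w1.
by rewrite (_ : 2 = 1 + 1 :> R) ?lerD2l ?(le_trans (ltW wv)).
Qed.

(** The difference of the two sides has derivative 0 on ]0, +oo[ and tends to 0
    at 0. *)
Lemma sbeta_rec e b T : 0 < e -> 0 < T ->
  (e - b) * sbeta e b T + b * sbeta e (b + 1) T = T `^ e * (1 + T) `^ (- b).
Proof.
move=> e0 T0; apply/eqP; rewrite -subr_eq0.
pose K t := (e - b) * sbeta e b t + b * sbeta e (b + 1) t + - (t `^ e * (1 + t) `^ (- b)).
rewrite -[X in X == 0]/(K T).
have dK t : 0 < t -> is_derive t 1 K 0.
  move=> t0; have t1 : 0 < 1 + t by rewrite addr_gt0.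
  have d1 := isd_mul (isd_cst (e - b) t) (is_derive_sbeta b e0 t0).
  have d2 := isd_mul (isd_cst b t) (is_derive_sbeta (b + 1) e0 t0).
  have d3 := isd_powR e t0 (isd_id t).
  have d4 := isd_powR (f := fun t => 1 + t) (- b) t1 (isd_add (isd_cst 1 t) (isd_id t)).
  apply: isd_eq (isd_add (isd_add d1 d2) (isd_opp (isd_mul d3 d4))) _.
  cbv beta.
  have -> : t `^ e = t * t `^ (e - 1).
    by rewrite -[X in X * _](powRr1 (ltW t0)) -(powR_D _ _ t0); congr (_ `^ _); ring.
  have -> : (1 + t) `^ (- (b + 1)) = (1 + t) `^ (- b - 1) by congr (_ `^ _); ring.
  have -> : (1 + t) `^ (- b) = (1 + t) * (1 + t) `^ (- b - 1).
    by rewrite -[X in X * _](powRr1 (ltW t1)) -(powR_D _ _ t1); congr (_ `^ _); ring.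
  move: (sbeta e b t) (sbeta e (b + 1) t) => s1 s2.
  by abstract_upto; ring.
have Kcst s : 0 < s -> s < T -> K s = K T.
  move=> s0 sT.
  have [||z zi] := @MVT _ K (fun=> 0) s T sT.
  - move=> z zi; apply: dK; apply: lt_trans s0 _.
    by move: zi; rewrite in_itv/= => /andP[].
  - apply: continuous_in_subspaceT => z zi; apply: isd_continuous (dK _ _).
    by move: zi; rewrite inE/= in_itv/= => /andP[+ _]; apply: lt_le_trans.
  - by rewrite mul0r => /eqP; rewrite subr_eq0 eq_sym => /eqP.
pose C := `|e - b| * (2 `^ `|b| / e) + `|b| * (2 `^ `|b + 1| / e) + 2 `^ `|b|.
have Kle s : 0 < s <= 1 -> `|K s| <= C * s `^ e.
  move=> s01; have /andP[s0 s1] := s01.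
  rewrite /K; apply: le_trans (ler_normD _ _) _; rewrite normrN /C [X in _ <= X]mulrDl.
  apply: lerD.
    apply: le_trans (ler_normD _ _) _; rewrite [X in _ <= X]mulrDl; apply: lerD.
      rewrite normrM -mulrA; apply: ler_wpM2l => //.
      rewrite ger0_norm ?sbeta_ge0//; apply: le_trans (sbeta_le b e0 s01) _.
      by rewrite -mulrA [e^-1 * _]mulrC.
    rewrite normrM -mulrA; apply: ler_wpM2l => //.
    rewrite ger0_norm ?sbeta_ge0//; apply: le_trans (sbeta_le (b + 1) e0 s01) _.
    by rewrite -mulrA [e^-1 * _]mulrC.
  rewrite ger0_norm; last by apply: mulr_ge0; exact: powR_ge0.
  rewrite mulrC; apply: ler_wpM2r; first exact: powR_ge0.
  have w1 : 1 <= 1 + s by rewrite lerDl ltW.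
  apply: (@le_trans _ _ ((1 + s) `^ `|b|)).
    by apply: ler_powR => //; rewrite -normrN ler_norm.
  apply: ge0_ler_powR; rewrite ?nnegrE ?normr_ge0//.
    exact: le_trans ler01 w1.
  by rewrite (_ : 2 = 1 + 1 :> R) ?lerD2l.
have C0 : 0 < C.
  rewrite /C; apply: ltr_wpDl; last exact: powR_gt0.
  apply: addr_ge0; apply: mulr_ge0 => //; apply: divr_ge0; rewrite ?powR_ge0//; exact: ltW.
rewrite -normr_le0 leNgt; apply/negP => KT.
pose d := (`|K T| / (2 * C)) `^ e^-1.
have KC0 : 0 < `|K T| / (2 * C) by rewrite divr_gt0// mulr_gt0.
have d0 : 0 < d by apply: powR_gt0.
(* at d the bound C * d^e equals |K T| / 2 *)
pose s := Num.min (Num.min 1 (T / 2)) d.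
have s0 : 0 < s by rewrite !lt_min ltr01 divr_gt0.
have sT : s < T.
  apply: (@le_lt_trans _ _ (T / 2)); first by rewrite /s !ge_min lexx orbT.
  by rewrite ltr_pdivrMr// ltr_pMr// ltr1n.
have s1 : s <= 1 by rewrite /s !ge_min lexx.
have sd : s <= d by rewrite /s ge_min lexx orbT.
have := Kle s; rewrite s0 s1 => /(_ isT); rewrite (Kcst _ s0 sT) leNgt => /negP; apply.
apply: (@le_lt_trans _ _ (C * (d `^ e))).
  apply: ler_wpM2l; first exact: ltW.
  by apply: ge0_ler_powR; rewrite ?nnegrE ?(ltW e0) ?(ltW s0) ?(ltW d0).
rewrite /d (powR_powRV (ltW KC0) (lt0r_neq0 e0)).
rewrite (_ : C * _ = `|K T| / 2); last by field; exact: lt0r_neq0.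
by rewrite ltr_pdivrMr// ltr_pMr// ltr1n.
Qed.

Lemma scoef_shift b j : b * scoef (b + 1) j = - j.+1%:R * scoef b j.+1.
Proof.
rewrite /scoef /bcoef risingSl factS natrM exprS; have := @fact_neq0 R j.
have : j.+1%:R != 0 :> R by rewrite pnatr_eq0.
move: (j.+1%:R : R) (j`!%:R : R) ((-1) ^+ j : R) => x y z.
by abstract_atoms; move=> h1 h2; field; rewrite h1 h2.
Qed.

(** The expansion at infinity, in powers of T; its constant term is the
    continued Beta function. For b > e this is the expansion of the convergent
    tail, and sbeta_rec descends from b + 1 to b. *)
Lemma cvg_sbeta_infinity e b T : 0 < e -> 1 < T ->
  (forall j : nat, e - b - j%:R != 0) ->
  series (fun j => scoef b j * (T `^ (e - b - j%:R) / (e - b - j%:R))) @ \oo -->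
    sbeta e b T - Beta e (b - e).
Proof.
move=> e0 T1; have T0 : 0 < T := lt_trans ltr01 T1.
have [n] : exists n : nat, 0 < b + n%:R - e /\ 0 < b + n%:R.
  exists (Num.truncn (e - b)).+1.
  have := truncnS_gt (e - b); lra.
elim: n b => [|n IH] b.
  rewrite addr0 => -[be b0] H.
  have hB := has_int_Beta_y e0 be.
  have ebb : e + (b - e) = b by ring.
  rewrite ebb in hB.
  have ht := has_int_tail be T0.
  have := has_int_split T0 (has_int_sbeta b e0 T0) ht.
  move=> /(has_int_uniq hB) ->; rewrite opprD addrA subrr add0r.
  have iT : 0 < T `^ (-1) < 1.
    by rewrite powR_gt0//= powR_inv1 ?(ltW T0)// invf_lt1.
  have := @cvg_sbeta _ b _ be iT => /cvgN.
  apply: cvg_trans; apply: near_eq_cvg; near=> m.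
  rewrite ?fctE /series/= -sumrN; apply: eq_bigr => j _.
  rewrite -powRrM (_ : -1 * (b - e + j%:R) = e - b - j%:R); last by ring.
  rewrite (_ : b - e + j%:R = - (e - b - j%:R)); last by ring.
  by rewrite invrN mulrN mulrN opprK.
rewrite -natr1 => hn H.
have b1n : 0 < b + 1 + n%:R - e /\ 0 < b + 1 + n%:R.
  by rewrite (_ : b + 1 + n%:R = b + (n%:R + 1)); last ring.
have H1 j : e - (b + 1) - j%:R != 0.
  rewrite (_ : e - (b + 1) - j%:R = e - b - j.+1%:R) ?H//.
  by rewrite -natr1; ring.
have {}IH := IH _ b1n H1.
have eb : e - b != 0 by have := H 0%N; rewrite subr0.
have Bd : Beta e (b - e) = b * Beta e (b + 1 - e) / (b - e).
  have be : b - e != 0 by rewrite -opprB oppr_eq0.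
  rewrite !BetaE (_ : e + (b - e) = b); last by ring.
  rewrite (_ : e + (b + 1 - e) = b + 1); last by ring.
  rewrite (_ : b + 1 - e = b - e + 1); last by ring.
  rewrite (GammaS be) (invGammaS b).
  move: (Gamma (b + 1))^-1 => G; abstract_atoms.
  by field.
rewrite -cvg_shiftS.
have Tinv : `|T `^ (-1)| < 1.
  rewrite ger0_norm ?powR_ge0//.
  by rewrite powR_inv1 ?(ltW T0)// invf_lt1.
have cR := @cvg_sbinom b _ Tinv.
have lim1 : (fun n => (T `^ (e - b) * series (fun j => scoef b j * (T `^ (-1)) ^+ j) n.+1 -
    b * series (fun j => scoef (b + 1) j *
       (T `^ (e - (b + 1) - j%:R) / (e - (b + 1) - j%:R))) n) / (e - b)) @ \oo -->
   (T `^ (e - b) * (1 + T `^ (-1)) `^ (- b) -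
    b * (sbeta e (b + 1) T - Beta e (b + 1 - e))) / (e - b).
  apply: cvgM; last exact: cvg_cst.
  apply: cvgB; apply: cvgM; try exact: cvg_cst; last exact: IH.
  rewrite -[X in X @ _ --> _]/(fun n => (series (fun j => scoef b j * (T `^ (-1)) ^+ j)) n.+1).
  by rewrite cvg_shiftS.
have -> : sbeta e b T - Beta e (b - e) =
   (T `^ (e - b) * (1 + T `^ (-1)) `^ (- b) -
    b * (sbeta e (b + 1) T - Beta e (b + 1 - e))) / (e - b).
  have -> : T `^ (e - b) * (1 + T `^ (-1)) `^ (- b) = T `^ e * (1 + T) `^ (- b).
    have T1' : 0 < 1 + T by rewrite addr_gt0.
    have -> : 1 + T `^ (-1) = (1 + T) * T `^ (-1).
      by rewrite mulrDl mul1r powR_inv1 ?(ltW T0)// mulfV ?gt_eqF// addrC.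
    rewrite (powRM _ (ltW T1') (powR_ge0 _ _)) -powRrM.
    have -> : T `^ e = T `^ (e - b) * T `^ (-1 * - b).
      by rewrite -(powR_D _ _ T0); congr (_ `^ _); ring.
    by abstract_upto; ring.
  rewrite -(sbeta_rec b e0 T0) Bd.
  have be : b - e != 0 by rewrite -opprB oppr_eq0.
  move: (sbeta e b T) (sbeta e (b + 1) T) => s1 s2; abstract_atoms.
  by field; rewrite eb be.
move: lim1; apply: cvg_trans; apply: near_eq_cvg; near=> m.
rewrite /series/= !big_nat_recl//= mulrDr mulr_sumr mulr_sumr -addrA -sumrB mulrDl mulr_suml.
congr (_ + _).
  rewrite !subr0 expr0 mulr1 /scoef expr0 bcoef0 !mul1r mulr1//.
apply: eq_bigr => j _.
have ebj := H j.+1.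
rewrite (_ : e - (b + 1) - j%:R = e - b - j.+1%:R); last by rewrite -natr1; ring.
rewrite [b * (_ * _)]mulrA scoef_shift.
have -> : T `^ (e - b - j.+1%:R) = T `^ (e - b) * (T `^ (-1)) ^+ j.+1.
  rewrite -(powR_mulrn _ (powR_ge0 _ _)) -powRrM -(powR_D _ _ T0).
  by congr (_ `^ _); ring.
move: ebj; move: (j.+1%:R : R) ((T `^ (-1)) ^+ j.+1) (scoef b j.+1) => J t sc ebj.
abstract_atoms; field; by rewrite eb ebj.
Unshelve. all: by end_near. Qed.

(** The bound u k * w j makes the tail in j of each row small compared with the
    summable u k. *)
Lemma iterated_series_swap (d : nat -> nat -> R) (u w r s : nat -> R) :
  (forall k, 0 <= u k) -> (forall j, 0 <= w j) ->
  cvgn (series u) -> cvgn (series w) ->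
  (forall k j, `|d k j| <= u k * w j) ->
  (forall k : nat, series (d k) @ \oo --> (r k : R)) ->
  (forall j : nat, series (d ^~ j) @ \oo --> (s j : R)) ->
  exists2 L : R, series r @ \oo --> L & series s @ \oo --> L.
Proof.
move=> u0 w0 cu cw dle dr ds.
pose U := limn (series u); pose W := limn (series w).
have Ule n : series u n <= U by apply: series_le_lim.
have Wle n : series w n <= W by apply: series_le_lim.
have W0 : 0 <= W by have := Wle 0%N; rewrite /series/= big_nil.
have U0 : 0 <= U by have := Ule 0%N; rewrite /series/= big_nil.
have tail k n : `|r k - series (d k) n| <= u k * (W - series w n).
  have c : (fun m => `|series (d k) m - series (d k) n|) @ \oo --> `|r k - series (d k) n|.
    by apply: cvg_norm; apply: cvgB; [exact: dr|exact: cvg_cst].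
  rewrite -(cvg_lim (@Rhausdorff R) c).
  apply: limr_le; first exact: cvgP c.
  near=> m.
  have nm : (n <= m)%N by near: m; exact: nbhs_infty_ge.
  rewrite /series/= (big_cat_nat (n := n) (leq0n _) nm)/= addrAC subrr add0r.
  apply: le_trans (ler_norm_sum _ _ _) _.
  apply: (@le_trans _ _ (\sum_(n <= j < m) u k * w j)).
    by apply: ler_sum => j _; exact: dle.
  rewrite -mulr_sumr; apply: ler_wpM2l => //.
  have := Wle m; rewrite /series/= (big_cat_nat (n := n) (leq0n _) nm)/=; lra.
have cr : cvgn (series r).
  apply: normed_cvg; apply: (@series_le_cvg _ _ (fun k => W * u k)) => [k|k|k|].
  - exact: normr_ge0.
  - by rewrite mulr_ge0.
  - by have := tail k 0%N; rewrite /series/= !big_nil !subr0 mulrC.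
  - rewrite (_ : series _ = fun n => W * series u n); last first.
      by apply/funext => n; rewrite /series/= mulr_sumr.
    by apply: is_cvgM => //; exact: is_cvg_cst.
exists (limn (series r)) => //.
have est n : `|series s n - limn (series r)| <= U * (W - series w n).
  have c1 : (fun m => \sum_(0 <= j < n) series (d ^~ j) m) @ \oo --> series s n.
    rewrite /series/=.
    elim: n => [|n IH].
      by rewrite big_nil; under eq_fun do rewrite big_nil; exact: cvg_cst.
    rewrite big_nat_recr//=; under eq_fun do rewrite big_nat_recr//=.
    by apply: cvgD => //; exact: ds.
  have c2 : (fun m => `|\sum_(0 <= j < n) series (d ^~ j) m - series r m|) @ \oo -->
      `|series s n - limn (series r)|.
    by apply: cvg_norm; apply: cvgB.
  rewrite -(cvg_lim (@Rhausdorff R) c2).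
  apply: limr_le; first exact: cvgP c2.
  near=> m.
  rewrite /series/= exchange_big/= -sumrB.
  apply: le_trans (ler_norm_sum _ _ _) _.
  apply: (@le_trans _ _ (\sum_(0 <= k < m) u k * (W - series w n))).
    by apply: ler_sum => k _; rewrite distrC; exact: tail.
  rewrite -mulr_suml; apply: ler_wpM2r; last exact: Ule.
  by rewrite subr_ge0.
apply/cvgrPdist_le => e e0.
have c : (fun n => U * (W - series w n)) @ \oo --> U * (W - W).
  by apply: cvgM; [exact: cvg_cst|apply: cvgB => //; exact: cvg_cst].
move: c; rewrite subrr mulr0 => /cvgrPdist_le /(_ _ e0); apply: filterS => n.
rewrite sub0r normrN => h; rewrite distrC; apply: le_trans (est n) _.
by apply: le_trans h; exact: ler_norm.
Unshelve. all: by end_near. Qed.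

(** When C = 0 nothing is known of the series of t, but then V = 0. *)
Lemma series_scale_lim (C V : R) (t : nat -> R) :
  series (fun k => C * t k) @ \oo --> V -> V = C * limn (series t).
Proof.
have -> : series (fun k => C * t k) = fun n => C * series t n.
  by apply/funext => n; rewrite /series/= mulr_sumr.
have [->|C0] := eqVneq C 0.
  move=> h; rewrite mul0r; apply: cvg_unique h _ => //.
  rewrite (_ : (fun n => 0 * series t n) = (fun=> 0)); first exact: cvg_cst.
  by apply/funext => n; rewrite mul0r.
move=> h; have : (fun n => C^-1 * (C * series t n)) @ \oo --> C^-1 * V.
  by apply: cvgM => //; exact: cvg_cst.
under eq_fun do rewrite mulKf//.
by move=> /(cvg_lim (@Rhausdorff R)) ->; rewrite mulVKf.
Qed.

End expansions.

(** * Power series at 1 *)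

Section unit_argument.
Context {R : realType}.
Notation mu := (@lebesgue_measure R).
Local Opaque powR expR Gamma_pos Gamma Beta sbeta.

(** Raabe's test: delta * t k is at most the decrease of k * t k from k to k + 1,
    and these decreases telescope. *)
Lemma raabe_summable (t : nat -> R) (delta : R) (N : nat) : 0 < delta ->
  (forall k, 0 <= t k) ->
  (forall k, (N <= k)%N -> k.+1%:R * t k.+1 <= (k%:R - delta) * t k) ->
  cvgn (series t).
Proof.
move=> d0 t0 H; apply: nondecreasing_is_cvgn.
  by apply/nondecreasing_seqP => n; rewrite /series/= big_nat_recr//= lerDl.
have tel n : delta * \sum_(N <= k < N + n) t k + (N + n)%:R * t (N + n)%N <= N%:R * t N.
  elim: n => [|n IH]; first by rewrite addn0 big_geq// mulr0 add0r.
  apply: le_trans IH; rewrite addnS big_nat_recr ?leq_addr//= mulrDr -addrA lerD2l.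
  by have := H (N + n)%N (leq_addr _ _); lra.
exists (series t N + N%:R * t N / delta) => _ [n _ <-].
have le1 : series t n <= series t (N + n)%N.
  by rewrite /series/= (big_cat_nat (n := n) (leq0n _) (leq_addl N n))/= lerDl sumr_ge0.
apply: le_trans le1 _; rewrite /series/= (big_cat_nat (n := N) (leq0n _) (leq_addr n N))/= lerD2l.
rewrite ler_pdivlMr// mulrC; apply: le_trans (tel n); rewrite lerDl.
by apply: mulr_ge0.
Qed.

(** The cubic terms cancel; the coefficient of k^2 in the difference is
    b1 + b2 - (a1 + a2 + a3) - delta, positive when delta is half the gap. *)
Lemma raabe_cubic (a1 a2 a3 b1 b2 : R) : a1 + a2 + a3 < b1 + b2 ->
  exists2 delta : R, 0 < delta & exists N : nat, forall k : nat, (N <= k)%N ->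
    [/\ 0 < (a1 + k%:R) * (a2 + k%:R) * (a3 + k%:R), 0 < (b1 + k%:R) * (b2 + k%:R) &
     (a1 + k%:R) * (a2 + k%:R) * (a3 + k%:R) <=
       (k%:R - delta) * ((b1 + k%:R) * (b2 + k%:R))].
Proof.
move=> ab; pose d := (b1 + b2 - (a1 + a2 + a3)) / 2.
have d0 : 0 < d by rewrite divr_gt0// subr_gt0.
exists d => //.
pose B := b1 * b2 - d * (b1 + b2) - (a1 * a2 + a1 * a3 + a2 * a3).
pose C := - d * (b1 * b2) - a1 * a2 * a3.
(* beyond M all five factors are positive, and d k >= |B| + |C| *)
pose M := `|a1| + `|a2| + `|a3| + `|b1| + `|b2| + 1 + (`|B| + `|C|) / d.
exists (Num.truncn M).+1 => k Nk.
have Mk : M < k%:R by apply: lt_le_trans (truncnS_gt M) _; rewrite ler_nat.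
have q0 : 0 <= (`|B| + `|C|) / d by apply: divr_ge0; [exact: addr_ge0|exact: ltW].
have pos a : `|a| <= `|a1| + `|a2| + `|a3| + `|b1| + `|b2| -> 0 < a + k%:R.
  move=> ha; have := ler_norm (- a); rewrite normrN; move: Mk q0 ha.
  by rewrite /M; move: (_ / d) => Q; lra.
have nn := @normr_ge0 R R.
have na1 := nn a1; have na2 := nn a2; have na3 := nn a3.
have nb1 := nn b1; have nb2 := nn b2; have nB := nn B; have nC := nn C.
split.
- by rewrite !mulr_gt0// pos//; lra.
- by rewrite !mulr_gt0// pos//; lra.
- rewrite -subr_ge0.
  have -> : (k%:R - d) * ((b1 + k%:R) * (b2 + k%:R)) -
      (a1 + k%:R) * (a2 + k%:R) * (a3 + k%:R) = d * k%:R ^+ 2 + B * k%:R + C.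
    by rewrite /B /C /d; field.
  have k1 : 1 <= k%:R :> R by rewrite ler1n (leq_trans _ Nk).
  have h1 : `|B| + `|C| <= d * k%:R.
    by rewrite mulrC -ler_pdivrMr//; move: Mk; rewrite /M; move: (_ / d) => Q; lra.
  have h2 : (`|B| + `|C|) * k%:R <= d * k%:R ^+ 2.
    by rewrite expr2 mulrA ler_wpM2r.
  have h3 : - (`|B| * k%:R) <= B * k%:R.
    by rewrite -mulNr ler_wpM2r// lerNl -normrN ler_norm.
  have h4 : - (`|C| * k%:R) <= C.
    rewrite lerNl; apply: le_trans (ler_norm (- C)) _.
    by rewrite normrN ler_peMr.
  by move: h2; rewrite mulrDl; lra.
Qed.

Lemma hyper_summable (a1 a2 a3 b1 b2 : R) :
  (forall i : nat, b1 + i%:R != 0) -> (forall i : nat, b2 + i%:R != 0) ->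
  a1 + a2 + a3 < b1 + b2 ->
  cvgn (series (fun k => `|rising a1 k * rising a2 k * rising a3 k /
    (rising b1 k * rising b2 k) * (1 ^+ k / k`!%:R)|)).
Proof.
move=> hb1 hb2 /raabe_cubic [d d0 [N H]].
apply: (raabe_summable (N := N) d0) => k; first exact: normr_ge0.
move=> /H [P0 Q0 PQ].
have -> : rising a1 k.+1 * rising a2 k.+1 * rising a3 k.+1 /
    (rising b1 k.+1 * rising b2 k.+1) * (1 ^+ k.+1 / k.+1`!%:R) =
  rising a1 k * rising a2 k * rising a3 k / (rising b1 k * rising b2 k) * (1 ^+ k / k`!%:R) *
  ((a1 + k%:R) * (a2 + k%:R) * (a3 + k%:R) / ((b1 + k%:R) * (b2 + k%:R)) / k.+1%:R).
  rewrite !risingS factS natrM !expr1n.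
  have := rising_neq0 k hb1; have := rising_neq0 k hb2; have := @fact_neq0 R k.
  have : k.+1%:R != 0 :> R by rewrite pnatr_eq0.
  have := hb1 k; have := hb2 k.
  move: (a1 + k%:R) (a2 + k%:R) (a3 + k%:R) (b1 + k%:R) (b2 + k%:R) (k.+1%:R : R) (k`!%:R : R).
  move=> x1 x2 x3 x4 x5 x6 x7; abstract_atoms => h1 h2 h3 h4 h5 h6.
  by field; rewrite h1 h2 h3 h4 h5 h6.
rewrite normrM; move: `|_ * (1 ^+ k / _)| (normr_ge0 (rising a1 k * rising a2 k * rising a3 k /
    (rising b1 k * rising b2 k) * (1 ^+ k / k`!%:R))) => t t0.
have k0 : 0 < k.+1%:R :> R by rewrite ltr0n.
rewrite ger0_norm; last by rewrite divr_ge0// ?divr_ge0// ltW.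
rewrite mulrCA [_ * t]mulrC; apply: ler_wpM2l => //.
by rewrite mulrC divfK ?gt_eqF// ler_pdivrMr.
Qed.

(** Abel's theorem in the absolutely convergent case, where the tails are small
    uniformly in y. *)
Lemma cvg_power_series_left (t y : nat -> R) : cvgn (series (fun k => `|t k|)) ->
  (forall n, 0 <= y n <= 1) -> y @ \oo --> (1 : R) ->
  (fun n => limn (series (fun k => t k * y n ^+ k))) @ \oo --> limn (series t).
Proof.
move=> ct y01 cy; pose W := limn (series (fun k => `|t k|)).
have tail (u : nat -> R) N : (forall k, `|u k| <= `|t k|) ->
    `|limn (series u) - series u N| <= W - series (fun k => `|t k|) N.
  move=> ut.
  have cu : cvgn (series u).
    apply: normed_cvg; apply: (series_le_cvg _ _ ut ct) => k; exact: normr_ge0.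
  have c : (fun m => `|series u m - series u N|) @ \oo --> `|limn (series u) - series u N|.
    by apply: cvg_norm; apply: cvgB; [exact: cu|exact: cvg_cst].
  rewrite -(cvg_lim (@Rhausdorff R) c).
  apply: limr_le; first exact: cvgP c.
  near=> m.
  have nm : (N <= m)%N by near: m; exact: nbhs_infty_ge.
  rewrite /series/= (big_cat_nat (n := N) (leq0n _) nm)/= addrAC subrr add0r.
  apply: le_trans (ler_norm_sum _ _ _) _.
  apply: (@le_trans _ _ (\sum_(N <= j < m) `|t j|)); first by apply: ler_sum => j _.
  have : series (fun k => `|t k|) m <= W by apply: series_le_lim.
  by rewrite /series/= (big_cat_nat (n := N) (leq0n _) nm)/=; lra.
apply/cvgrPdist_le => e e0.
have e3 : 0 < e / 3 by rewrite divr_gt0.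
have [N _ HN] : \forall N \near \oo, W - series (fun k => `|t k|) N <= e / 3.
  have /cvgrPdist_le /(_ _ e3) := ct; apply: filterS => n; apply: le_trans; exact: ler_norm.
have {}HN := HN N (leqnn N).
have cN : (fun n => series (fun k => t k * y n ^+ k) N) @ \oo --> series t N.
  rewrite /series/=; elim: N {HN} => [|N IH].
    by rewrite big_nil; under eq_fun do rewrite big_nil; exact: cvg_cst.
  rewrite big_nat_recr//=; under eq_fun do rewrite big_nat_recr//=.
  apply: cvgD => //.
  have cp : (fun n => y n ^+ N) @ \oo --> ((1 : R) ^+ N : R).
    elim: N {IH} => [|N IH]; first by under eq_fun do rewrite expr0; exact: cvg_cst.
    by under eq_fun do rewrite exprS; rewrite exprS; exact: cvgM cy IH.
  rewrite expr1n in cp; rewrite -[X in _ --> X](mulr1 (t N)).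
  exact: cvgM (cvg_cst _) cp.
near=> n.
have h1 : `|series t N - series (fun k => t k * y n ^+ k) N| <= e / 3.
  near: n; by move/cvgrPdist_le: cN; apply.
have h2 := tail t N (fun k => lexx _).
have h3 : `|limn (series (fun k => t k * y n ^+ k)) - series (fun k => t k * y n ^+ k) N| <=
    W - series (fun k => `|t k|) N.
  apply: tail => k; rewrite normrM ler_piMr// normrX; have /andP[yn0 yn1] := y01 n.
  by rewrite ger0_norm// exprn_ile1.
move: h1 h2 h3 HN; rewrite [X in _ -> _ -> X <= _ -> _]distrC.
move: (limn _) (limn _) (series t N) (series _ N) (W - _) => L1 L2 s1 s2 w.
rewrite !ler_norml => /andP[a1 a2] /andP[a3 a4] /andP[a5 a6] a7.
by apply/andP; split; lra.
Unshelve. all: by end_near. Qed.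

End unit_argument.

(** * The Stieltjes transform of the incomplete Beta integral *)

Section connection.
Context {R : realType}.
Notation mu := (@lebesgue_measure R).
Local Opaque powR expR Gamma_pos Gamma Beta sbeta.

Lemma powRV1 (x : R) : 0 < x -> x `^ (-1) = x^-1.
Proof. by move=> x0; rewrite powR_inv1// ltW. Qed.

Lemma powRN1M (x a : R) : (x `^ (-1)) `^ a = x `^ (- a).
Proof. by rewrite -powRrM mulN1r. Qed.

(** Write sbeta k0 c v as its value at T plus the integral of its derivative over
    ]T, v[, and use Tonelli on the wedge T < w < v. *)
Lemma has_int_sbeta_tail (k0 c d T : R) : 0 < k0 -> 0 < d -> 0 < c + d - k0 -> 0 < T ->
  has_int `]T, +oo[ (fun v => sbeta k0 c v * v `^ (- d - 1))
    ((T `^ (- d) * sbeta k0 c T + sbeta (c + d - k0) c (T `^ (-1))) / d).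
Proof.
move=> k0p d0 cd T0.
pose th w : R := w `^ (k0 - 1) * (1 + w) `^ (- c).
have th0 w : 0 <= th w by apply: mulr_ge0; exact: powR_ge0.
have h1 := has_int_scale (sbeta k0 c T) (measurable_itv _) (has_int_powR_y d0 T0).
pose h v w : R := if w < v then th w * v `^ (- d - 1) else 0.
have mh : measurable_fun setT (fun z : R * R => h z.1 z.2).
  apply: measurable_fun_ifT => //=.
    exact: measurable_fun_ltr.
  apply: measurable_funM; last exact: measurable_powRf.
  apply: measurable_funM; first exact: measurable_powRf.
  by apply: measurable_powRf; exact: measurable_funD.
have sw := tonelli_swap (measurable_itv `]T, +oo[) (measurable_itv `]T, +oo[) mh.
have h0 v w : 0 <= h v w.
  rewrite /h; case: (w < v); last exact: lexx.
  by apply: mulr_ge0; [exact: th0|exact: powR_ge0].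
have {}sw := sw (fun v w _ _ => h0 v w).
have l1 : (\int[mu]_(v in `]T, +oo[) \int[mu]_(w in `]T, +oo[) (h v w)%:E =
    \int[mu]_(v in `]T, +oo[) ((sbeta k0 c v - sbeta k0 c T) * v `^ (- d - 1))%:E)%E.
  apply: eq_integral => v; rewrite inE => /mem_oy Tv; have v0 := lt_trans T0 Tv.
  have hi := has_int_increment (ltW T0) Tv (has_int_sbeta c k0p T0) (has_int_sbeta c k0p v0).
  have [_ e] := has_int_scale (v `^ (- d - 1)) (measurable_itv _) hi.
  rewrite [X in _ = X%:E]mulrC -e [LHS]integral_mkcond [RHS]integral_mkcond.
  apply: eq_integral => w _; rewrite !patchE.
  have [wv|vw] := ltP w v.
    have [Tw|wT] := ltP T w.
      have m1 : w \in (`]T, v[%classic : set R) by rewrite inE; apply/mem_oo; rewrite Tw.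
      have m2 : w \in (`]T, +oo[%classic : set R) by rewrite inE; apply/mem_oy.
      by rewrite m1 m2 /h wv; congr EFin; exact: mulrC.
    have m1 : (w \in (`]T, v[%classic : set R)) = false.
      by apply/negbTE; rewrite notin_setE => /mem_oo /andP[]; rewrite ltNge wT.
    have m2 : (w \in (`]T, +oo[%classic : set R)) = false.
      by apply/negbTE; rewrite notin_setE => /mem_oy; rewrite ltNge wT.
    by rewrite m1 m2.
  have m1 : (w \in (`]T, v[%classic : set R)) = false.
    by apply/negbTE; rewrite notin_setE => /mem_oo /andP[_]; rewrite ltNge vw.
  by rewrite m1 /h [w < v]ltNge vw/=; case: (_ \in _).
have l2 : (\int[mu]_(w in `]T, +oo[) \int[mu]_(v in `]T, +oo[) (h v w)%:E =
    (d^-1 * sbeta (c + d - k0) c (T `^ (-1)))%:E)%E.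
  have ckd : 0 < c - (k0 - d) by move: cd; lra.
  have := has_int_tail (e := k0 - d) ckd T0.
  rewrite (_ : c - (k0 - d) = c + d - k0); last by ring.
  move=> /(has_int_scale d^-1 (measurable_itv _)) [_ <-].
  apply: eq_integral => w; rewrite inE => /mem_oy Tw; have w0 := lt_trans T0 Tw.
  have [_ e] := has_int_scale (th w) (measurable_itv _) (has_int_powR_y d0 w0).
  have -> : d^-1 * (w `^ (k0 - d - 1) * (1 + w) `^ (- c)) = th w * (w `^ (- d) / d).
    rewrite /th (_ : k0 - d - 1 = k0 - 1 + - d); last by ring.
    by rewrite (powR_D (k0 - 1) (- d) w0); abstract_upto; ring.
  rewrite -e [LHS]integral_mkcond [RHS]integral_mkcond.
  apply: eq_integral => v _; rewrite !patchE.
  have [wv|vw] := ltP w v.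
    have m1 : v \in (`]w, +oo[%classic : set R) by rewrite inE; apply/mem_oy.
    have m2 : v \in (`]T, +oo[%classic : set R).
      by rewrite inE; apply/mem_oy; exact: lt_trans wv.
    by rewrite m1 m2 /h wv.
  have m1 : (v \in (`]w, +oo[%classic : set R)) = false.
    by apply/negbTE; rewrite notin_setE => /mem_oy; rewrite ltNge vw.
  by rewrite m1 /h [w < v]ltNge vw/=; case: (_ \in _).
have mf : measurable_fun (`]T, +oo[%classic : set R)
    (fun v => (sbeta k0 c v - sbeta k0 c T) * v `^ (- d - 1)).
  apply: exhaustible_continuous_measurable; first exact: exh_oy.
  move=> v /mem_oy Tv; have v0 := lt_trans T0 Tv.
  apply: ct_mul; last by apply: ct_powR => //; exact: ct_id.
  apply: ct_sub; last exact: ct_cst.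
  exact: isd_continuous (is_derive_sbeta c k0p v0).
have h2 : has_int `]T, +oo[ (fun v => (sbeta k0 c v - sbeta k0 c T) * v `^ (- d - 1))
    (d^-1 * sbeta (c + d - k0) c (T `^ (-1))).
  apply: (has_int_ge0 (measurable_itv _) mf); last exact: (etrans (esym l1) (etrans sw l2)).
  move=> v /mem_oy Tv; apply: mulr_ge0; last exact: powR_ge0.
  have v0 := lt_trans T0 Tv.
  exact: has_int_pos (fun w _ => th0 w) (has_int_increment (ltW T0) Tv (has_int_sbeta c k0p T0) (has_int_sbeta c k0p v0)).
have -> : (T `^ (- d) * sbeta k0 c T + sbeta (c + d - k0) c (T `^ (-1))) / d =
    sbeta k0 c T * (T `^ (- d) / d) + d^-1 * sbeta (c + d - k0) c (T `^ (-1)).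
  by rewrite mulrDl; congr (_ + _); [rewrite mulrAC mulrC|exact: mulrC].
apply: (has_int_eq (measurable_itv _) _ (has_int_add (measurable_itv _) h1 h2)) => v _.
by rewrite -mulrDl addrC subrK.
Qed.

Lemma has_int_shifted (e b y T : R) : 0 < e -> 0 < y -> 0 < T ->
  has_int `]0, T[ (fun v => v `^ (e - 1) * (y + v) `^ (- b))
    (y `^ (e - b) * sbeta e b (T / y)).
Proof.
move=> e0 y0 T0; have Ty : 0 < T / y by rewrite divr_gt0.
have h := has_int_scale (y `^ (e - 1 - b)) (measurable_itv _) (has_int_sbeta b e0 Ty).
have -> : y `^ (e - b) * sbeta e b (T / y) = y * (y `^ (e - 1 - b) * sbeta e b (T / y)).
  rewrite mulrA -[X in _ = X * _ * _](powRr1 (ltW y0)) -(powR_D _ _ y0).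
  by congr (_ `^ _ * _); ring.
have -> : (`]0, T[%classic : set R) = `]0, y * (T / y)[%classic.
  by rewrite mulrC divfK// gt_eqF.
apply: has_int_scale_o h => //.
- move=> v /andP[v0 _]; apply: ct_mul; first exact: ct_cst.
  exact: continuous_sbeta_fun.
- by move=> v _; rewrite !mulr_ge0 ?powR_ge0.
- move=> v /andP[v0 _].
  have -> : y + y * v = y * (1 + v) by ring.
  have v1 : 0 < 1 + v by rewrite addr_gt0.
  rewrite (powRM _ (ltW y0) (ltW v0)) (powRM _ (ltW y0) (ltW v1)).
  by rewrite (powR_D (e - 1) (- b) y0); abstract_upto; ring.
Qed.

Section parameters.
Context (k0 c alpha beta : R).
Hypotheses (k00 : 0 < k0) (k01 : k0 < 1).
Hypotheses (ak : 0 < alpha + k0) (ba : 0 < beta - alpha) (bac : 0 < c + (beta - alpha) - k0).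
Hypothesis noninteger : forall n : nat, beta - alpha - k0 != n%:R.

Let e0 := alpha + k0 - beta.

(** In the double series obtained below for a cut at T, e0 + k - j is the
    exponent of T in the term of index (k, j); its vanishing would produce a
    logarithm. *)
Lemma exponent_neq0 (k j : nat) : e0 + k%:R - j%:R != 0.
Proof.
have [jk|kj] := leqP j k.
  have := noninteger (k - j); rewrite natrB//; apply: contra => /eqP e.
  by rewrite eq_le; move: e; rewrite /e0 => e; apply/andP; split; lra.
apply/eqP => e; have : (k.+1%:R : R) <= j%:R by rewrite ler_nat.
rewrite -natr1; move: e ba k01; rewrite /e0; lra.
Qed.

(** The integers stay away from a number that is not one of them, which makes
    the double series absolutely convergent in spite of its denominators. *)
Lemma exponent_gap : exists2 delta : R, 0 < delta &
  forall k j : nat, delta <= `|e0 + k%:R - j%:R|.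
Proof.
pose f := e0 - (Num.floor e0)%:~R.
have f0 : 0 <= f by rewrite subr_ge0 floor_le.
have f1 : f < 1 by rewrite /f ltrBlDl -[1]/(1%:~R) -intrD floorD1_gt.
have fn0 : f != 0.
  rewrite subr_eq0; apply/eqP => e.
  case E : (Num.floor e0) => [n|n].
    by have := exponent_neq0 0 n; rewrite e E addr0 subrr eqxx.
  have := exponent_neq0 n.+1 0; rewrite e E subr0 NegzE mulrNz -pmulrn addrC subrr.
  by rewrite eqxx.
have fp : 0 < f by rewrite lt_neqAle eq_sym fn0.
exists (Num.min f (1 - f)); first by rewrite lt_min fp subr_gt0.
move=> k j; pose i : int := Num.floor e0 + k%:Z - j%:Z.
have -> : e0 + k%:R - j%:R = f + i%:~R.
  by rewrite /i /f !intrD mulrNz -!pmulrn; ring.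
have [i0|i0] := leP 0 i.
  have : (0 : R) <= i%:~R by rewrite ler0z.
  move=> h; rewrite ger0_norm; last exact: addr_ge0.
  by apply: (@le_trans _ _ f); [rewrite ge_min lexx|rewrite lerDl].
have : (i%:~R : R) <= -1 by rewrite -[-1]/((-1)%:~R) ler_int -ltzD1.
move=> h; rewrite ler0_norm; last by lra.
by rewrite ge_min; apply/orP; right; lra.
Qed.

Let cA k := scoef c k / (k0 + k%:R) : R.
Let kk (k : nat) : 0 < k0 + k%:R. Proof. by rewrite ltr_wpDr. Qed.
Let ek (k : nat) : 0 < alpha + k0 + k%:R. Proof. by rewrite ltr_wpDr. Qed.
Let dj (j : nat) : 0 < beta - alpha + j%:R. Proof. by rewrite ltr_wpDr. Qed.

(** What the third integral becomes, up to a constant factor, in the variable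
    v = sinh^q t and with y = sinh^q x. *)
Definition integrand y v : R := sbeta k0 c v * (v `^ (alpha - 1) * (y + v) `^ (- beta)).

Lemma continuous_integrand y v : 0 < y -> 0 < v -> {for v, continuous (integrand y)}.
Proof.
move=> y0 v0; apply: ct_mul; first exact: isd_continuous (is_derive_sbeta c k00 v0).
apply: ct_mul; first by apply: ct_powR => //; exact: ct_id.
apply: (ct_powR (f := fun v => y + v)); first exact: addr_gt0.
by apply: ct_add; [exact: ct_cst|exact: ct_id].
Qed.

Lemma summable_cA T : 0 < T -> T < 1 -> cvgn (series (fun k => `|cA k| * T ^+ k)).
Proof.
move=> T0 T1.
have c1 : cvgn (series (fun k => k0^-1 * (`|bcoef c k| * T ^+ k))).
  rewrite (_ : series _ = fun n => k0^-1 * series (fun k => `|bcoef c k| * T ^+ k) n).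
    apply: is_cvgM; first exact: is_cvg_cst.
    by apply: bcoef_summable => //; exact: ltW.
  by apply/funext => n; rewrite /series/= mulr_sumr.
apply: series_le_cvg c1 => k.
- by apply: mulr_ge0 => //; apply: exprn_ge0; exact: ltW.
- apply: mulr_ge0; first by rewrite invr_ge0 ltW.
  by apply: mulr_ge0 => //; apply: exprn_ge0; exact: ltW.
- rewrite mulrA; apply: ler_wpM2r; first by apply: exprn_ge0; exact: ltW.
  rewrite /cA normrM normr_scoef mulrC; apply: ler_wpM2r => //.
  rewrite ger0_norm; last by rewrite invr_ge0 ltW.
  by rewrite lef_pV2 ?posrE// lerDl.
Qed.

(** The expansion of sbeta in powers of v, which needs v < 1. *)
Lemma integrand_near0 y T : 0 < y -> 0 < T -> T < 1 ->
  exists2 V, has_int `]0, T[ (integrand y) V &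
    series (fun k => cA k * (y `^ (e0 + k%:R) * sbeta (alpha + k0 + k%:R) beta (T / y)))
      @ \oo --> V.
Proof.
move=> y0 T0 T1.
apply: (@has_int_power_series _ _ _ _ T _ (fun v => v)
  (fun v => v `^ (alpha + k0 - 1) * (y + v) `^ (- beta)) _
  (fun v => sbeta k0 c v * v `^ (- k0)) (measurable_itv _) (ltW T0)
  (summable_cA T0 T1) _ (has_int_shifted beta ak y0 T0)).
- by move=> v /mem_oo /andP[v0 vT]; rewrite gtr0_norm// ltW.
- by move=> v _; apply: mulr_ge0; exact: powR_ge0.
- move=> k; have := has_int_shifted beta (ek k) y0 T0.
  rewrite (_ : alpha + k0 + k%:R - beta = e0 + k%:R); last by rewrite /e0; ring.
  apply: has_int_eq => // v /mem_oo /andP[v0 _]; rewrite mulrA; congr (_ * _).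
  rewrite -(powR_mulrn _ (ltW v0)) -(powR_D _ _ v0); congr (_ `^ _); ring.
- apply: exhaustible_continuous_measurable; first exact: exh_oo.
  by move=> v /mem_oo /andP[v0 _]; exact: continuous_integrand.
- move=> v /mem_oo /andP[v0 _]; rewrite /integrand.
  rewrite (_ : alpha + k0 - 1 = k0 + (alpha - 1)); last by ring.
  rewrite (powR_D k0 (alpha - 1) v0).
  have e : v `^ (- k0) * v `^ k0 = 1 by rewrite -(powR_D _ _ v0) addNr powRr0.
  move: e; move: (sbeta k0 c v) => s; abstract_upto => e.
  by rewrite -[LHS]mulr1 -e; ring.
- move=> v /mem_oo /andP[v0 vT]; have v01 : 0 < v < 1 by rewrite v0 (lt_trans vT).
  have : (fun n => series (fun k => scoef c k * (v `^ (k0 + k%:R) / (k0 + k%:R))) n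
     * v `^ (- k0)) @ \oo --> sbeta k0 c v * v `^ (- k0).
    by apply: cvgM; [exact: cvg_sbeta|exact: cvg_cst].
  apply: cvg_trans; apply: near_eq_cvg; near=> n.
  rewrite /series/= mulr_suml; apply: eq_bigr => k _.
  rewrite (powR_D k0 k%:R v0) (powR_mulrn _ (ltW v0)) /cA.
  have e : v `^ k0 * v `^ (- k0) = 1 by rewrite -(powR_D _ _ v0) subrr powRr0.
  move: e; move: (scoef c k) (k0 + k%:R)^-1 (v ^+ k) => x1 x2 x3; abstract_upto => e.
  by rewrite -[RHS]mulr1 -e; ring.
Unshelve. all: by end_near. Qed.

Definition tailcoef T j : R := (T `^ (- (beta - alpha + j%:R)) * sbeta k0 c T +
  sbeta (c + (beta - alpha + j%:R) - k0) c (T `^ (-1))) / (beta - alpha + j%:R).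

(** The expansion of (y + v)^(- beta) in powers of y / v, which needs v > y. *)
Lemma integrand_near_infinity y T : 0 < y -> y < T ->
  exists2 V, has_int `]T, +oo[ (integrand y) V &
    series (fun j => scoef beta j * (y ^+ j * tailcoef T j)) @ \oo --> V.
Proof.
move=> y0 yT; have T0 := lt_trans y0 yT.
have yT0 : 0 <= y / T by rewrite divr_ge0// ltW.
have yT1 : y / T < 1 by rewrite ltr_pdivrMr// mul1r.
have cd j : 0 < c + (beta - alpha + j%:R) - k0.
  by have : (0 : R) <= j%:R by []; move: bac; lra.
have ht j := has_int_sbeta_tail k00 (dj j) (cd j) T0.
have h0 := ht 0%N; rewrite addr0 in h0.
have sm : cvgn (series (fun k => `|scoef beta k| * (y / T) ^+ k)).
  under eq_fun do rewrite normr_scoef.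
  exact: bcoef_summable.
have yv v : T < v -> 0 < y / v < 1.
  move=> Tv; have v0 := lt_trans T0 Tv; rewrite divr_gt0//= ltr_pdivrMr// mul1r.
  exact: lt_trans Tv.
apply: (@has_int_power_series _ _ _ _ (y / T) _ (fun v => y / v)
  (fun v => sbeta k0 c v * v `^ (- (beta - alpha) - 1)) _
  (fun v => (1 + y / v) `^ (- beta)) (measurable_itv _) yT0 sm _ h0).
- move=> v /mem_oy Tv; have /andP[h1 _] := yv _ Tv; have v0 := lt_trans T0 Tv.
  rewrite gtr0_norm//; apply: ler_wpM2l; first exact: ltW.
  by rewrite lef_pV2 ?posrE// ltW.
- by move=> v _; apply: mulr_ge0; [exact: sbeta_ge0|exact: powR_ge0].
- move=> j; apply: has_int_eq (has_int_scale (y ^+ j) (measurable_itv _) (ht j)) => // v /mem_oy Tv.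
  have v0 := lt_trans T0 Tv.
  have -> : v `^ (- (beta - alpha + j%:R) - 1) = v `^ (- (beta - alpha) - 1) * (v^-1) ^+ j.
    rewrite -(powRV1 v0) -(powR_mulrn _ (powR_ge0 _ _)) powRN1M -(powR_D _ _ v0).
    by congr (_ `^ _); ring.
  rewrite exprMn; move: (sbeta k0 c v) ((v^-1) ^+ j) (y ^+ j) => x1 x2 x3.
  by abstract_upto; ring.
- apply: exhaustible_continuous_measurable; first exact: exh_oy.
  by move=> v /mem_oy Tv; apply: continuous_integrand => //; exact: lt_trans Tv.
- move=> v /mem_oy Tv; have v0 := lt_trans T0 Tv; rewrite /integrand.
  have yv0 : 0 < 1 + y / v by rewrite addr_gt0// divr_gt0.
  have -> : y + v = v * (1 + y / v) by field; rewrite gt_eqF.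
  rewrite (powRM _ (ltW v0) (ltW yv0)).
  have -> : v `^ (- (beta - alpha) - 1) = v `^ (alpha - 1) * v `^ (- beta).
    by rewrite -(powR_D _ _ v0); congr (_ `^ _); ring.
  by move: (sbeta k0 c v) => x1; abstract_upto; ring.
- move=> v /mem_oy Tv; have /andP[h1 h2] := yv _ Tv.
  by apply: cvg_sbinom; rewrite gtr0_norm.
Qed.

(** What remains of the terms of the two expansions once their dependence on the
    cutting point T has cancelled. *)
Definition res1 y k : R := cA k *
  (y `^ (e0 + k%:R) * Beta (alpha + k0 + k%:R) (beta - alpha - k0 - k%:R)).
Definition res2 y j : R := scoef beta j * (y ^+ j *
  (Beta (c + (beta - alpha) - k0 + j%:R) (alpha - beta + k0 - j%:R) / (beta - alpha + j%:R))).

(** Cut at a T with y < T < 1 and use the two expansions. By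
    cvg_sbeta_infinity, the term of index k near 0 is res1 y k plus the sum of
    d k j over j, and the term of index j near infinity is res2 y j minus the
    sum of d k j over k, for one and the same double series d. Its two iterated
    sums agree, so d disappears from the total. *)
Lemma has_int_integrand_lt1 y : 0 < y -> y < 1 ->
  exists V1 V2, [/\ has_int `]0, +oo[ (integrand y) (V1 + V2),
    series (res1 y) @ \oo --> V1 & series (res2 y) @ \oo --> V2].
Proof.
move=> y0 y1; pose T := (y + 1) / 2.
have yT : y < T by rewrite /T; lra.
have T1 : T < 1 by rewrite /T; lra.
have T0 := lt_trans y0 yT.
have [U1 hU1 cU1] := integrand_near0 y0 T0 T1.
have [U2 hU2 cU2] := integrand_near_infinity y0 yT.
have [delta d0 hd] := exponent_gap.
have Ty : 1 < T / y by rewrite ltr_pdivlMr// mul1r.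
have Ty0 := lt_trans ltr01 Ty.
have iT1 : 1 < T `^ (-1) by rewrite powRV1// invf_gt1.
pose d k j := cA k * (scoef beta j * (y ^+ j * (T `^ (e0 + k%:R - j%:R) / (e0 + k%:R - j%:R)))).
pose r k := cA k * (y `^ (e0 + k%:R) * sbeta (alpha + k0 + k%:R) beta (T / y)) - res1 y k.
pose s j := res2 y j - scoef beta j * (y ^+ j * tailcoef T j).
have rows k : series (d k) @ \oo --> (r k : R).
  have ne j : alpha + k0 + k%:R - beta - j%:R != 0.
    rewrite (_ : alpha + k0 + k%:R - beta = e0 + k%:R) ?exponent_neq0//.
    by rewrite /e0; ring.
  have := cvg_sbeta_infinity (ek k) Ty ne.
  rewrite (_ : beta - (alpha + k0 + k%:R) = beta - alpha - k0 - k%:R); last by ring.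
  move=> h.
  have : (fun n => (cA k * y `^ (e0 + k%:R)) * series (fun j => scoef beta j *
      ((T / y) `^ (alpha + k0 + k%:R - beta - j%:R) / (alpha + k0 + k%:R - beta - j%:R))) n)
      @ \oo --> (cA k * y `^ (e0 + k%:R)) * (sbeta (alpha + k0 + k%:R) beta (T / y)
        - Beta (alpha + k0 + k%:R) (beta - alpha - k0 - k%:R)).
    by apply: cvgM => //; exact: cvg_cst.
  have -> : (cA k * y `^ (e0 + k%:R)) * (sbeta (alpha + k0 + k%:R) beta (T / y)
        - Beta (alpha + k0 + k%:R) (beta - alpha - k0 - k%:R)) = r k.
    by rewrite /r /res1 mulrBr -!mulrA.
  apply: cvg_trans; apply: near_eq_cvg; near=> n.
  rewrite /series/= mulr_sumr; apply: eq_bigr => j _; rewrite /d.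
  rewrite (_ : alpha + k0 + k%:R - beta - j%:R = e0 + k%:R - j%:R); last by rewrite /e0; ring.
  have -> : (T / y) `^ (e0 + k%:R - j%:R) = T `^ (e0 + k%:R - j%:R) * y `^ (- (e0 + k%:R - j%:R)).
    by rewrite (powRM _ (ltW T0)) ?invr_ge0 ?(ltW y0)// -(powRV1 y0) powRN1M.
  have -> : y ^+ j = y `^ (e0 + k%:R) * y `^ (- (e0 + k%:R - j%:R)).
    by rewrite -(powR_mulrn _ (ltW y0)) -(powR_D _ _ y0); congr (_ `^ _); ring.
  move: (cA k) (scoef beta j) (e0 + k%:R - j%:R)^-1 => x1 x2 x3; abstract_upto; ring.
have cols j : series (d ^~ j) @ \oo --> (s j : R).
  pose D := beta - alpha + j%:R.
  have D0 : 0 < D by exact: dj.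
  have cD : 0 < c + D - k0.
    by rewrite /D; have : (0 : R) <= j%:R by []; move: bac; lra.
  have ne k : c + D - k0 - c - k%:R != 0.
    have := exponent_neq0 k j; apply: contra => /eqP e.
    by rewrite eq_le; move: e; rewrite /D /e0 => e; apply/andP; split; lra.
  have c1 := cvg_sbeta_infinity cD iT1 ne.
  have T01 : 0 < T < 1 by rewrite T0.
  have c2 := @cvg_sbeta R k0 c T k00 T01.
  have : (fun n => - (scoef beta j * y ^+ j / D) * (T `^ (- D) *
      series (fun k => scoef c k * (T `^ (k0 + k%:R) / (k0 + k%:R))) n +
      series (fun k => scoef c k * ((T `^ (-1)) `^ (c + D - k0 - c - k%:R) /
        (c + D - k0 - c - k%:R))) n)) @ \oo -->
      - (scoef beta j * y ^+ j / D) * (T `^ (- D) * sbeta k0 c T +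
      (sbeta (c + D - k0) c (T `^ (-1)) - Beta (c + D - k0) (c - (c + D - k0)))).
    apply: cvgM; first exact: cvg_cst.
    by apply: cvgD => //; apply: cvgM => //; exact: cvg_cst.
  have -> : - (scoef beta j * y ^+ j / D) * (T `^ (- D) * sbeta k0 c T +
      (sbeta (c + D - k0) c (T `^ (-1)) - Beta (c + D - k0) (c - (c + D - k0)))) = s j.
    rewrite /s /res2 /tailcoef -/D.
    rewrite (_ : c - (c + D - k0) = alpha - beta + k0 - j%:R); last by rewrite /D; ring.
    rewrite (_ : c + D - k0 = c + (beta - alpha) - k0 + j%:R); last by rewrite /D; ring.
    move: (Beta _ _) (sbeta k0 c T) (sbeta _ c _) (scoef beta j) (y ^+ j) D^-1 (T `^ (- D)).
    by move=> *; ring.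
  apply: cvg_trans; apply: near_eq_cvg; near=> n.
  rewrite /series/= mulr_sumr -big_split/= mulr_sumr; apply: eq_bigr => k _.
  rewrite /d.
  have nk := ne k.
  have -> : (T `^ (-1)) `^ (c + D - k0 - c - k%:R) = T `^ (e0 + k%:R - j%:R).
    by rewrite powRN1M; congr (_ `^ _); rewrite /D /e0; ring.
  have -> : T `^ (- D) * (scoef c k * (T `^ (k0 + k%:R) / (k0 + k%:R))) =
      scoef c k * (T `^ (e0 + k%:R - j%:R) / (k0 + k%:R)).
    have -> : T `^ (e0 + k%:R - j%:R) = T `^ (- D) * T `^ (k0 + k%:R).
      by rewrite -(powR_D _ _ T0); congr (_ `^ _); rewrite /D /e0; ring.
    by move: (scoef c k) (k0 + k%:R)^-1 => x1 x2; abstract_upto; ring.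
  have -> : e0 + k%:R - j%:R = k0 + k%:R - D by rewrite /D /e0; ring.
  have nk' : k0 + k%:R - D != 0.
    apply: contra nk => /eqP e.
    by rewrite eq_le; apply/andP; split; move: e; lra.
  have -> : c + D - k0 - c - k%:R = - (k0 + k%:R - D) by ring.
  rewrite /cA; move: (kk k) D0 nk'.
  abstract_upto; move: (scoef c k) (scoef beta j) (y ^+ j) (k0 + k%:R); generalize D.
  move=> x6 x1 x2 x3 x5 h1 h2 h3.
  by field; rewrite h3 (gt_eqF h1) (gt_eqF h2).
pose u k := `|cA k| * T ^+ k.
pose w j := (T `^ e0 / delta) * (`|scoef beta j| * (y / T) ^+ j).
have yT0 : 0 <= y / T by rewrite divr_ge0// ltW.
have u0 k : 0 <= u k by apply: mulr_ge0 => //; apply: exprn_ge0; exact: ltW.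
have w0 j : 0 <= w j.
  apply: mulr_ge0; first by apply: divr_ge0; [exact: powR_ge0|exact: ltW].
  by apply: mulr_ge0 => //; exact: exprn_ge0.
have cw : cvgn (series w).
  rewrite (_ : series w = fun n => (T `^ e0 / delta) * series (fun j => `|scoef beta j| * (y / T) ^+ j) n).
    apply: is_cvgM; first exact: is_cvg_cst.
    under eq_fun do rewrite normr_scoef.
    by apply: bcoef_summable => //; rewrite ltr_pdivrMr// mul1r.
  by apply/funext => n; rewrite /series/= mulr_sumr.
have dle k j : `|d k j| <= u k * w j.
  have -> : u k * w j = `|cA k| * (`|scoef beta j| * (y ^+ j * (T `^ (e0 + k%:R - j%:R) / delta))).
    rewrite /u /w [(y / T) ^+ j]exprMn exprVn.
    have -> : T `^ (e0 + k%:R - j%:R) = T `^ e0 * T ^+ k * (T ^+ j)^-1.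
      rewrite -!(powR_mulrn _ (ltW T0)) -powRN -!(powR_D _ _ T0); congr (_ `^ _); ring.
    have ac (x1 x2 x3 x4 x5 x6 x7 : R) :
        x1 * x2 * (x3 / x4 * (x5 * (x6 * x7))) = x1 * (x5 * (x6 * (x3 * x2 * x7 / x4))).
      by ring.
    exact: ac.
  rewrite /d normrM; apply: ler_wpM2l => //.
  rewrite normrM; apply: ler_wpM2l => //.
  rewrite normrM ger0_norm; last by apply: exprn_ge0; exact: ltW.
  apply: ler_wpM2l; first by apply: exprn_ge0; exact: ltW.
  rewrite normrM ger0_norm; last exact: powR_ge0.
  apply: ler_wpM2l; first exact: powR_ge0.
  by rewrite normfV lef_pV2 ?posrE// (lt_le_trans d0).
have [L cr cs] := iterated_series_swap u0 w0 (summable_cA T0 T1) cw dle rows cols.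
exists (U1 - L), (U2 + L); split.
- have -> : U1 - L + (U2 + L) = U1 + U2 by ring.
  exact: has_int_split T0 hU1 hU2.
- have -> : series (res1 y) = fun n => series (fun k => cA k *
      (y `^ (e0 + k%:R) * sbeta (alpha + k0 + k%:R) beta (T / y))) n - series r n.
    apply/funext => n; rewrite /series/= -sumrB; apply: eq_bigr => k _.
    by rewrite /r opprB addrC subrK.
  exact: cvgB cU1 cr.
- have -> : series (res2 y) = fun n =>
      series (fun j => scoef beta j * (y ^+ j * tailcoef T j)) n + series s n.
    apply/funext => n; rewrite /series/= -big_split/=; apply: eq_bigr => k _.
    by rewrite /s addrC subrK.
  exact: cvgD cU2 cs.
Unshelve. all: by end_near. Qed.

Definition hyp1 y k : R := rising c k * rising (alpha + k0) k * rising k0 k /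
  (rising (alpha - beta + k0 + 1) k * rising (k0 + 1) k) * (y ^+ k / k`!%:R).
Definition hyp2 y k : R := rising beta k * rising (beta - alpha + c - k0) k *
  rising (beta - alpha) k /
  (rising (beta - alpha - k0 + 1) k * rising (beta - alpha + 1) k) * (y ^+ k / k`!%:R).

Definition const1 y : R := y `^ (alpha - beta + k0) / k0 *
  Beta (alpha + k0) (beta - alpha - k0).
Definition const2 : R :=
  Beta (alpha - beta + k0) (beta - alpha + c - k0) / (beta - alpha).

Lemma res1E y k : 0 < y -> res1 y k = const1 y * hyp1 y k.
Proof.
move=> y0; rewrite /res1 Beta_shift//; last first.
  move=> i; have := exponent_neq0 i.+1 0; apply: contra => /eqP e.
  by rewrite eq_le; move: e; rewrite /e0 -natr1 => e; apply/andP; split; lra.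
rewrite /const1 /hyp1 /cA /scoef /bcoef.
have er : (k0 + k%:R)^-1 = k0^-1 * (rising k0 k / rising (k0 + 1) k).
  by rewrite rising_ratio// mulrA mulVf ?gt_eqF// mul1r.
rewrite er (_ : e0 + k%:R = alpha - beta + k0 + k%:R); last by rewrite /e0; ring.
rewrite (powR_D (alpha - beta + k0) k%:R y0) (powR_mulrn _ (ltW y0)).
rewrite (_ : 1 - (beta - alpha - k0) = alpha - beta + k0 + 1); last by ring.
rewrite invfM.
have s1 : (-1) ^+ k * (-1) ^+ k = 1 :> R by rewrite -expr2 sqrr_sign.
move: s1; move: ((-1) ^+ k : R) (y ^+ k) (k`!%:R^-1 : R) (k0^-1) => S x1 x2 x3.
move: (rising (alpha - beta + k0 + 1) k)^-1 (rising (k0 + 1) k)^-1 => x4 x5.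
abstract_atoms => s1.
by rewrite -[RHS]mulr1 -s1; ring.
Qed.

Lemma res2E y k : 0 < y -> res2 y k = const2 * hyp2 y k.
Proof.
move=> y0; rewrite /res2 Beta_shift//; last first.
  move=> i; have : (0 : R) <= i%:R by [].
  by move=> i0; apply: lt0r_neq0; move: k01 ba; lra.
rewrite /const2 /hyp2 /scoef /bcoef.
have er : (beta - alpha + k%:R)^-1 =
    (beta - alpha)^-1 * (rising (beta - alpha) k / rising (beta - alpha + 1) k).
  by rewrite (rising_ratio _ ba) mulrA mulVf ?mul1r// gt_eqF.
rewrite er (_ : 1 - (alpha - beta + k0) = beta - alpha - k0 + 1); last by ring.
rewrite (_ : c + (beta - alpha) - k0 = beta - alpha + c - k0); last by ring.
rewrite [Beta (beta - alpha + c - k0) _]BetaC.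
rewrite invfM.
have s1 : (-1) ^+ k * (-1) ^+ k = 1 :> R by rewrite -expr2 sqrr_sign.
move: s1; move: ((-1) ^+ k : R) (y ^+ k) (k`!%:R^-1 : R) ((beta - alpha)^-1) => S x1 x2 x3.
move: (rising (beta - alpha - k0 + 1) k)^-1 (rising (beta - alpha + 1) k)^-1 => x4 x5.
abstract_atoms => s1.
by rewrite -[RHS]mulr1 -s1; ring.
Qed.

Lemma has_int_integrand_hyper_lt1 y : 0 < y -> y < 1 ->
  has_int `]0, +oo[ (integrand y)
    (const1 y * limn (series (hyp1 y)) + const2 * limn (series (hyp2 y))).
Proof.
move=> y0 y1; have [V1 [V2 [h c1 c2]]] := has_int_integrand_lt1 y0 y1.
have e1 : series (res1 y) = series (fun k => const1 y * hyp1 y k).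
  by congr series; apply/funext => k; exact: res1E.
have e2 : series (res2 y) = series (fun k => const2 * hyp2 y k).
  by congr series; apply/funext => k; exact: res2E.
rewrite e1 in c1; rewrite e2 in c2.
by rewrite -(series_scale_lim c1) -(series_scale_lim c2).
Qed.

(** The ratio (y + v) / (1 + v) lies between y and 1. *)
Lemma integrand_comparison y v : 0 < y -> y <= 1 -> 0 < v ->
  y `^ `|beta| * integrand y v <= integrand 1 v <= y `^ (- `|beta|) * integrand y v.
Proof.
move=> y0 y1 v0; have v1 : 0 < 1 + v by rewrite addr_gt0.
have yv : 0 < y + v by rewrite addr_gt0.
pose r := (y + v) / (1 + v).
have r0 : 0 < r by rewrite divr_gt0.
have r1 : r <= 1 by rewrite ler_pdivrMr// mul1r lerD2r.
have yr : y <= r.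
  rewrite ler_pdivlMr// mulrDr mulr1 lerD2l; apply: ler_piMl => //; exact: ltW.
have -> : integrand y v = r `^ (- beta) * integrand 1 v.
  rewrite /integrand (_ : y + v = r * (1 + v)); last by rewrite divfK ?gt_eqF.
  rewrite (powRM _ (ltW r0) (ltW v1)).
  by move: (sbeta k0 c v) => s; abstract_upto; ring.
have K0 : 0 <= integrand 1 v.
  by apply: mulr_ge0; [exact: sbeta_ge0|apply: mulr_ge0; exact: powR_ge0].
have r01 : 0 < r <= 1 by rewrite r0.
have yy : y `^ `|beta| * y `^ (- `|beta|) = 1.
  by rewrite -(powR_D _ _ y0) subrr powRr0.
have ya : y `^ `|beta| <= r `^ `|beta|.
  by apply: ge0_ler_powR; rewrite ?nnegrE ?normr_ge0 ?(ltW y0) ?(ltW r0).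
have yp := powR_gt0 `|beta| y0.
have yn := powR_gt0 (- `|beta|) y0.
have up : r `^ (- beta) <= y `^ (- `|beta|).
  apply: (@le_trans _ _ (r `^ (- `|beta|))).
    apply: ger_powR => //; rewrite lerN2; exact: ler_norm.
  rewrite !powRN lef_pV2 ?posrE//; exact: powR_gt0.
have lo : y `^ `|beta| <= r `^ (- beta).
  apply: le_trans ya _; apply: ger_powR => //; rewrite -normrN; exact: ler_norm.
apply/andP; split; rewrite mulrA; [apply: ler_piMl|apply: ler_peMl] => //.
  by rewrite -yy; apply: ler_wpM2l => //; exact: ltW.
by rewrite -yy mulrC; apply: ler_wpM2l => //; exact: ltW.
Qed.

(** For beta + c < 2 both hypergeometric series converge absolutely at 1, so that
    the value found for y < 1 has a limit as y tends to 1; integrand_comparison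
    squeezes the integral for y = 1 between sequences with that limit. *)
Lemma has_int_integrand_hyper1 : beta + c < 2 ->
  has_int `]0, +oo[ (integrand 1)
    (const1 1 * limn (series (hyp1 1)) + const2 * limn (series (hyp2 1))).
Proof.
move=> bc.
pose y n : R := 1 - harmonic n / 2.
have h01 n : 0 < (harmonic n : R) <= 1 by rewrite harmonic_gt0 invf_le1// ler1n.
have y0 n : 0 < y n by have /andP[_ ?] := h01 n; rewrite /y; lra.
have y1 n : y n < 1 by have /andP[? _] := h01 n; rewrite /y; lra.
have cy : y @ \oo --> (1 : R).
  have : y @ \oo --> (1 - 0 / 2 : R).
    by apply: cvgB; [exact: cvg_cst|apply: cvgM; [exact: cvg_harmonic|exact: cvg_cst]].
  by rewrite mul0r subr0.
pose I z := const1 z * limn (series (hyp1 z)) + const2 * limn (series (hyp2 z)).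
have hI n : has_int `]0, +oo[ (integrand (y n)) (I (y n)) by exact: has_int_integrand_hyper_lt1.
have cI : (fun n => I (y n)) @ \oo --> I 1.
  have y01 n : 0 <= y n <= 1 by rewrite !ltW.
  apply: cvgD; apply: cvgM; last 1 first.
  - have e n : hyp2 (y n) = fun k => hyp2 1 k * y n ^+ k.
      by apply/funext => k; rewrite /hyp2 expr1n mul1r -[RHS]mulrA [_^-1 * _]mulrC.
    under eq_fun do rewrite e.
    apply: cvg_power_series_left => //; apply: hyper_summable => [i|i|].
    + have : (0 : R) <= i%:R by [].
      by move=> i0; apply: lt0r_neq0; move: k01 ba; lra.
    + have : (0 : R) <= i%:R by [].
      by move=> i0; apply: lt0r_neq0; move: ba; lra.
    + by lra.
  - apply: cvgM; last exact: cvg_cst.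
    by apply: cvgM; [exact: cvg_powR|exact: cvg_cst].
  - have e n : hyp1 (y n) = fun k => hyp1 1 k * y n ^+ k.
      by apply/funext => k; rewrite /hyp1 expr1n mul1r -[RHS]mulrA [_^-1 * _]mulrC.
    under eq_fun do rewrite e.
    apply: cvg_power_series_left => //; apply: hyper_summable => [i|i|].
    + have := exponent_neq0 i.+1 0; apply: contra => /eqP e'.
      by rewrite eq_le; move: e'; rewrite /e0 -natr1 => e'; apply/andP; split; lra.
    + have : (0 : R) <= i%:R by [].
      by move=> i0; apply: lt0r_neq0; move: k00; lra.
    + by lra.
  - exact: cvg_cst.
have mK : measurable_fun (`]0, +oo[%classic : set R) (integrand 1).
  apply: exhaustible_continuous_measurable; first exact: exh_oy.
  by move=> v /mem_oy v0; exact: continuous_integrand.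
have K0 v : 0 <= integrand 1 v.
  by apply: mulr_ge0; [exact: sbeta_ge0|apply: mulr_ge0; exact: powR_ge0].
have cmp n v (v0 : 0 < v) := integrand_comparison (y0 n) (ltW (y1 n)) v0.
have [V hV] : exists V, has_int `]0, +oo[ (integrand 1) V.
  apply: (has_int_dom (measurable_itv _) mK
    (has_int_scale (y 0%N `^ (- `|beta|)) (measurable_itv _) (hI 0%N))) => v /mem_oy v0.
  by rewrite ger0_norm//; have /andP[] := cmp 0%N v v0.
suff e : I 1 = V by rewrite -e in hV.
have cp (a : R) : (fun n => y n `^ a * I (y n)) @ \oo --> I 1.
  have cya : (fun n => y n `^ a) @ \oo --> ((1 : R) `^ a : R) by exact: cvg_powR.
  by have := cvgM cya cI; rewrite powR1r mul1r; apply.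
have lo n : y n `^ `|beta| * I (y n) <= V.
  apply: (has_int_le (measurable_itv _) (has_int_scale _ (measurable_itv _) (hI n)) hV) => v /mem_oy v0.
  by have /andP[] := cmp n v v0.
have up n : V <= y n `^ (- `|beta|) * I (y n).
  apply: (has_int_le (measurable_itv _) hV (has_int_scale _ (measurable_itv _) (hI n))) => v /mem_oy v0.
  by have /andP[] := cmp n v v0.
apply/eqP; rewrite eq_le; apply/andP; split.
  rewrite -(cvg_lim (@Rhausdorff R) (cp `|beta|)).
  by apply: limr_le; [exact: cvgP (cp _)|exact: nearW].
rewrite -(cvg_lim (@Rhausdorff R) (cp (- `|beta|))).
by apply: limr_ge; [exact: cvgP (cp _)|exact: nearW].
Qed.

End parameters.
End connection.

(** * The hyperbolic sine over its whole range *)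

Section hyperbolic_sine_full.
Context {R : realType}.
Notation mu := (@lebesgue_measure R).
Local Opaque powR expR Gamma_pos Gamma Beta sbeta.
Context (p q : R) (hp : 1 < p) (hq : 1 < q).
Implicit Types (alpha beta x u v w y t r : R).

Let p0 : 0 < p := lt_trans ltr01 hp.
Let q0 : 0 < q := lt_trans ltr01 hq.
Let iq0 : 0 < q^-1. Proof. by rewrite invr_gt0. Qed.
Let iq1 : q^-1 < 1. Proof. by rewrite invf_lt1. Qed.
Let qn0 : q != 0 := lt0r_neq0 q0.
Let pn0 : p != 0 := lt0r_neq0 p0.

(** In the variable v = sinh^q t the powers of 1 + v coming from cosh and from
    dt cancel, which leaves the integral of integrand. *)
Lemma sinh_integral_full alpha beta x :
  - 1 < q * alpha -> q * (alpha - beta) - Num.min 1 (q / p) < - 1 ->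
   (forall n : nat, beta - alpha - q^-1 != n%:R) ->
   0 < x -> (x%:E < hpihat p q)%E -> sinhpq p q x <= 1 ->
   (sinhpq p q x = 1 -> beta + p^-1 < 2) ->
   (\int[mu]_(t in [set t : R | (0 < t)%R /\ t%:E < hpihat p q])
      (t * coshpq p q t * sinhpq p q t `^ (alpha * q - 1)
       / (sinhpq p q x `^ q + sinhpq p q t `^ q) `^ beta)%:E)%E
   = (sinhpq p q x `^ (q * (alpha - beta) + 1) / q
      * Beta (alpha + q^-1) (beta - alpha - q^-1)
      * hyper3F2 p^-1 (alpha + q^-1) q^-1
          (alpha - beta + q^-1 + 1) (q^-1 + 1)
          (sinhpq p q x `^ q)
      + Beta (alpha - beta + q^-1) (beta - alpha + p^-1 - q^-1)
        / (q ^+ 2 * (beta - alpha))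
        * hyper3F2 beta (beta - alpha + p^-1 - q^-1) (beta - alpha)
            (beta - alpha - q^-1 + 1) (beta - alpha + 1)
            (sinhpq p q x `^ q))%:E.
Proof.
move=> qa gap nonint x0 xh.
have [u u0 ux] := arcsinh_surj hq (ltW x0) xh.
rewrite -ux (sinh_arcsinh hp hq u0) => u1 uE.
have up : 0 < u.
  rewrite lt_neqAle u0 andbT; apply/eqP => u00.
  by move: x0; rewrite -ux -u00 arcsinh0 ltxx.
pose y := u `^ q.
have y0 : 0 < y by apply: powR_gt0.
have y1 : y <= 1.
  rewrite -(powR1r q); apply: ge0_ler_powR; rewrite ?nnegrE ?(ltW q0) ?ler01//.
have ak : 0 < alpha + q^-1.
  by rewrite -(pmulr_rgt0 _ q0) mulrDr mulfV//; move: qa; lra.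
have m1 : Num.min 1 (q / p) <= 1 by rewrite ge_min lexx.
have m2 : Num.min 1 (q / p) <= q / p by rewrite ge_min lexx orbT.
have ba : 0 < beta - alpha.
  rewrite -(pmulr_rgt0 _ q0) -opprB mulrN oppr_gt0.
  by move: gap m1; move: (Num.min _ _) => m; move: (q * _) => z; lra.
have bac : 0 < p^-1 + (beta - alpha) - q^-1.
  rewrite -(pmulr_rgt0 _ q0).
  have -> : q * (p^-1 + (beta - alpha) - q^-1) = q / p - q * (alpha - beta) - 1.
    by field; rewrite pn0 qn0.
  by move: gap m2; move: (Num.min _ _) => m; move: (q * _) (q / p) => z1 z2; lra.
have K : has_int `]0, +oo[ (integrand q^-1 p^-1 alpha beta y)
    (const1 q^-1 alpha beta y * limn (series (hyp1 q^-1 p^-1 alpha beta y)) +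
     const2 q^-1 p^-1 alpha beta * limn (series (hyp2 q^-1 p^-1 alpha beta y))).
  have [yE|yn1] := eqVneq y 1.
    rewrite yE; apply: has_int_integrand_hyper1 => //; apply: uE.
    by rewrite -[LHS](powR_powR u0 qn0) -/y yE powR1r.
  by apply: has_int_integrand_hyper_lt1 => //; rewrite lt_neqAle yn1.
pose F v := q^-1 * sbeta q^-1 p^-1 v.
have FE v : 0 <= v -> arcsinhpq p q (v `^ q^-1) = F v by exact: arcsinh_root.
pose phi v := q^-1 * (v `^ (q^-1 - 1) * (1 + v) `^ (- p^-1)).
have dF v : 0 < v -> is_derive v 1 F (phi v).
  move=> v0; apply: isd_eq (isd_mul (isd_cst q^-1 v) (is_derive_sbeta p^-1 iq0 v0)) _.
  by rewrite mulr0 addr0.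
pose g v := F v * (1 + v) `^ p^-1 * (v `^ q^-1) `^ (alpha * q - 1) * (y + v) `^ (- beta).
set W := (X in _ = X%:E).
suff : has_int [set t : R | (0 < t)%R /\ (t%:E < hpihat p q)%E]
   (fun t => t * coshpq p q t * sinhpq p q t `^ (alpha * q - 1)
       / (y + sinhpq p q t `^ q) `^ beta) W by move=> [].
apply/(@has_int_subst _ `]0, +oo[ _ F phi _ g).
- exact: exh_oy.
- by move=> v /mem_oy v0; exact: dF.
- by move=> v /mem_oy v0; apply: ct_mul; [exact: ct_cst|exact: continuous_sbeta_fun].
- left => v /mem_oy v0; apply: mulr_gt0 => //; apply: mulr_gt0; apply: powR_gt0 => //.
  exact: addr_gt0.
- move=> v /mem_oy v0; apply: ct_mul; last first.
    apply: (ct_powR (f := fun v => y + v)); first exact: addr_gt0.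
    by apply: ct_add; [exact: ct_cst|exact: ct_id].
  apply: ct_mul; last first.
    apply: (ct_powR (f := fun v => v `^ q^-1)); first exact: powR_gt0.
    by apply: ct_powR => //; exact: ct_id.
  apply: ct_mul; first exact: isd_continuous (dF _ v0).
  apply: (ct_powR (f := fun v => 1 + v)); first exact: addr_gt0.
  by apply: ct_add; [exact: ct_cst|exact: ct_id].
- move=> v /mem_oy v0; apply: mulr_ge0; last exact: powR_ge0.
  apply: mulr_ge0; last exact: powR_ge0.
  apply: mulr_ge0; last exact: powR_ge0.
  by apply: mulr_ge0; [exact: ltW|exact: sbeta_ge0].
- move=> v /mem_oy v0; have h3 := powR_ge0 v q^-1; split.
    split; last by rewrite -FE ?(ltW v0)//; exact: arcsinh_lt_hpihat.
    rewrite -FE ?(ltW v0)// -[X in X < _](arcsinh0 p q).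
    by apply: arcsinh_lt => //; exact: powR_gt0.
  rewrite -[X in X * coshpq _ _ _](FE _ (ltW v0)) -(FE _ (ltW v0)).
  rewrite (sinh_arcsinh hp hq h3) (cosh_arcsinh hp hq h3).
  rewrite (powR_powRV (ltW v0) qn0) /g -(FE _ (ltW v0)).
  by rewrite (powRN (y + v)).
- move=> t [t0 th].
  have [w w0 wt] := arcsinh_surj hq (ltW t0) th.
  exists (w `^ q); last by rewrite -FE ?powR_ge0// (powR_powR w0 qn0).
  apply/mem_oy; apply: powR_gt0; rewrite lt_neqAle w0 andbT; apply/eqP => w00.
  by move: t0; rewrite -wt -w00 arcsinh0 ltxx.
have -> : W = q^-1 ^+ 2 *
    (const1 q^-1 alpha beta y * limn (series (hyp1 q^-1 p^-1 alpha beta y)) +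
     const2 q^-1 p^-1 alpha beta * limn (series (hyp2 q^-1 p^-1 alpha beta y))).
  rewrite /W /const1 /const2 -/y.
  have -> : u `^ (q * (alpha - beta) + 1) = y `^ (alpha - beta + q^-1).
    by rewrite /y -powRrM [q * (_ + q^-1)]mulrDr mulfV.
  rewrite -[limn (series (hyp1 _ _ _ _ _))]/(hyper3F2 p^-1 (alpha + q^-1) q^-1
    (alpha - beta + q^-1 + 1) (q^-1 + 1) y).
  rewrite -[limn (series (hyp2 _ _ _ _ _))]/(hyper3F2 beta (beta - alpha + p^-1 - q^-1)
    (beta - alpha) (beta - alpha - q^-1 + 1) (beta - alpha + 1) y).
  have ac (A1 A2 A3 A4 A5 d : R) : d != 0 ->
      A1 / q * A2 * A3 + A4 / (q ^+ 2 * d) * A5 =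
      q^-1 ^+ 2 * (A1 / q^-1 * A2 * A3 + A4 / d * A5).
    by move=> d0; field; rewrite d0 qn0.
  exact: ac (lt0r_neq0 ba).
apply: has_int_eq (has_int_scale (q^-1 ^+ 2) (measurable_itv _) K) => // v /mem_oy v0.
have v1 : 0 < 1 + v by rewrite addr_gt0.
rewrite ger0_norm; last first.
  apply: mulr_ge0; first exact: ltW.
  by apply: mulr_ge0; exact: powR_ge0.
rewrite /integrand /g /F /phi.
have -> : v `^ (alpha - 1) = (v `^ q^-1) `^ (alpha * q - 1) * v `^ (q^-1 - 1).
  by rewrite -powRrM -(powR_D _ _ v0); congr (_ `^ _); field.
have e : (1 + v) `^ p^-1 * (1 + v) `^ (- p^-1) = 1 by rewrite -(powR_D _ _ v1) subrr powRr0.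
move: e; move: (sbeta _ _ v) => s; move: (q^-1) => iq.
by abstract_upto => e; rewrite -[LHS]mulr1 -e; ring.
Qed.

End hyperbolic_sine_full.

Theorem corollary5 (R : realType) (p q alpha beta : R)
    (hp : 1 < p) (hq : 1 < q) :
  (alpha < 2 -> beta < 1 ->
   forall x : R, 0 < x -> x <= hpi p q ->
   (\int[lebesgue_measure]_(t in `]0%R, x[)
      (t * sinpq p q t `^ (- alpha) * cospq p q t
       / (sinpq p q x `^ q - sinpq p q t `^ q) `^ beta)%:E)%E
   = (q^-1 * Beta ((2 - alpha) / q) (1 - beta)
      * sinpq p q x `^ (2 - alpha - q * beta)
      * hyper3F2 p^-1 ((2 - alpha) / q) q^-1
          ((2 - alpha) / q + 1 - beta) (q^-1 + 1)
          (sinpq p q x `^ q))%:E)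
  /\
  (alpha < 1 -> beta < 1 ->
   forall x : R, 0 <= x -> x < hpi p q ->
   (\int[lebesgue_measure]_(t in `]x, hpi p q[)
      (t * sinpq p q t `^ (q - 1) * cospq p q t `^ (2 - p - alpha)
       / (cospq p q x `^ p - cospq p q t `^ p) `^ beta)%:E)%E
   = (cospq p q x `^ (1 - alpha - p * beta) / q ^+ 2
      * Beta ((p - 1) / p) q^-1 * Beta ((1 - alpha) / p) (1 - beta)
      - p * cospq p q x `^ (p * (1 - beta) - alpha) / (q ^+ 2 * (p - 1))
        * Beta (1 - alpha / p) (1 - beta)
        * hyper3F2 (1 - q^-1) (1 - alpha / p) ((p - 1) / p)
            (2 - alpha / p - beta) ((2 * p - 1) / p)
            (cospq p q x `^ p))%:E)
  /\
  (- 1 < q * alpha -> q * (alpha - beta) - Num.min 1 (q / p) < - 1 ->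
   (forall n : nat, beta - alpha - q^-1 != n%:R) ->
   forall x : R, 0 < x -> (x%:E < hpihat p q)%E -> sinhpq p q x <= 1 ->
   (sinhpq p q x = 1 -> beta + p^-1 < 2) ->
   (\int[lebesgue_measure]_(t in [set t : R | (0 < t)%R /\ t%:E < hpihat p q])
      (t * coshpq p q t * sinhpq p q t `^ (alpha * q - 1)
       / (sinhpq p q x `^ q + sinhpq p q t `^ q) `^ beta)%:E)%E
   = (sinhpq p q x `^ (q * (alpha - beta) + 1) / q
      * Beta (alpha + q^-1) (beta - alpha - q^-1)
      * hyper3F2 p^-1 (alpha + q^-1) q^-1
          (alpha - beta + q^-1 + 1) (q^-1 + 1)
          (sinhpq p q x `^ q)
      + Beta (alpha - beta + q^-1) (beta - alpha + p^-1 - q^-1)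
        / (q ^+ 2 * (beta - alpha))
        * hyper3F2 beta (beta - alpha + p^-1 - q^-1) (beta - alpha)
            (beta - alpha - q^-1 + 1) (beta - alpha + 1)
            (sinhpq p q x `^ q))%:E)
  /\
  (p < q -> beta < 1 -> 1 < (alpha + beta) * p ->
   forall x : R, 0 <= x -> (x%:E < hpihat p q)%E ->
   (\int[lebesgue_measure]_(t in [set t : R | (x < t)%R /\ t%:E < hpihat p q])
      (t * sinhpq p q t `^ (q - 1) * coshpq p q t `^ (2 - p * (alpha + 1))
       / (coshpq p q t `^ p - coshpq p q x `^ p) `^ beta)%:E)%E
   = (coshpq p q x `^ (1 - p * (alpha + beta)) / q ^+ 2
      * Beta (p^-1 - q^-1) q^-1 * Beta (1 - beta) (beta + alpha - p^-1)
      + coshpq p q x `^ (p / q - p * (alpha + beta)) / (q * (1 - q / p))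
        * Beta (beta + alpha - q^-1) (1 - beta)
        * hyper3F2 (1 - q^-1) (beta + alpha - q^-1) (p^-1 - q^-1)
            (alpha + 1 - q^-1) (p^-1 - q^-1 + 1)
            (coshpq p q x `^ (- p)))%:E).
Proof.
split; [|split; [|split]].
- move=> a2 b1 x x0 xp; exact: sine_integral_left.
- move=> a1 b1 x x0 xp; exact: sine_integral_right.
- move=> qa gap nonint x; exact: sinh_integral_full.
- move=> pq b1 ab x; exact: sinh_integral_tail.
Qed.
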